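(* For each integer $m\ge 3$ and each $\ell\in\{1,\dots,m-2\}$ there exists a function $u\in C^\infty_c(\mathbb{R}^m)$ with the following properties. (i) The set $K$ of light segments of $u$ is a closed cylinder $\overline{B}^{\ell-1}\times[a,b]$ (with $a<b$, and $\overline{B}^{\ell-1}$ a closed ball of positive radius in $\mathbb{R}^{\ell-1}$) contained in an $\ell$-dimensional affine subspace of $\mathbb{R}^m$ identified isometrically with $\mathbb{R}^{\ell-1}\times\mathbb{R}$ (in particular, if $\ell=1$, $K$ is a single light segment), and $|Du|<1$ on $\mathbb{R}^m\setminus K$. (ii) There is a function $\rho_u$, belonging to $L^q(\mathbb{R}^m)$ for each $q\in[1,m-\ell)$, such that $$\int_{\mathbb{R}^m}\frac{Du\cdot D\eta}{\sqrt{1-|Du|^2}}\,dx=\int_{\mathbb{R}^m}\rho_u\,\eta\,dx\qquad\text{for all Lipschitz functions }\eta\text{ with compact support in }\mathbb{R}^m .$$ In particular, if $\Omega\subset\mathbb{R}^m$ is a bounded domain containing the support of $u$, then the restriction of $u$ to $\Omega$ is a weak solution of $-\mathrm{div}\big(Du/\sqrt{1-|Du|^2}\big)=\rho_u$ in $\Omega$, $u=0$ on $\partial\Omega$. (iii) With $w=(1-|Du|^2)^{-1/2}$, for each $q\in[1,m-\ell)$ one has $w\in L^q_{\mathrm{loc}}(\mathbb{R}^m)$ and $$w|D^2u|,\quad w^2|D^2u(Du,\cdot)|,\quad w^3D^2u(Du,Du)\ \in L^q(\mathbb{R}^m).$$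
   Context: $D,D^2$ denote Euclidean gradient and Hessian, $|\cdot|$ the Euclidean norm. For $u$ with $|Du|\le1$, a light segment of $u$ is a closed segment $\overline{xy}$ with $x\ne y$ and $|u(x)-u(y)|=|x-y|$. The set of light segments of $u$ is the closure of the union of all such segments. Weak solution: for a bounded domain $\Omega\subset\mathbb{R}^m$ and a function $\rho$, a weak solution of $-\mathrm{div}(Du/\sqrt{1-|Du|^2})=\rho$ in $\Omega$, $u=0$ on $\partial\Omega$, is a function $u\in W^{1,\infty}(\Omega)$ with $|Du|\le 1$ a.e., $u=0$ on $\partial\Omega$, such that $w=(1-|Du|^2)^{-1/2}\in L^1_{\mathrm{loc}}(\Omega)$ and $\int_\Omega w\,Du\cdot D\eta\,dx=\int_\Omega\rho\,\eta\,dx$ for every Lipschitz $\eta$ with compact support in $\Omega$. *)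

(* Defs.v *)
From HB Require Import structures.
From mathcomp Require Import all_boot all_order all_algebra.
From mathcomp Require Import all_classical all_reals all_analysis.
From mathcomp Require Import measurable_realfun.

Set Implicit Arguments.
Unset Strict Implicit.
Unset Printing Implicit Defensive.

Import Order.TTheory GRing.Theory Num.Theory.
Import numFieldNormedType.Exports.

Local Open Scope classical_set_scope.
Local Open Scope ring_scope.

(* The product sigma-algebra on R^n, generated by the coordinates; it is the
   Borel sigma-algebra. *)
Definition measure_row_display : measure_display.
Proof. exact: default_measure_display. Qed.

Section measurable_row.
Context {R : realType} (n : nat).

Definition row_coord (i : 'I_n) (x : 'rV[R]_n) : R := x ord0 i.

Let row_set0 : g_sigma_preimage row_coord set0.
Proof. exact: sigma_algebra0. Qed.

Let row_setC A : g_sigma_preimage row_coord A ->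
  g_sigma_preimage row_coord (~` A).
Proof. exact: sigma_algebraC. Qed.

Let row_bigcup (F : (set 'rV[R]_n)^nat) :
  (forall i, g_sigma_preimage row_coord (F i)) ->
  g_sigma_preimage row_coord (\bigcup_i (F i)).
Proof. exact: sigma_algebra_bigcup. Qed.

HB.instance Definition _ := @isMeasurable.Build measure_row_display
  'rV[R]_n (g_sigma_preimage row_coord) row_set0 row_setC row_bigcup.

Lemma measurable_row_coord (i : 'I_n) : measurable_fun setT (row_coord i).
Proof.
move=> _ Y mY; rewrite setTI; apply: sub_sigma_algebra => /=.
rewrite -bigcup_seq/=; exists i => /=; first by rewrite mem_index_enum.
by exists Y => //; rewrite setTI.
Qed.

Lemma measurable_fun_rowP d (T : measurableType d) (f : T -> 'rV[R]_n) :
  measurable_fun setT f <->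
  forall i, measurable_fun setT (row_coord i \o f).
Proof.
apply: (@iff_trans _ (g_sigma_preimage
    (fun i => row_coord i \o f) `<=` measurable)).
  rewrite g_sigma_preimage_comp; split=> [mf A [/= C preC <-]|prefS].
    exact: mf.
  by move=> _ A mA; apply: prefS; exists A.
split=> [rS i|mf].
- move=> _ A mA; apply: rS; apply: sub_sigma_algebra => /=.
  rewrite -bigcup_seq/=; exists i => /=; first by rewrite mem_index_enum.
  by exists A.
- apply: smallest_sub; first exact: sigma_algebra_measurable.
  rewrite -bigcup_seq/=; apply: bigcup_sub => i _ A [B mB <-].
  exact: mf.
Qed.

End measurable_row.

Section lebesgue_row.
Context {R : realType}.

Definition row_cons n (p : R * 'rV[R]_n) : 'rV[R]_n.+1 :=
  row_mx (p.1%:M : 'rV[R]_1) p.2.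

Lemma row_cons0 n p : @row_cons n p ord0 ord0 = p.1.
Proof.
have := row_mxEl (p.1%:M : 'rV[R]_1) p.2 ord0 ord0.
rewrite [X in _ = X]mxE eqxx mulr1n => <-; congr (row_mx _ _ _ _); exact/val_inj.
Qed.

Lemma row_consS n p i : @row_cons n p ord0 (lift ord0 i) = p.2 ord0 i.
Proof.
rewrite -(row_mxEr (p.1%:M : 'rV[R]_1) p.2 ord0 i).
congr (row_mx _ _ _ _); exact/val_inj.
Qed.

Lemma measurable_row_cons n : measurable_fun setT (@row_cons n).
Proof.
apply/measurable_fun_rowP => i; case: (unliftP ord0 i) => [j|] ->.
  rewrite (_ : _ \o _ = row_coord j \o snd); last first.
    by apply/funext => p /=; rewrite /row_coord row_consS.
  by apply: measurableT_comp => //; exact: measurable_row_coord.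
rewrite (_ : _ \o _ = fst) //.
by apply/funext => p /=; rewrite /row_coord row_cons0.
Qed.

Section step.
Variables (n : nat) (mu : {sigma_finite_measure set 'rV[R]_n -> \bar R}).

Definition lebesgue_row_step : set 'rV[R]_n.+1 -> \bar R :=
  pushforward ((@lebesgue_measure R) \x mu)%E (@row_cons n).

HB.instance Definition _ := Measure.copy lebesgue_row_step
  (measure_function_pushforward__canonical__measure_function_Measure
     ((@lebesgue_measure R) \x mu)%E (@measurable_row_cons n)).

Let row_uncons (x : 'rV[R]_n.+1) : R * 'rV[R]_n :=
  (x ord0 ord0, \row_i x ord0 (lift ord0 i)).

Let row_unconsK p : row_uncons (row_cons p) = p.
Proof.
case: p => a y; rewrite /row_uncons row_cons0; congr (_, _).
by apply/rowP => i; rewrite mxE row_consS.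
Qed.

Let measurable_row_uncons : measurable_fun setT row_uncons.
Proof.
apply/measurable_fun_pairP; split; first exact: (measurable_row_coord ord0).
apply/measurable_fun_rowP => i.
rewrite (_ : _ \o _ = row_coord (lift ord0 i)); first exact: measurable_row_coord.
by apply/funext => x; rewrite /row_coord /= mxE.
Qed.

Let lebesgue_row_step_sigma_finite : sigma_finite setT lebesgue_row_step.
Proof.
have /sigma_finiteP[F [TF ndF Foo]] := sigma_finiteT (@lebesgue_measure R).
have /sigma_finiteP[G [TG ndG Goo]] := sigma_finiteT mu.
exists (fun k => row_uncons @^-1` (F k `*` G k)).
  rewrite -preimage_bigcup (_ : \bigcup_k _ = setT) ?preimage_setT//.
  apply/seteqP; split => // -[x y] _.
  have [k _ Fkx] : (\bigcup_k F k) x by rewrite -TF.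
  have [j _ Gjy] : (\bigcup_k G k) y by rewrite -TG.
  exists (maxn k j) => //; split => /=.
  - by move: x Fkx; exact/subsetPset/ndF/leq_maxl.
  - by move: y Gjy; exact/subsetPset/ndG/leq_maxr.
move=> k; have [mF Fk] := Foo k; have [mG Gk] := Goo k; split.
  by rewrite -[X in measurable X]setTI; apply: measurable_row_uncons => //;
    exact: measurableX.
rewrite /lebesgue_row_step /pushforward -comp_preimage.
rewrite (_ : _ \o _ = id); last by apply/funext => p /=; rewrite row_unconsK.
by rewrite preimage_id product_measure1E// lte_mul_pinfty// ge0_fin_numE.
Qed.

HB.instance Definition _ := Measure_isSigmaFinite.Build _ _ _
  lebesgue_row_step lebesgue_row_step_sigma_finite.

End step.

(* Lebesgue measure on R^n: the n-fold product of lebesgue_measure. *)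
Fixpoint lebesgue_row (n : nat) : {sigma_finite_measure set 'rV[R]_n -> \bar R} :=
  match n with
  | 0 => \d_(0 : 'rV[R]_0)
  | n'.+1 => lebesgue_row_step (lebesgue_row n')
  end.

Lemma measurable_row_box n (A : 'I_n -> set R) :
  (forall i, measurable (A i)) ->
  measurable [set x : 'rV[R]_n | forall i, A i (x ord0 i)].
Proof.
move=> mA; rewrite (_ : [set _ | _] =
    \big[setI/setT]_(i < n) (row_coord i @^-1` A i)).
  apply: big_ind => //; first exact: measurableI.
  by move=> i _; rewrite -[X in measurable X]setTI; exact: measurable_row_coord.
rewrite -bigcap_seq; apply/seteqP; split => x /= h i.
  by move=> _; exact: h.
exact: (h i (mem_index_enum i)).
Qed.

Lemma lebesgue_row_box n (A : 'I_n -> set R) :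
  (forall i, measurable (A i)) ->
  lebesgue_row n [set x | forall i, A i (x ord0 i)] =
  (\prod_(i < n) lebesgue_measure (A i))%E.
Proof.
elim: n => [|n IHn] in A * => mA.
  by rewrite big_ord0 /= diracE mem_set //=; case.
rewrite big_ord_recl -IHn // /= /lebesgue_row_step /pushforward.
rewrite -product_measure1E; [|exact: mA|]; last first.
  exact: (@measurable_row_box n (fun i => A (lift ord0 i))).
apply: (f_equal (product_measure1 _ _)).
apply/seteqP; split => -[a y] /=.
  move=> h; split; first by have := h ord0; rewrite row_cons0.
  by move=> i; have := h (lift ord0 i); rewrite row_consS.
by case=> ha hy i; case: (unliftP ord0 i) => [j|] ->;
  rewrite ?row_consS ?row_cons0.
Qed.

End lebesgue_row.

Section defs.
Context {R : realType} {m : nat}.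
Implicit Types (u eta rho : 'rV[R]_m -> R) (g : 'rV[R]_m -> 'rV[R]_m).
Implicit Types (f : 'rV[R]_m -> \bar R) (D Omega K : set 'rV[R]_m).

Local Notation mu := (@lebesgue_row R m).

(* The library norm on matrices is the sup norm, hence the Euclidean one. *)
Definition dotp n (x y : 'rV[R]_n) : R := \sum_i x ord0 i * y ord0 i.
Definition enorm n (x : 'rV[R]_n) : R := Num.sqrt (dotp x x).
Definition hsnorm (A : 'M[R]_m) : R := Num.sqrt (\sum_i \sum_j A i j ^+ 2).

Definition basis_row (i : 'I_m) : 'rV[R]_m := delta_mx ord0 i.
Definition partial (i : 'I_m) u : 'rV[R]_m -> R := fun x => 'D_(basis_row i) u x.
Definition grad u (x : 'rV[R]_m) : 'rV[R]_m := \row_i partial i u x.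
Definition hessian u (x : 'rV[R]_m) : 'M[R]_m :=
  \matrix_(i, j) partial i (partial j u) x.

(* C^infinity: the iterated partial derivatives of all orders exist and are
   continuous. *)
Definition smooth u := forall s : seq 'I_m,
  continuous (foldr partial u s) /\
  forall i x, derivable (foldr partial u s) x (basis_row i).

Definition supp u : set 'rV[R]_m := closure [set x | u x != 0].
Definition compact_supp_in Omega u := compact (supp u) /\ supp u `<=` Omega.

(* Equivalence of norms makes the library's Lipschitz condition, for the sup
   norm, the Euclidean one. *)
Definition lipschitz_test Omega eta :=
  [lipschitz eta x | x in setT] /\ compact_supp_in Omega eta.

Definition in_Lp (p : \bar R) D f :=
  measurable_fun D f /\ ('N[mu]_p[f \_ D] < +oo)%E.
Definition in_Lp_loc (p : \bar R) D f :=
  forall C, compact C -> C `<=` D -> in_Lp p C f.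

Definition weak_gradient Omega u g :=
  forall phi, smooth phi -> compact_supp_in Omega phi -> forall i,
  (\int[mu]_(x in Omega) (u x * partial i phi x)%:E =
   - \int[mu]_(x in Omega) (g x ord0 i * phi x)%:E)%E.

Definition W1infty Omega u g :=
  [/\ in_Lp +oo Omega (EFin \o u),
      forall i, in_Lp +oo Omega (fun x => (g x ord0 i)%:E) &
      weak_gradient Omega u g].

(* The boundary condition u = 0 is understood for the continuous
   representative of u in Omega. *)
Definition zero_on_boundary Omega u :=
  exists v : 'rV[R]_m -> R,
    [/\ {in Omega, continuous v},
        {ae mu, forall x, Omega x -> v x = u x} &
        forall y, (closure Omega `\` Omega) y -> v @ within Omega (nbhs y) --> 0].

(* w = (1 - |g|^2)^(-1/2), with value +oo where |g| >= 1. *)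
Definition weight g (x : 'rV[R]_m) : \bar R :=
  ((Num.sqrt (1 - enorm (g x) ^+ 2))%:E^-1)%E.

Definition weak_equation Omega g rho :=
  forall eta, lipschitz_test Omega eta ->
  (\int[mu]_(x in Omega) (weight g x * (dotp (g x) (grad eta x))%:E) =
   \int[mu]_(x in Omega) (rho x * eta x)%:E)%E.

Definition bounded_domain Omega :=
  [/\ open Omega, connected Omega, Omega !=set0 & bounded_set Omega].

(* The integrals of rho * eta make sense for all test functions eta when rho
   is locally integrable. *)
Definition weak_solution Omega rho u :=
  in_Lp_loc 1%E Omega (EFin \o rho) /\
  exists g,
    [/\ W1infty Omega u g,
        {ae mu, forall x, Omega x -> enorm (g x) <= 1},
        zero_on_boundary Omega u,
        in_Lp_loc 1%E Omega (weight g) &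
        weak_equation Omega g rho].

Definition segment (x y : 'rV[R]_m) : set 'rV[R]_m :=
  [set (1 - t) *: x + t *: y | t in `[0, 1]].
Definition light_segment u (x y : 'rV[R]_m) :=
  x != y /\ `|u x - u y| = enorm (x - y).
Definition light_set u : set 'rV[R]_m :=
  closure (\bigcup_(p in [set p | light_segment u p.1 p.2]) segment p.1 p.2).

(* (y, t) |-> p + (y, t) A, where the rows of A are orthonormal, identifies
   R^(l-1) x R isometrically with an l-dimensional affine subspace; used for
   l >= 1 only. *)
Definition closed_cylinder (l : nat) K :=
  exists (p : 'rV[R]_m) (A : 'M[R]_(l.-1 + 1, m)) (c : 'rV[R]_l.-1) (r a b : R),
    [/\ A *m A^T = 1%:M, 0 < r, a < b &
        K = [set p + row_mx yt.1 (yt.2%:M : 'rV[R]_1) *m A |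
              yt in [set y | enorm (y - c) <= r] `*` `[a, b]]].

End defs.

(* Main.v *)
(* Write x = (y, t, z) with y in R^(l-1) and z in R^(m-l), and take
   u(x) = a(t) b(y, z).  The axial profile satisfies a(t) = t for |t| <= T,
   |a'| < 1 elsewhere, and |a''| <= C_e (1 - a'^2)^(1-e) for every e > 0; the
   transverse bump b equals 1 exactly on {|y| <= 1, z = 0} and obeys
   1 - b >= min(z_i^2, 1)/2 and |Db|^2 <= C (1 - b).  If a is small, then
   F = 1 - |Du|^2 >= b^2 (1 - a'^2) + (1 - b)/2, so F vanishes only on the
   cylinder K = {|y| <= 1, |t| <= T, z = 0} and F >= c min(z_i^2, 1).

   Differentiating, |D^2u(Du, .)| <= C F^(1/2) and |D^2u(Du, Du)| <= C_e F^(1-e),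
   so that w = F^(-1/2), w |D^2u|, w^2 |D^2u(Du, .)| and w^3 D^2u(Du, Du) are all
   O(F^(-1/2-e)).  As F^(m-l) >= c prod_i min(z_i^2, 1), a negative power
   F^(-r) is bounded by a product of powers |z_i|^(-2r/(m-l)), which is locally
   integrable once 2r < m-l.

   The equation is obtained by replacing F with F + c, integrating by parts one
   coordinate at a time, and letting c -> 0 by dominated convergence.  Along a
   light segment t |-> u(x + tv) has the maximal slope |v|, which forces |Du| = 1
   there; hence light segments lie in K, and the lines of K parallel to the t-axis
   are light segments. *)

Require Import Defs.
From HB Require Import structures.
From mathcomp Require Import all_boot all_order all_algebra.
From mathcomp Require Import all_classical all_reals all_analysis.
From mathcomp Require Import measurable_realfun.
From mathcomp Require Import ring lra.
Set Implicit Arguments.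
Unset Strict Implicit.
Unset Printing Implicit Defensive.
Import Order.TTheory GRing.Theory Num.Theory.
Import numFieldNormedType.Exports.
Local Open Scope classical_set_scope.
Local Open Scope ring_scope.

(** * Integration by parts against Lipschitz functions on the line *)

(** The arbitrarily small loss e comes from the flat function exp(-1/t): each derivative multiplies
    it by a polynomial in 1/t, which is bounded only by a multiple of exp(e/t). The estimate of
    |Db|^2 is Glaeser's inequality for the nonnegative function 1 - b: if the second derivative is
    bounded, the squared slope is at most a multiple of the value. Making a small costs nothing in
    slope, since t |-> c a(t/c) has the slopes of a. The obstacle to integrating by parts is that
    the test functions are only Lipschitz, while [grad eta] consists of directional derivatives that
    default to 0 where they do not exist. What is needed on each line is that a Lipschitz function
    is almost everywhere derivable and is the integral of its derivative; this is drawn from the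
    Radon-Nikodym theorem and Lebesgue differentiation. To combine the lines by Fubini, the
    directional derivatives must be shown measurable. Where F = 0, real powers of F with nonzero
    exponent have the value 0 whereas [weight] is +oo; the two readings agree almost everywhere
    because {F = 0} is a null set. *)

Section lipschitz_density.
Context {R : realType}.
Variables (G : R -> R) (L M : R).
Hypothesis L0 : 0 < L.
Hypothesis M1 : 1 <= M.
Hypothesis Glip : forall x y, `|G x - G y| <= L * `|x - y|.
Hypothesis Gsupp : forall x, M <= `|x| -> G x = 0.

Local Notation leb := (@lebesgue_measure R).

Definition clampM (x : R) : R := Num.min (Num.max x (- M)) M.

Lemma clampMP x : [\/ x <= - M /\ clampM x = - M,
  - M <= x <= M /\ clampM x = x | M <= x /\ clampM x = M].
Proof.
rewrite /clampM minEle maxEle; have ? := M1.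
have [xM|Mx] := leP x (- M); first by rewrite ifT; [constructor 1|lra].
by have [xM'|Mx'] := leP x M; [constructor 2|constructor 3]; split; lra.
Qed.

Lemma clampM_nd x y : x <= y -> 0 <= clampM y - clampM x <= y - x.
Proof.
move=> xy; have ? := M1.
by case: (clampMP x) => -[h1 ->]; case: (clampMP y) => -[h2 ->]; lra.
Qed.

(** Adding a ramp of slope L makes G nondecreasing, and dividing by 2LM turns the total rise into 1.
    The slope is then at most 1/M <= 1, so [x - lipF x] is nondecreasing too and both functions
    define Stieltjes measures. *)
Definition lipF (x : R) : R := (2 * L * M)^-1 * (G x + L * (clampM x + M)).

Lemma lip_in x y : x <= y ->
  0 <= (G y + L * (clampM y + M)) - (G x + L * (clampM x + M)) <= 2 * L * (y - x).
Proof.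
move=> xy; have /andP[c1 c2] := clampM_nd xy.
have : `|G y - G x| <= L * (clampM y - clampM x).
  have GE z : G z = G (clampM z).
    have ? := M1.
    by case: (clampMP z) => -[h ->] //; rewrite !Gsupp//; rewrite ler_normr; lra.
  rewrite (GE x) (GE y) (le_trans (Glip _ _))// ler_pM2l//.
  by rewrite ger0_norm.
rewrite ler_norml => /andP[h1 h2].
have h : L * (clampM y - clampM x) <= L * (y - x) by rewrite ler_pM2l.
by apply/andP; split; lra.
Qed.

Lemma lip_diff x y : x <= y -> 0 <= lipF y - lipF x <= y - x.
Proof.
move=> xy; have /andP[h1 h2] := lip_in xy.
rewrite /lipF -mulrBr; have M0 : 0 < M by have := M1; lra.
have h : 0 < 2 * L * M by rewrite !mulr_gt0.
apply/andP; split; first by rewrite mulr_ge0// invr_ge0 ltW.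
rewrite mulrC ler_pdivrMr// (le_trans h2)//.
have : 0 <= (y - x) * L * (M - 1) by rewrite !mulr_ge0 ?subr_ge0// ltW.
lra.
Qed.

Lemma lipF_nd : nondecreasing lipF.
Proof. by move=> x y /lip_diff /andP[]; rewrite subr_ge0. Qed.

Lemma lipFc_nd : nondecreasing (fun x => x - lipF x).
Proof. by move=> x y /lip_diff /andP[_]; lra. Qed.

Lemma lipF_continuous : continuous lipF.
Proof.
move=> x; apply/cvgrPdist_le => e e0; near=> y.
have : `|x - y| <= e by near: y; apply: cvgr_dist_le.
apply: le_trans; have [xy|/ltW yx] := leP x y.
  have /andP[h1 h2] := lip_diff xy.
  by rewrite distrC ger0_norm// distrC ger0_norm// subr_ge0.
have /andP[h1 h2] := lip_diff yx.
by rewrite ger0_norm// ger0_norm// subr_ge0.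
Unshelve. all: by end_near. Qed.

Lemma lipF_rc : right_continuous lipF.
Proof. exact/right_continuousW/lipF_continuous. Qed.

Lemma lipFc_rc : right_continuous (fun x => x - lipF x).
Proof.
by apply: right_continuousW => x; apply: continuousB; [exact: cvg_id|exact: lipF_continuous].
Qed.

Lemma lipF_lo x : x <= - M -> lipF x = 0.
Proof.
move=> xM; rewrite /lipF Gsupp; last by rewrite ler_normr; lra.
have -> : clampM x = - M.
  by have ? := M1; case: (clampMP x) => -[h ->] //; lra.
by rewrite addNr mulr0 addr0 mulr0.
Qed.

Lemma lipF_hi x : M <= x -> lipF x = 1.
Proof.
move=> xM; rewrite /lipF Gsupp; last by rewrite ler_normr xM.
have -> : clampM x = M.
  by have ? := M1; case: (clampMP x) => -[h ->] //; lra.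
have M0 : M != 0 by apply/negP => /eqP M0; have := M1; rewrite M0; lra.
have L0' : L != 0 by rewrite gt_eqF.
by field; rewrite L0' M0.
Qed.

Lemma lipF_Ny : lipF @ -oo --> (0 : R).
Proof.
apply: cvg_near_cst; near=> x; rewrite lipF_lo//.
Unshelve. all: by end_near. Qed.

Lemma lipF_y : lipF @ +oo --> (1 : R).
Proof.
apply: cvg_near_cst; near=> x; rewrite lipF_hi//.
Unshelve. all: by end_near. Qed.

HB.instance Definition _ := isCumulative.Build R _ R lipF lipF_nd lipF_rc.
HB.instance Definition _ := isCumulativeBounded.Build R 0 1 lipF lipF_Ny lipF_y.

Definition lipFc (x : R) := x - lipF x.
HB.instance Definition _ := isCumulative.Build R _ R lipFc lipFc_nd lipFc_rc.

Let nu := lebesgue_stieltjes_measure (lipF : cumulativeBounded (0:R) 1).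

Lemma ls_oc (f : cumulative R R) a b : a <= b ->
  lebesgue_stieltjes_measure f `]a, b] = (f b - f a)%:E.
Proof.
move=> ab; rewrite /lebesgue_stieltjes_measure/=.
rewrite /measure_extension measurable_mu_extE/=; last exact: is_ocitv.
by rewrite wlength_itv_bnd.
Qed.

(** The Stieltjes measures of [lipF] and [lipFc] add up to Lebesgue measure, as one sees on
    half-open intervals; so each of them vanishes on Lebesgue null sets. *)
Lemma nu_dom : nu `<< leb.
Proof.
apply/null_content_dominatesP => A mA A0.
have := @lebesgue_measure_unique R (measure_add
  (lebesgue_stieltjes_measure (lipF : cumulative R R))
  (lebesgue_stieltjes_measure (lipFc : cumulative R R))) _ A mA.
rewrite A0 => /(_ _)/esym; set m := measure_add _ _ => H.
have mE : m A = (_ + _)%E := measure_addE _ _ _.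
suff mA0 : m A = 0.
  apply/eqP; rewrite eq_le measure_ge0 andbT -mA0 mE.
  by apply: leeDl; exact: measure_ge0.
apply: H.
move=> X /ocitvP[->|[[a b] /= /ltW ab ->]].
  by rewrite !measure0.
apply/esym; apply: (eq_trans (measure_addE _ _ _)).
apply: (eq_trans (congr2 adde (ls_oc (lipF : cumulative R R) ab)
  (ls_oc (lipFc : cumulative R R) ab))).
apply/esym; rewrite lebesgue_measure_itv/= lte_fin.
case: ltP => [_|ba].
  by apply: (congr1 EFin); rewrite /lipFc /=; ring.
have -> : a = b by apply/eqP; rewrite eq_le ab.
by apply: (congr1 EFin); rewrite !subrr addr0.
Qed.

Lemma lip_density : exists g : R -> R, leb.-integrable setT (EFin \o g) /\
  forall a b, a <= b -> (\int[leb]_(t in `]a, b]) (g t)%:E = (lipF b - lipF a)%:E)%E.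
Proof.
pose h := Radon_Nikodym_SigmaFinite.f nu leb.
have ffin := Radon_Nikodym_SigmaFinite.f_fin_num nu_dom.
have fint := Radon_Nikodym_SigmaFinite.f_integrable nu_dom.
have fE := Radon_Nikodym_SigmaFinite.f_integral nu_dom.
have hE : EFin \o (fine \o h) = h by apply/funext => x /=; rewrite fineK//; exact: ffin.
exists (fine \o h); split; first by rewrite hE.
move=> a b ab; rewrite -(ls_oc (lipF : cumulative R R))//.
rewrite (fE _ (measurable_itv _)).
by apply: eq_integral => x _ /=; rewrite fineK//; exact: ffin.
Qed.

End lipschitz_density.

Section lipschitz_line.
Context {R : realType}.
Variables (G : R -> R) (L M : R).
Hypothesis L0 : 0 < L.
Hypothesis M1 : 1 <= M.
Hypothesis Glip : forall x y, `|G x - G y| <= L * `|x - y|.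
Hypothesis Gsupp : forall x, M <= `|x| -> G x = 0.

Local Notation leb := (@lebesgue_measure R).

Lemma lip_outside (x : R) : M < `|x| -> is_derive x (1 : R) G 0.
Proof.
move=> Mx; apply: (@near_eq_is_derive _ _ _ (cst 0)).
near=> y; rewrite  Gsupp//; apply: ltW.
have : `|x - y| < `|x| - M by near: y; apply: cvgr_dist_lt => //; rewrite subr_gt0.
have := ler_normD (x - y) y; rewrite subrK; lra.
Unshelve. all: by end_near. Qed.

(** Rademacher's theorem on the line together with the fundamental theorem of calculus. The
    primitive of the density of [lipF] is differentiated almost everywhere by [FTC1], and the ramp
    is then subtracted again. *)
Lemma lip_derivable_density : exists g : R -> R,
  [/\ leb.-integrable setT (EFin \o g),
      {ae leb, forall x, is_derive (x : R) (1 : R) G (g x)} &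
      (\int[leb]_x (g x)%:E = 0)%E].
Proof.
have M0 : 0 < M by have := M1; lra.
have LM0 : 0 < 2 * L * M by rewrite !mulr_gt0.
have [h [hint hE]] := lip_density L0 M1 Glip Gsupp.
have hintS A : measurable A -> leb.-integrable A (EFin \o h).
  by move=> mA; apply: integrableS hint.
pose I := `]- M, M]%classic : set R.
have mI : measurable (I : set (measurableTypeR R)) by exact: measurable_itv.
have lebI : leb I = (2 * M)%:E.
  have -> : leb I = _ := lebesgue_measure_itv _.
  by rewrite /= lte_fin ifT ?opprK; [apply: (congr1 EFin); ring|lra].
have cI (c : R) : (\int[leb]_(x in I) c%:E = (c * (2 * M))%:E)%E.
  apply: (eq_trans (integral_cst leb mI c%:E)).
  by apply: (eq_trans (congr1 (mule _) lebI)).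
(* On [I] the clamp is the identity, so G = 2LM lipF - L(x + M), whose derivative is this. *)
pose g0 := fun x => 2 * L * M * h x - L.
have h1int : leb.-integrable I (fun x => (2 * L * M)%:E * (EFin \o h) x)%E.
  by apply: integrableZl => //; exact: hintS.
have Lint : leb.-integrable I (EFin \o cst L).
  apply/integrableP; split; first exact/measurable_EFinP.
  under eq_integral do rewrite /=.
  by rewrite (cI `|L|) ltry.
have g0E x : (EFin \o g0) x = ((2 * L * M)%:E * (EFin \o h) x - (EFin \o cst L) x)%E by [].
have g0int : leb.-integrable I (EFin \o g0).
  have H := integrableB mI h1int Lint.
  by move: H; apply: eq_integrable.
exists (g0 \_ I); split.
- by have := (integrable_mkcond _ mI).1 g0int; rewrite restrict_EFin.
- have FT := @FTC1 R h (BRight (- M)) (fun y => hintS _ (measurable_itv _))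
    (open_integrable_locally openT hint).
  (* The corners -M and M of the clamp are discarded as null sets. *)
  have neq a : {ae leb, forall x, x <> a}.
    exists [set a]; split => //; first exact: lebesgue_measure_set1.
    by move=> x /= /contrapT.
  apply: (@filterS3 _ _ (ae_filter_ringOfSetsType leb) _ _ _ _ _ FT (neq M) (neq (- M))) => x H xM xNM.
  have [xI|xI] := boolP (- M < x < M); last first.
    have Mx : M < `|x|.
      rewrite ltNge ler_norml !le_eqVlt; apply: contra xI.
      by move=> /andP[/orP[/eqP/esym|->] // /orP[/eqP|->]].
    rewrite patchE memNset; first exact: lip_outside.
    rewrite /I/= in_itv/= => /andP[h1 h2]; move: Mx.
    by rewrite ltNge ler_norml h2 ltW.
  have /andP[x1 x2] := xI.
  rewrite patchE mem_set; last by rewrite /I/= in_itv/= x1 ltW.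
  have [] := H _; first by rewrite /= lte_fin.
  set Fh := fun _ => _ => dF eF.
  have dFh : is_derive x 1 Fh (h x).
    by rewrite -eF derive1E; exact: derivableP.
  apply: (@near_eq_is_derive _ _ _ (fun y => 2 * L * M * Fh y - L * (y + M))).
    near=> y.
    have yI : y \in `]- M, M[ by near: y; apply: near_in_itvoo; rewrite in_itv.
    have /andP[yM1 yM2] : - M < y < M by move: yI; rewrite in_itv.
    rewrite /Fh /Rintegral hE; last lra.
    rewrite (@lipF_lo _ G L M _ _ (- M))//= subr0 /lipF.
    have -> : clampM M y = y by case: (clampMP M1 y) => -[h1 ->] //; lra.
    by field; rewrite !gt_eqF.
  apply: is_derive_eq; rewrite /g0 addr0.
  by congr (_ - _); rewrite /GRing.scale/= mulr1.
- rewrite (_ : (fun x => ((g0 \_ I) x)%:E) = (EFin \o g0) \_ I); last first.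
    by rewrite restrict_EFin.
  rewrite -integral_mkcond; apply: (eq_trans (integralB mI h1int Lint)).
  rewrite (integralZl mI (hintS _ mI)) (cI L) hE; last lra.
  rewrite lipF_hi// lipF_lo//; apply: (congr1 EFin); ring.
Unshelve. all: by end_near. Qed.
End lipschitz_line.

Section ibp_line.
Context {R : realType}.
Local Notation leb := (@lebesgue_measure R).
Implicit Types G F V W eta : R -> R.

(** [F] has to match the derivative of [G] only where that derivative exists; this accommodates the
    default value of ['D_1] at the other points. *)
Lemma integral_derive_lipschitz G F L M : 0 < L -> 1 <= M ->
  (forall x y, `|G x - G y| <= L * `|x - y|) ->
  (forall x, M <= `|x| -> G x = 0) ->
  measurable_fun (setT : set (measurableTypeR R)) F ->
  (forall (x : R) (df : R), is_derive (x : R) (1 : R) G df -> F x = df) ->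
  (\int[leb]_x (F x)%:E = 0)%E.
Proof.
move=> L0 M1 Glip Gsupp mF FG.
have [g [gint gG gE]] := lip_derivable_density L0 M1 Glip Gsupp.
rewrite -gE; apply: ae_eq_integral => //.
- exact/measurable_EFinP.
- exact: measurable_int gint.
apply: (@filterS _ _ (ae_filter_ringOfSetsType leb) _ _ _ gG) => x gx _.
by rewrite (FG x (g x)).
Qed.

Lemma lipschitz_of_derive V W C : (forall x : R, is_derive x (1 : R) V (W x)) ->
  (forall x, `|W x| <= C) -> forall x y, `|V x - V y| <= C * `|x - y|.
Proof.
move=> dV WC.
have cV (a b : R) : {within `[a, b], continuous V}.
  apply: continuous_subspaceT => z; apply: differentiable_continuous.
  by apply/derivable1_diffP; exact: ex_derive.
have lip x y : x <= y -> `|V y - V x| <= C * (y - x).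
  move=> xy; have [c _ ->] := @MVT_segment R V W x y xy (fun z _ => dV z) (cV _ _).
  by rewrite normrM (ger0_norm (_ : 0 <= y - x)) ?subr_ge0// ler_wpM2r ?subr_ge0.
move=> x y; have [xy|/ltW yx] := leP x y.
  by rewrite distrC (distrC x) (ger0_norm (_ : 0 <= y - x)) ?subr_ge0//; exact: lip.
by rewrite (ger0_norm (_ : 0 <= x - y)) ?subr_ge0//; exact: lip.
Qed.

(* Where [V] does not vanish, [eta] inherits derivability from [V * eta];
   where it does, the derivative of [V * eta] is [V' * eta] by continuity. *)
Lemma derive_mul_lipschitz V W eta L (x d : R) :
  (forall x y, `|eta x - eta y| <= L * `|x - y|) ->
  is_derive x (1 : R) V (W x) -> is_derive x (1 : R) (fun y => V y * eta y) d ->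
  V x * 'D_1 eta x + W x * eta x = d.
Proof.
move=> elip dV dG.
have cV : {for x, continuous V}.
  by apply: differentiable_continuous; apply/derivable1_diffP; exact: ex_derive.
have [Vx0|Vx0] := eqVneq (V x) 0.
  rewrite Vx0 mul0r add0r.
  have ceta : eta y @[y --> x] --> eta x.
    apply/cvgrPdist_le => e e0; near=> y.
    rewrite (le_trans (elip _ _))//.
    have L1 : 0 < `|L| + 1 by rewrite ltr_wpDl.
    have : `|x - y| <= e / (`|L| + 1).
      by near: y; apply: cvgr_dist_le => //; rewrite divr_gt0.
    rewrite ler_pdivlMr// => h.
    rewrite (le_trans _ h)// mulrC ler_wpM2l//.
    by rewrite (le_trans (ler_norm _))// lerDl.
  have [g [gE cg gx]] := (is_derive1_caratheodory V x (W x)).1 dV.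
  have dG' : is_derive x (1 : R) (fun y => V y * eta y) (W x * eta x).
    apply/is_derive1_caratheodory; exists (fun y => g y * eta y); split.
    - by move=> z; rewrite Vx0 mul0r subr0 mulrAC -gE Vx0 subr0.
    - exact: cvgM.
    - by rewrite gx.
  by rewrite -(@derive_val _ _ _ _ _ _ _ dG') (@derive_val _ _ _ _ _ _ _ dG).
have nV : \forall y \near x, V y != 0.
  exact: (cvgr_neq0 (V x) cV Vx0).
have deta : derivable eta x 1.
  apply: (@near_eq_derivable _ _ _ (fun y => (V y)^-1 * (V y * eta y))).
    by near=> y; rewrite mulKf//; near: y.
  apply: derivableM; last exact: ex_derive.
  by apply: derivableV => //; exact: ex_derive.
have De := derivableP deta.
have DG : is_derive x 1 (V * eta) (V x *: 'D_1 eta x + eta x *: W x).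
  exact: is_deriveM.
rewrite -(@derive_val _ _ _ _ _ _ _ dG).
have -> : (fun y => V y * eta y) = V * eta by [].
by rewrite (@derive_val _ _ _ _ _ _ _ DG); congr (_ + _); exact: mulrC.
Unshelve. all: by end_near. Qed.

(** [eta] may be unbounded, but [V * eta] is still Lipschitz: it vanishes from M outwards, hence
    factors through the clamp, on whose range [eta] is bounded. *)
Lemma ibp_line V W eta C L M : 0 <= C -> 0 <= L -> 1 <= M ->
  (forall x : R, is_derive x (1 : R) V (W x)) ->
  (forall x, `|W x| <= C) -> (forall x, M <= `|x| -> V x = 0) ->
  (forall x y, `|eta x - eta y| <= L * `|x - y|) ->
  measurable_fun (setT : set (measurableTypeR R))
    (fun x => V x * 'D_1 eta x + W x * eta x) ->
  (\int[leb]_x (V x * 'D_1 eta x + W x * eta x)%:E = 0)%E.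
Proof.
move=> C0 L0 M1 dV WC VM elip mF.
have Vlip := lipschitz_of_derive dV WC.
have M0 : 0 <= M by lra.
have cM x : - M <= clampM M x <= M by case: (clampMP M1 x) => -[h ->]; lra.
have VE x : V x = V (clampM M x).
  by case: (clampMP M1 x) => -[h ->] //; rewrite !VM//; rewrite ler_normr; lra.
have Vb x : `|V x| <= C * (2 * M).
  rewrite VE -[V _]subr0 -(VM M) ?ler_normr ?lexx//.
  rewrite (le_trans (Vlip _ _))// ler_wpM2l//.
  by rewrite ler_norml; have := cM x; lra.
pose H := `|eta 0| + L * M.
have eb x : `|eta (clampM M x)| <= H.
  have := ler_normD (eta (clampM M x) - eta 0) (eta 0); rewrite subrK => h.
  rewrite (le_trans h)// addrC lerD2l (le_trans (elip _ _))// subr0 ler_wpM2l//.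
  by rewrite ler_norml.
have GE x : V x * eta x = V (clampM M x) * eta (clampM M x).
  case: (clampMP M1 x) => -[h ->] //; rewrite !VM ?mul0r//; rewrite ler_normr; lra.
(* The first two summands are the Lipschitz constant of the product; the last makes K strictly
   positive. *)
pose K := C * H + C * (2 * M) * L + 1.
have H0 : 0 <= H by rewrite addr_ge0// mulr_ge0.
apply: (@integral_derive_lipschitz (fun x => V x * eta x) _ K M) => //.
- by rewrite /K ltr_wpDl// addr_ge0// !mulr_ge0.
- move=> x y; rewrite GE (GE y).
  have : `|clampM M x - clampM M y| <= `|x - y|.
    have [xy|/ltW yx] := leP x y.
      have /andP[h1 h2] := clampM_nd M1 xy.
      by rewrite distrC (distrC x) !ger0_norm// subr_ge0.
    have /andP[h1 h2] := clampM_nd M1 yx.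
    by rewrite !ger0_norm// subr_ge0.
  set x' := clampM M x; set y' := clampM M y => xy.
  have -> : V x' * eta x' - V y' * eta y' =
    (V x' - V y') * eta x' + V y' * (eta x' - eta y') by ring.
  rewrite (le_trans (ler_normD _ _))// !normrM.
  apply: (@le_trans _ _ (C * `|x - y| * H + C * (2 * M) * (L * `|x - y|))).
    apply: lerD; apply: ler_pM => //; first exact: (le_trans (Vlip _ _)) (ler_wpM2l _ _).
    - exact: eb.
    - exact: (le_trans (elip _ _)) (ler_wpM2l _ _).
  have := normr_ge0 (x - y); rewrite /K; lra.
- by move=> x Mx; rewrite VM// mul0r.
- move=> x df dG; exact: derive_mul_lipschitz elip (dV x) dG.
Qed.

End ibp_line.

(** * Integration on rows *)

Section row_integration.
Context {R : realType}.
Local Notation leb := (@lebesgue_measure R).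

Local Notation mR := (measurableTypeR R).

(* [measurable_row_cons] for the sigma-algebra on which [lebesgue_measure] is defined. *)
Lemma measurable_row_consT n :
  measurable_fun (setT : set (mR * 'rV[R]_n)) (@row_cons R n).
Proof. exact: measurable_row_cons. Qed.

Lemma measurable_row_cons_section n (t : R) :
  measurable_fun setT (fun y : 'rV[R]_n => row_cons (t, y)).
Proof.
exact: (measurableT_comp (@measurable_row_consT n) (pair1_measurable (t : mR))).
Qed.

Lemma ge0_integral_rowS n (f : 'rV[R]_n.+1 -> \bar R) :
  measurable_fun setT f -> (forall x, 0 <= f x)%E ->
  (\int[lebesgue_row n.+1]_x f x =
   \int[leb]_t \int[lebesgue_row n]_y f (row_cons (t, y)))%E.
Proof.
move=> mf f0.
apply: (eq_trans (@ge0_integral_pushforward _ _ _ _ R _ (@measurable_row_consT n)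
  (leb \x lebesgue_row n)%E setT f measurableT mf (fun x _ => f0 x))).
rewrite preimage_setT fubini_tonelli1 => [//||x]; last exact: f0.
by apply: measurableT_comp => //; exact: measurable_row_consT.
Qed.

(** Both orders are recorded because the integral along a chosen direction must be innermost, and
    that direction may be the first coordinate or a later one. *)
Lemma integral_rowS n (f : 'rV[R]_n.+1 -> \bar R) :
  (lebesgue_row n.+1).-integrable setT f ->
  [/\ (\int[lebesgue_row n.+1]_x f x =
       \int[leb]_t \int[lebesgue_row n]_y f (row_cons (t, y)))%E &
      (\int[lebesgue_row n.+1]_x f x =
       \int[lebesgue_row n]_y \int[leb]_t f (row_cons (t, y)))%E].
Proof.
move=> intf; have mf := measurable_int _ intf.
have mfc : measurable_fun setT (f \o @row_cons R n).
  by apply: measurableT_comp => //; exact: measurable_row_consT.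
have intfc : (leb \x lebesgue_row n)%E.-integrable setT (f \o @row_cons R n).
  apply/integrableP; split => //.
  move/integrableP : intf => [_]; apply: le_lt_trans.
  rewrite le_eqVlt; apply/orP; left; apply/eqP/esym.
  have maf : measurable_fun setT (abse \o f) by apply: measurableT_comp.
  by apply: (eq_trans (@ge0_integral_pushforward _ _ _ _ R _ (@measurable_row_consT n)
    (leb \x lebesgue_row n)%E setT _ measurableT maf (fun x _ => abse_ge0 _))).
have E := @integral_pushforward _ _ _ _ R _ (@measurable_row_consT n)
  (leb \x lebesgue_row n)%E setT f mf intfc measurableT.
split; apply: (eq_trans E); rewrite preimage_setT.
  by rewrite -integral12_prod_meas1.
by rewrite -integral21_prod_meas1.
Qed.

Definition row_box n (M : R) : set 'rV[R]_n := [set x | forall j, `[- M, M]%classic (x ord0 j)].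

Lemma measurable_row_sym_box n M : measurable (@row_box n M).
Proof. by apply: (@measurable_row_box R n (fun=> `[- M, M]%classic)) => i; exact: measurable_itv. Qed.

Lemma lebesgue_row_sym_box n M : (lebesgue_row n (@row_box n M) < +oo)%E.
Proof.
rewrite (@lebesgue_row_box R n (fun=> `[- M, M]%classic)); last by move=> i; exact: measurable_itv.
have -> : leb `[- M, M]%classic = _ := lebesgue_measure_itv _.
by rewrite /= lte_fin; case: ifP => _; rewrite -?EFinB prodEFin ltry.
Qed.

Lemma integrable_row_box n (F : 'rV[R]_n -> R) C M :
  measurable_fun setT F -> (forall x, `|F x| <= C) ->
  (forall x, ~ row_box M x -> F x = 0) ->
  (lebesgue_row n).-integrable setT (EFin \o F).
Proof.
move=> mF FC FM.
have -> : EFin \o F = (EFin \o F) \_ (row_box M).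
  by apply/funext => x; rewrite patchE; case: ifPn => //; rewrite notin_setE => /FM /= ->.
apply: (integrable_mkcond _ (@measurable_row_sym_box n M)).1.
apply/integrableP; split.
  by apply/measurable_EFinP; exact: measurable_funTS.
apply: (@le_lt_trans _ _ (\int[lebesgue_row n]_(x in row_box M) C%:E)%E).
  apply: ge0_le_integral => //; first exact: measurable_row_sym_box.
  - apply: (@measurable_funTS _ _ _ _ _ (abse \o (EFin \o F))).
    by apply: measurableT_comp => //; exact/measurable_EFinP.
  - by move=> x _; rewrite /= lee_fin.
rewrite integral_cst; last exact: measurable_row_sym_box.
rewrite lte_mul_pinfty//; last exact: lebesgue_row_sym_box.
by rewrite lee_fin (le_trans _ (FC 0)).
Qed.

(** Fubini with coordinate i innermost. The induction peels off the first coordinate, outermost as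
    long as it is not the i-th, and innermost when it is. *)
Lemma integral_lines_eq0 n (i : 'I_n) (F : 'rV[R]_n -> R) C M :
  measurable_fun setT F -> (forall x, `|F x| <= C) ->
  (forall x, ~ row_box M x -> F x = 0) ->
  (forall x, \int[leb]_t (F (t *: basis_row i + x))%:E = 0)%E ->
  (\int[lebesgue_row n]_x (F x)%:E = 0)%E.
Proof.
elim: n => [|n IHn] in i F *; first by case: i.
move=> mF FC FM Fl.
have [E1 E2] := integral_rowS (integrable_row_box mF FC FM).
case: (unliftP ord0 i) Fl => [j|] -> Fl.
  apply: (eq_trans E1); apply: integral0_eq => t _.
  apply: (IHn j (fun y => F (row_cons (t, y)))).
  - by apply: measurableT_comp => //; exact: measurable_row_cons_section.
  - by move=> y; exact: FC.
  - move=> y My; apply: FM => h; apply: My => k.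
    by have := h (lift ord0 k); rewrite row_consS.
  - move=> y; rewrite -(Fl (row_cons (t, y))); apply: eq_integral => s _.
    congr (F _)%:E; apply/rowP => k; rewrite [RHS]mxE [X in _ = X + _]mxE [X in _ = _ * X + _]mxE.
    case: (unliftP ord0 k) => [k'|] ->.
      by rewrite !row_consS !mxE (inj_eq lift_inj) eqxx.
    by rewrite !row_cons0 mulr0 add0r.
apply: (eq_trans E2); apply: integral0_eq => y _.
rewrite -(Fl (row_cons (0, y))); apply: eq_integral => s _.
congr (F _)%:E; apply/rowP => k; rewrite [RHS]mxE [X in _ = X + _]mxE [X in _ = _ * X + _]mxE.
case: (unliftP ord0 k) => [k'|] ->.
  by rewrite !row_consS mulr0 add0r.
by rewrite !row_cons0 mulr1 addr0.
Qed.

End row_integration.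

(** * Open sets and sets of derivability in the product sigma-algebra *)

Section row_borel.
Context {R : realType}.
Local Notation leb := (@lebesgue_measure R).

(** An open set is the union of the cubes [B p] inside it, with centres on the grid of mesh 1/(k+1)
    and radius 1/(k+1); there are countably many. A point x is covered by rounding its coordinates
    down, on a grid with 2/(k+1) < e. *)
Lemma open_row_measurable n (U : set 'rV[R]_n) : open U -> measurable U.
Proof.
move=> oU.
pose B (p : 'rV[int]_n * nat) := [set y : 'rV[R]_n |
  forall i, ball ((p.1 ord0 i)%:~R / p.2.+1%:R : R) p.2.+1%:R^-1 (y ord0 i)].
have mB p : measurable (B p).
  apply: (@measurable_row_box R n (fun i => ball ((p.1 ord0 i)%:~R / p.2.+1%:R : R) p.2.+1%:R^-1)) => i.
  exact: measurable_ball.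
rewrite (_ : U = \bigcup_p (if `[< B p `<=` U >] then B p else set0)).
  by apply: countable_bigcupT_measurable => // p; case: ifP.
apply/seteqP; split=> [x Ux|x [p _]]; last first.
  by case: asboolP => // pU; exact: pU.
have /nbhs_ballP[e /= e0 xU] : nbhs x U by exact: open_nbhs_nbhs.
have [k ke] : exists k, 2 / k.+1%:R < e.
  have [k _ /(_ k (leqnn _))] := near_infty_natSinv_lt (PosNum (divr_gt0 e0 (ltr0n R 2))).
  by rewrite /= => ke; exists k; rewrite mulrC -ltr_pdivlMr.
pose p : 'rV[int]_n * nat := (\row_i Num.floor (x ord0 i * k.+1%:R), k).
have k0 : 0 < k.+1%:R :> R by [].
have xp i : ball ((p.1 ord0 i)%:~R / p.2.+1%:R : R) p.2.+1%:R^-1 (x ord0 i).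
  rewrite /ball/= mxE distrC; have /andP[] := floor_itv (x ord0 i * k.+1%:R).
  set z := (Num.floor _)%:~R; rewrite intrD -/z => z1 z2.
  have -> : x ord0 i - z / k.+1%:R = (x ord0 i * k.+1%:R - z) / k.+1%:R.
    by rewrite mulrBl mulfK// lt0r_neq0.
  rewrite normrM [X in _ * X]gtr0_norm ?invr_gt0// ger0_norm ?subr_ge0//.
  by rewrite ltr_pdivrMr// [ltRHS]mulVf ?lt0r_neq0// ltrBlDl.
suff pU : B p `<=` U by exists p => //; rewrite ifT//; exact/asboolP.
move=> y By; apply: xU; suff : @mx_ball 1 n R R x e y by [].
split => // i j.
have le2 : p.2.+1%:R^-1 + p.2.+1%:R^-1 <= e by rewrite -mulr2n -[leLHS]mulr_natl; exact: (ltW ke).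
by rewrite ord1; exact: (le_ball le2 (ball_triangle (ball_sym (xp j)) (By j))).
Qed.

Lemma closed_row_measurable n (U : set 'rV[R]_n) : closed U -> measurable U.
Proof. by move/closed_openC/open_row_measurable/measurableC; rewrite setCK. Qed.

Lemma continuous_row_measurable n (f : 'rV[R]_n -> R) :
  continuous f -> measurable_fun setT f.
Proof.
move=> /continuousP cf; apply: (measurability _ (RGenOpens.measurableE R)).
move=> _ [_ [a [b ->] <-]]; rewrite setTI; apply: open_row_measurable.
exact/cf/interval_open.
Qed.

(** Derivability is the Cauchy criterion for the difference quotients [Q h]. For a given tolerance
    and a given range of steps the condition is an intersection of closed sets, as each [Q h] is
    continuous in x, so the uncountably many steps cause no trouble. *)
Lemma measurable_derivable n (v : 'rV[R]_n) (eta : 'rV[R]_n -> R) :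
  continuous eta -> measurable [set x | derivable eta x v].
Proof.
move=> ce; pose Q (h : R) (x : 'rV[R]_n) := h^-1 * (eta (h *: v + x) - eta x).
have cQ h : continuous (Q h).
  move=> x; apply: (@continuousM _ _ (cst h^-1) (fun x => eta (h *: v + x) - eta x)); first exact: cst_continuous.
  apply: (@continuousB _ _ _ (fun x => eta (h *: v + x)) eta); last exact: ce.
  apply: (@continuous_comp _ _ _ (fun x => h *: v + x) eta); last exact: ce.
  by apply: (@continuousD _ _ _ (cst (h *: v)) id); [exact: cst_continuous|exact: cvg_id].
pose A k d := [set x : 'rV[R]_n | forall h h' : R, h != 0 -> h' != 0 -> `|h| < d.+1%:R^-1 -> `|h'| < d.+1%:R^-1 ->
  `|Q h x - Q h' x| <= k.+1%:R^-1].
have mA k d : measurable (A k d).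
  apply: closed_row_measurable.
  rewrite (_ : A k d = \bigcap_(p in [set p : R * R | [/\ p.1 != 0, p.2 != 0,
    `|p.1| < d.+1%:R^-1 & `|p.2| < d.+1%:R^-1]])
    [set x | `|Q p.1 x - Q p.2 x| <= k.+1%:R^-1]).
    apply: closed_bigI => p _.
    apply: (@preimage_closed _ _ (fun x => `|Q p.1 x - Q p.2 x|) [set y | y <= k.+1%:R^-1]).
      move=> x _; apply: (@continuous_comp _ _ _ (fun x => Q p.1 x - Q p.2 x) Num.norm).
        by apply: (@continuousB _ _ _ (Q p.1) (Q p.2)); exact: cQ.
      exact: norm_continuous.
    exact: closed_le.
  apply/seteqP; split=> x Ax; first by move=> [h h'] /= [? ? ? ?]; exact: Ax.
  by move=> h h' ? ? ? ?; apply: (Ax (h, h')).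
rewrite (_ : [set x | _] = \bigcap_k \bigcup_d A k d).
  by apply: bigcap_measurable => // k _; exact: bigcup_measurable.
apply/seteqP; split=> x /=.
  move=> /cvg_ex[/= l /cvgrPdist_lt dl] k _.
  have k0 : 0 < (k.+1%:R^-1 / 2 : R) by rewrite divr_gt0.
  have [/= e e0 H] := dl _ k0.
  have [d _ /(_ d (leqnn _)) de] := near_infty_natSinv_lt (PosNum e0).
  exists d => // h h' h0 h'0 hd h'd.
  have H1 h2 : h2 != 0 -> `|h2| < d.+1%:R^-1 -> `|l - Q h2 x| < k.+1%:R^-1 / 2.
    by move=> h20 h2d; apply: H => //=; rewrite sub0r normrN (lt_trans h2d).
  have := H1 _ h0 hd; have := H1 _ h'0 h'd.
  move=> H2 H3; rewrite (splitr k.+1%:R^-1) (le_trans (ler_distD l _ _))//.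
  by rewrite lerD//; apply: ltW => //; rewrite distrC.
move=> H; apply: cauchy_cvg; apply/cauchy_ballP => e e0.
have [k _ /(_ k (leqnn _)) /= ke] := near_infty_natSinv_lt (PosNum e0).
have [d _ Ad] := H k I.
have d0 : 0 < (d.+1%:R^-1 : R) by rewrite invr_gt0.
rewrite near_map2; near=> h h'; apply: (le_lt_trans _ ke); apply: Ad.
- rewrite /=; near: h; exact: nbhs_dnbhs_neq.
- rewrite /=; near: h'; exact: nbhs_dnbhs_neq.
- rewrite /=; near: h; apply: dnbhs0_lt; exact: d0.
- rewrite /=; near: h'; apply: dnbhs0_lt; exact: d0.
Unshelve. all: by end_near. Qed.

End row_borel.

(** * Measurable directional derivatives; integrals of products of one-variable powers *)

Section row_products.
Context {R : realType}.
Local Notation leb := (@lebesgue_measure R).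
Local Notation mR := (measurableTypeR R).

(** A pointwise limit of difference quotients with step 1/(k+1), cut off outside the set of
    derivability, where ['D_v] has the default value 0. *)
Lemma measurable_derive n (v : 'rV[R]_n) (eta : 'rV[R]_n -> R) :
  continuous eta -> measurable_fun setT (fun x => 'D_v eta x).
Proof.
move=> ce; pose C := [set x | derivable eta x v].
have mC : measurable C by exact: measurable_derivable.
pose h k : 'rV[R]_n -> R := (fun x => k.+1%:R * (eta (k.+1%:R^-1 *: v + x) - eta x)) \_ C.
apply: (@measurable_fun_cvg _ _ _ setT h).
  move=> k; apply: (measurable_restrictT _ mC).1; apply: measurable_funTS.
  apply: continuous_row_measurable => x.
  apply: (@continuousM _ _ (cst k.+1%:R) (fun x => eta (k.+1%:R^-1 *: v + x) - eta x)); first exact: cst_continuous.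
  apply: (@continuousB _ _ _ (fun x => eta (k.+1%:R^-1 *: v + x)) eta); last exact: ce.
  apply: (@continuous_comp _ _ _ (fun x => k.+1%:R^-1 *: v + x) eta); last exact: ce.
  by apply: (@continuousD _ _ _ (cst (k.+1%:R^-1 *: v)) id); [exact: cst_continuous|exact: cvg_id].
move=> x _; have [Cx|Cx] := pselect (C x); last first.
  rewrite /h (_ : 'D_v eta x = 0); last by rewrite /derive dvgP.
  by under eq_fun do rewrite patchE memNset//; exact: cvg_cst.
rewrite /h; under eq_fun do rewrite patchE mem_set//.
move: Cx => /cvg_ex[/= l dl]; rewrite /derive (cvg_lim _ dl)//.
have H : (fun k : nat => (k.+1%:R^-1 : R)) @ \oo --> (0 : R)^'.
  move=> A A0; have : \forall k \near \oo, (k.+1%:R^-1 : R) != 0 -> A (k.+1%:R^-1).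
    exact: (@cvg_harmonic R _ A0).
  by apply: filterS => k; apply; rewrite invr_eq0.
have := cvg_comp _ _ H dl; apply: cvg_trans; apply: near_eq_cvg.
by near=> k; rewrite /= invrK.
Unshelve. all: by end_near. Qed.

Lemma emeasurable_row_prod n (s : seq 'I_n) (f : 'I_n -> R -> \bar R) :
  (forall i, measurable_fun (setT : set mR) (f i)) ->
  measurable_fun setT (fun x : 'rV[R]_n => \prod_(i <- s) f i (x ord0 i))%E.
Proof.
move=> mf; elim: s => [|i s IHs].
  rewrite [X in measurable_fun _ X](_ : _ = cst 1%E); first exact: measurable_cst.
  by apply/funext => x; rewrite big_nil.
rewrite [X in measurable_fun _ X](_ : _ = fun x : 'rV[R]_n => (f i (x ord0 i) * \prod_(j <- s) f j (x ord0 j))%E); last first.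
  by apply/funext => x; rewrite big_cons.
apply: emeasurable_funM => //.
have mc : measurable_fun setT (row_coord i : 'rV[R]_n -> mR).
  exact: (@measurable_row_coord R n i).
exact: (measurableT_comp (mf i) mc).
Qed.

Lemma ge0_integral_row_prod n (f : 'I_n -> R -> \bar R) :
  (forall i, measurable_fun (setT : set mR) (f i)) ->
  (forall i t, 0 <= f i t)%E ->
  (\int[lebesgue_row n]_x (\prod_(i < n) f i (x ord0 i)) =
   \prod_(i < n) \int[leb]_t f i t)%E.
Proof.
elim: n => [|n IHn] in f *; move=> mf f0.
  rewrite big_ord0.
  have -> : (fun x : 'rV[R]_0 => \prod_(i < 0) f i (x ord0 i))%E = cst 1%E.
    by apply/funext => x; rewrite big_ord0.
  by apply: (eq_trans (integral_cst _ measurableT 1%E)); rewrite /= diracT mule1.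
have prod_ge0 k (g : 'I_k -> R -> \bar R) : (forall i t, 0 <= g i t)%E ->
    forall x : 'rV[R]_k, (0 <= \prod_(i < k) g i (x ord0 i))%E.
  by move=> g0 x; apply: prode_ge0.
rewrite ge0_integral_rowS; last 2 first.
- exact: emeasurable_row_prod.
- by apply: prod_ge0.
pose g i := f (lift (@ord0 n) i).
have mg : measurable_fun setT (fun y : 'rV[R]_n => \prod_(i < n) g i (y ord0 i))%E.
  by apply: emeasurable_row_prod => i; exact: mf.
have g0 (y : 'rV[R]_n) : (0 <= \prod_(i < n) g i (y ord0 i))%E.
  by apply: prod_ge0 => i t; exact: f0.
rewrite big_ord_recl -(IHn g) => [|i|i t]; [|exact: mf|exact: f0].
rewrite -ge0_integralZr//; last by apply: integral_ge0 => x _; exact: g0.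
apply: eq_integral => t _.
rewrite -ge0_integralZl//.
apply: eq_integral => y _; rewrite big_ord_recl row_cons0; congr (_ * _)%E.
by apply: eq_bigr => i _; rewrite row_consS.
Qed.

(** The value +oo at 0 overrides the convention that a nonzero power of 0 is 0: products of these
    functions must dominate on the coordinate hyperplanes too. *)
Definition npow (al M : R) (t : R) : \bar R :=
  if `|t| <= M then if t == 0 then +oo%E else (`|t| `^ (- al))%:E else 0%E.

Lemma npow_ge0 al M t : (0 <= npow al M t)%E.
Proof. by rewrite /npow; case: ifP => // _; case: ifP => // _; rewrite lee_fin powR_ge0. Qed.

Lemma measurable_npow al M : measurable_fun (setT : set mR) (npow al M).
Proof.
have mn : measurable_fun (setT : set mR) (Num.norm : R -> R) by exact: continuous_measurable_fun norm_continuous.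
have mi : measurable_fun (setT : set mR) (id : R -> R) by exact: measurable_id.
apply: measurable_fun_ifT => //.
  by apply: measurable_fun_ler => //; exact: measurable_cst.
apply: measurable_fun_ifT => //.
  by apply: measurable_fun_eqr => //; exact: measurable_cst.
apply/measurable_EFinP.
have mn' : measurable_fun (setT : set mR) (Num.norm : R -> mR) by exact: mn.
have mp : measurable_fun (setT : set mR) (fun t : R => t `^ (- al)) by exact: measurable_powR.
exact: (measurableT_comp mp mn').
Qed.

Lemma integral_npow_bound (al M d : R) : 0 <= al < 1 -> 0 < d < M ->
  (\int[leb]_(t in `[d, +oo[) npow al M t <= ((1 - al)^-1 * M `^ (1 - al))%:E)%E.
Proof.
move=> /andP[al0 al1] /andP[d0 dM].
have al1' : 0 < 1 - al by lra.
pose f t := t `^ (1 - al - 1) : R.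
pose F t := (1 - al)^-1 * t `^ (1 - al) : R.
have dF (t : R) : 0 < t -> is_derive t (1 : R) F (f t).
  move=> t0; have H := is_derive1_powR (1 - al) t0.
  have : is_derive t (1 : R) F ((1 - al)^-1 * ((1 - al) * t `^ (1 - al - 1))) by exact: is_deriveZ.
  by rewrite mulKf// gt_eqF.
have cF (t : R) : 0 < t -> {for t, continuous F}.
  move=> t0; apply: differentiable_continuous; apply/derivable1_diffP.
  by case: (dF t t0).
have -> : (\int[leb]_(t in `[d, +oo[) npow al M t = \int[leb]_(t in `[d, M]) (f t)%:E)%E.
  rewrite integral_mkcond [RHS]integral_mkcond; apply: eq_integral => t _.
  rewrite !patchE !mem_setE !in_itv/= andbT /npow.
  have [dt|//] := leP d t; have t0 := lt_le_trans d0 dt.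
  rewrite ger0_norm ?(ltW t0)// (gt_eqF t0).
  by case: ifP => // _; rewrite /f; congr (_ `^ _)%:E; lra.
rewrite (@continuous_FTC2 _ f F)//.
- rewrite -EFinB lee_fin /F lerBlDr lerDl mulr_ge0// ?powR_ge0// invr_ge0 ltW//.
- apply: continuous_in_subspaceT => t; rewrite inE/= in_itv/= => /andP[dt _].
  have t0 := lt_le_trans d0 dt.
  apply: differentiable_continuous; apply/derivable1_diffP.
  by case: (is_derive1_powR (1 - al - 1) t0).
- split.
  + move=> t; rewrite in_itv/= => /andP[dt _].
    by case: (dF t (lt_trans d0 dt)).
  + exact: cvg_at_right_filter (cF d d0).
  + exact: cvg_at_left_filter (cF M (lt_trans d0 dM)).
- move=> t; rewrite in_itv/= => /andP[dt _].
  by rewrite derive1E; case: (dF t (lt_trans d0 dt)).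
Qed.

(** The bound on [d, +oo[ is independent of d, so monotone convergence along d = M/(k+2), which
    stays below M, reaches the half-line; the other half follows by reflection. *)
Lemma integral_npow_lty (al M : R) : 0 <= al < 1 -> 0 < M -> (\int[leb]_t npow al M t < +oo)%E.
Proof.
move=> al01 M0.
have mN := measurable_npow al M.
have N0 := npow_ge0 al M.
suff H : (\int[leb]_(t in `[0%R, +oo[) npow al M t < +oo)%E.
  rewrite -(itv_setU_setT true 0) ge0_integral_setU//=; last 2 first.
  - exact: measurable_funTS.
  - rewrite disj_set2E; apply/eqP/seteqP; split => // t [] /=.
    by rewrite !in_itv/= andbT => t0; rewrite leNgt t0.
  rewrite lte_add_pinfty//.
  apply: le_lt_trans H; rewrite ge0_integration_by_substitution0//.
  rewrite [leRHS](_ : _ = \int[leb]_(t in `]-oo, 0%R]) npow al M t)%E.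
    apply: ge0_subset_integral => //=.
    - exact: measurable_funTS.
    - by move=> t /=; rewrite !in_itv/= => /ltW.
  by apply: eq_integral => t _; rewrite /npow normrN oppr_eq0.
rewrite -integral_itv_obnd_cbnd; last exact: measurable_funTS.
pose G k := `[M / k.+2%:R, +oo[%classic : set mR.
have -> : `]0%R, +oo[%classic = \bigcup_k G k.
  apply/seteqP; split=> [t|t [k _]]; rewrite /G/= !in_itv/= !andbT; last first.
    by apply: lt_le_trans; rewrite divr_gt0.
  move=> t0; have [k _ /(_ k (leqnn _)) /= kt] := near_infty_natSinv_lt (PosNum (divr_gt0 t0 M0)).
  exists k => //=; rewrite in_itv/= andbT mulrC -ler_pdivlMr//.
  by apply: ltW; apply: le_lt_trans kt; rewrite lef_pV2 ?posrE// ler_nat.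
apply: (@le_lt_trans _ _ ((1 - al)^-1 * M `^ (1 - al))%:E); last exact: ltry.
have ndG : nondecreasing_seq G.
  apply/nondecreasing_seqP => k; rewrite subsetEset => t; rewrite /G/= !in_itv/= !andbT.
  by apply: le_trans; rewrite ler_pM2l// lef_pV2 ?posrE// ler_nat.
have mG k : measurable (G k) by exact: measurable_itv.
have := @ge0_nondecreasing_set_cvg_integral _ _ _ G (npow al M) leb ndG mG
  (fun k => measurable_funTS mN) (fun _ t _ => N0 t).
apply: cvge_le; apply: nearW => k; apply: integral_npow_bound => //.
by rewrite divr_gt0//= ltr_pdivrMr// ltr_pMr// ltr1n.
Qed.

End row_products.

(** * Integrability of negative powers of a function vanishing on a set of codimension m - l *)

Section singular_integrability.
Context {R : realType} {m : nat}.
Variables (l : nat) (f : 'rV[R]_m -> R) (M : R).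
Hypothesis M1 : 1 <= M.
Hypothesis fl : forall (x : 'rV[R]_m) (i : 'I_m), (l <= i)%N -> Num.min (x ord0 i ^+ 2) 1 / 4 <= f x.
Hypothesis lm : (l < m)%N.
Local Notation leb := (@lebesgue_measure R).
Local Notation mu := (@lebesgue_row R m).
Local Notation k := ((m - l)%:R : R).

(** Only the coordinates z, those of index at least l, carry a singular factor; exponent 0 leaves in
    the others the indicator of [-M, M], except at 0. *)
Definition row_npow (al : R) (x : 'rV[R]_m) : \bar R :=
  (\prod_(i < m) npow (if (l <= i)%N then al else 0%R) M (x ord0 i))%E.

Lemma row_npow_ge0 al x : (0 <= row_npow al x)%E.
Proof. by apply: prode_ge0 => i _; exact: npow_ge0. Qed.

Lemma measurable_row_npow al : measurable_fun setT (row_npow al).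
Proof.
apply: (@emeasurable_row_prod R m _ (fun i => npow (if (l <= i)%N then al else 0%R) M)) => i.
exact: measurable_npow.
Qed.

Lemma row_npow_lty al : 0 <= al < 1 -> (\int[mu]_x row_npow al x < +oo)%E.
Proof.
move=> al01; rewrite (@ge0_integral_row_prod R m (fun i => npow (if (l <= i)%N then al else 0%R) M)).
- have M0 : 0 < M by rewrite (lt_le_trans _ M1).
  suff /andP[] : (0 <= \prod_(i < m) \int[leb]_t npow (if (l <= i)%N then al else 0%R) M t < +oo)%E by [].
  apply: (big_ind (fun y => 0 <= y < +oo)%E) => [|x y /andP[x0 xy] /andP[y0 yy]|i _].
  + by rewrite ltry lee_fin ler01.
  + rewrite mule_ge0//= lte_mul_pinfty// ge0_fin_numE//.
  + rewrite integral_ge0//=; last by move=> t _; exact: npow_ge0.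
    by apply: integral_npow_lty => //; case: ifP => // _; rewrite lexx ltr01.
- by move=> i; exact: measurable_npow.
- by move=> i t; exact: npow_ge0.
Qed.

Let npow_gt0 al (t : R) : `|t| <= M -> (0 < npow al M t)%E.
Proof.
move=> tM; rewrite /npow tM; case: ifPn => // t0.
by rewrite lte_fin powR_gt0// normr_gt0.
Qed.

Lemma row_npow_eqy al x i : row_box M x -> x ord0 i = 0 -> row_npow al x = +oo%E.
Proof.
move=> xM xi0; have xMi j : `|x ord0 j| <= M by have := xM j; rewrite /= in_itv/= -ler_norml.
rewrite /row_npow (bigD1 i)//= {1}/npow xMi xi0 eqxx gt0_mulye//.
apply: (big_ind (fun y => 0 < y)%E) => // [y z|j _]; first exact: mule_gt0.
exact: npow_gt0.
Qed.

Lemma row_npowE al x : row_box M x -> (forall i, x ord0 i != 0) ->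
  row_npow al x = (\prod_(i < m) `|x ord0 i| `^ (- (if (l <= i)%N then al else 0)))%:E.
Proof.
move=> xM x0; rewrite -prodEFin; apply: eq_bigr => i _.
have := xM i; rewrite /= in_itv/= -ler_norml => xMi.
by rewrite /npow xMi (negbTE (x0 i)).
Qed.

Lemma card_geq : #|[pred i : 'I_m | (l <= i)%N]| = (m - l)%N.
Proof.
rewrite -sum1_card -[RHS]muln1 -sum_nat_const_nat.
by rewrite (big_geq_mkord l m xpredT (fun=> 1%N)).
Qed.

(** There are k = m - l coordinates of index at least l, so f^(-sk) splits into one factor f^(-s)
    for each; the factor of index i is estimated by x_i^2 <= 4 M^2 f, valid on the box. *)
Lemma power_le_row_npow s x : 0 <= s -> row_box M x -> 0 < f x ->
  ((f x `^ (- (s * k)))%:E <= ((4 * M ^+ 2) `^ (s * k))%:E * row_npow (2 * s) x)%E.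
Proof.
move=> s0 xM fx0; have M0 : 0 < M by rewrite (lt_le_trans _ M1).
have M20 : 0 < 4 * M ^+ 2 by rewrite mulr_gt0// exprn_gt0.
have [[i xi0]|x0] := pselect (exists i, x ord0 i = 0).
  by rewrite (row_npow_eqy _ xM xi0) gt0_muley ?leey// lte_fin powR_gt0.
have {}x0 i : x ord0 i != 0 by apply/eqP => xi; apply: x0; exists i.
rewrite row_npowE// -EFinM lee_fin.
have powk (c : R) t : c `^ (t * k) = \prod_(i < m) (if (l <= i)%N then c `^ t else 1).
  rewrite -big_mkcond/= powRrM powR_mulrn ?powR_ge0//.
  by rewrite prodr_const card_geq.
rewrite -mulNr powk powk -big_split/=; apply: ler_prod => i _.
case: ifPn => li; last by rewrite oppr0 powRr0 mulr1 lexx ler01.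
rewrite powR_ge0/= powRN powRN powRrM powR_mulrn// real_normK ?num_real//.
have x20 : 0 < x ord0 i ^+ 2 by rewrite lt_def sqr_ge0 sqrf_eq0 x0.
have H : x ord0 i ^+ 2 <= 4 * M ^+ 2 * f x.
  have := xM i; rewrite /= in_itv/= -ler_norml => xMi.
  have x2M : x ord0 i ^+ 2 <= M ^+ 2.
    by rewrite -[leLHS]real_normK ?num_real// lerXn2r// nnegrE ltW.
  have M21 : 1 <= M ^+ 2 by rewrite exprn_ege1.
  have := fl x li; rewrite minEle; case: ifP => _ h.
    have : x ord0 i ^+ 2 <= 4 * f x by lra.
    move=> h2; rewrite (le_trans h2)// ler_wpM2r ?(ltW fx0)//; lra.
  have h2 : 1 <= 4 * f x by lra.
  rewrite (le_trans x2M)// -mulrA mulrCA -[leLHS]mulr1 ler_wpM2l// sqr_ge0//.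
rewrite ler_pdivlMr ?powR_gt0// mulrC ler_pdivrMr ?powR_gt0//.
rewrite -powRM ?(ltW fx0) ?(ltW M20)//.
by rewrite ge0_ler_powR// nnegrE ltW// mulr_gt0.
Qed.

(** With s = rq/k, |H|^q is at most a multiple of f^(-sk), hence of a product of powers |z_i|^(-2s),
    and 2s < 1. Nothing is assumed about H inside the box where f vanishes, so infinite values are
    allowed there. *)
Lemma singular_integral_lty K r q (H : 'rV[R]_m -> \bar R) :
  0 <= K -> 1 <= q -> 0 <= r -> 2 * (r * q) < k -> measurable_fun setT H ->
  (forall x, ~ row_box M x -> H x = 0%E) ->
  (forall x, 0 < f x -> (`|H x| <= (K * f x `^ (- r))%:E)%E) ->
  (\int[mu]_x (`|H x| `^ q) < +oo)%E.
Proof.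
move=> K0 q1 r0 rqk mH HM HK.
have k0 : 0 < k by rewrite ltr0n subn_gt0.
have q0 : 0 <= q by rewrite (le_trans _ q1).
pose s := r * q / k.
have s0 : 0 <= s by rewrite divr_ge0 ?mulr_ge0 ?(ltW k0).
have sk : s * k = r * q by rewrite divfK// gt_eqF.
(* The added 1 keeps C positive, so that C times +oo is +oo even if K = 0. *)
pose C := K `^ q * (4 * M ^+ 2) `^ (s * k) + 1.
have C0 : 0 < C by rewrite ltr_wpDl// mulr_ge0// powR_ge0.
have mHq : measurable_fun setT (fun x => `|H x| `^ q)%E.
  apply: (measurableT_comp (measurable_poweR _)).
  exact: measurableT_comp.
apply: (@le_lt_trans _ _ (\int[mu]_x (C%:E * row_npow (2 * s) x))%E).
  apply: ge0_le_integral => //.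
  - by move=> x _; exact: poweR_ge0.
  - by apply: measurable_funeM; exact: measurable_row_npow.
  move=> x _; have [xM|xM] := pselect (row_box M x); last first.
    rewrite HM// abse0 poweR0r ?gt_eqF ?(lt_le_trans _ q1)//.
    by rewrite mule_ge0 ?row_npow_ge0// lee_fin ltW.
  (* If f x <= 0, the lower bound on f forces coordinate l to vanish, and the dominating function is
     infinite there. *)
  have [fx0|fx0] := ltP 0 (f x); last first.
    have li : (l <= Ordinal lm)%N by [].
    have := fl x li => fl0; have xi : x ord0 (Ordinal lm) = 0.
      apply/eqP; rewrite -sqrf_eq0 eq_le sqr_ge0 andbT.
      by move: fl0; rewrite minEle; case: ifP => _; lra.
    by rewrite (row_npow_eqy _ xM xi) gt0_muley ?leey.
  have Hx := HK x fx0.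
  have : (`|H x| `^ q <= (K * f x `^ (- r))%:E `^ q)%E.
    by apply: gt0_ler_poweR => //; rewrite in_itv/= ?leey ?andbT// lee_fin mulr_ge0 ?powR_ge0.
  move=> /le_trans; apply; rewrite poweR_EFin powRM ?powR_ge0//.
  rewrite -powRrM mulNr -sk EFinM.
  have P := power_le_row_npow s0 xM fx0.
  apply: (@le_trans _ _ ((K `^ q)%:E * (((4 * M ^+ 2) `^ (s * k))%:E * row_npow (2 * s) x))%E).
    by apply: lee_wpmul2l => //; rewrite lee_fin powR_ge0.
  rewrite muleA -EFinM; apply: lee_wpmul2r; first exact: row_npow_ge0.
  by rewrite lee_fin lerDl.
rewrite ge0_integralZl_EFin//.
- apply: lte_mul_pinfty => //; first by rewrite lee_fin ltW.
  apply: row_npow_lty; rewrite mulr_ge0//=.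
  by rewrite mulrA ltr_pdivrMr// mul1r.
- by move=> x _; exact: row_npow_ge0.
- exact: measurable_row_npow.
- by rewrite ltW.
Qed.

End singular_integrability.

(** * Integration by parts along coordinate lines *)

Section ibp_row.
Context {R : realType} (n : nat).
Local Notation leb := (@lebesgue_measure R).
Local Notation mR := (measurableTypeR R).
Implicit Types (V W eta : 'rV[R]_n -> R) (v x : 'rV[R]_n).

Let line_quotient eta v x (t : R) :
  (fun h : R => h^-1 *: (((fun s : R => eta (s *: v + x)) \o shift t) (h *: 1) - eta (t *: v + x))) =
  (fun h : R => h^-1 *: ((eta \o shift (t *: v + x)) (h *: v) - eta (t *: v + x))).
Proof.
by apply/funext => h /=; rewrite scalerDl -addrA /GRing.scale/= mulr1.
Qed.

Lemma derivable_line eta v x (t : R) :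
  derivable (fun s : R => eta (s *: v + x)) t 1 <-> derivable eta (t *: v + x) v.
Proof. by rewrite /derivable line_quotient. Qed.

Lemma derive_line eta v x (t : R) :
  'D_1 (fun s : R => eta (s *: v + x)) t = 'D_v eta (t *: v + x).
Proof. by rewrite /derive line_quotient. Qed.

Lemma is_derive_line eta v x (t d : R) :
  is_derive (t *: v + x) v eta d -> is_derive t (1 : R) (fun s : R => eta (s *: v + x)) d.
Proof. by case=> h <-; split; [exact/derivable_line|exact: derive_line]. Qed.

Lemma measurable_line v x : measurable_fun (setT : set mR) (fun t : R => t *: v + x).
Proof.
apply/measurable_fun_rowP => i.
rewrite (_ : _ \o _ = fun t : R => t * v ord0 i + x ord0 i); last first.
  by apply/funext => t; rewrite /row_coord /= !mxE.
apply: measurable_funD; last exact: measurable_cst.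
by apply: measurable_funM; [exact: measurable_id|exact: measurable_cst].
Qed.

Lemma derive_lipschitz_bound eta v L x :
  0 <= L -> (forall h : R, `|eta (h *: v + x) - eta x| <= L * `|h|) ->
  `|'D_v eta x| <= L.
Proof.
move=> L0 elip; have [dx|dx] := pselect (derivable eta x v); last first.
  by rewrite /derive dvgP// normr0.
move: dx => /cvg_ex[/= l dl]; rewrite /derive (cvg_lim _ dl)//.
apply: (closed_cvg (fun y : R => `|y| <= L)) dl.
  apply: (@preimage_closed _ _ (Num.norm : R -> R) [set y | y <= L]); last exact: closed_le.
  by move=> y _; exact: norm_continuous.
near=> h; have h0 : h != 0 by near: h; exact: nbhs_dnbhs_neq.
by rewrite normrM normfV mulrC ler_pdivrMr ?normr_gt0.
Unshelve. all: by end_near. Qed.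

(** [eta] enters through a bound on the box and a Lipschitz estimate in direction i; the same
    statement thus serves the Lipschitz test functions of the equation and the smooth ones of the
    weak gradient. *)
Lemma ibp_row (i : 'I_n) V W eta C H L M : 0 <= C -> 0 <= L -> 0 <= M ->
  (forall x, is_derive x (basis_row i) V (W x)) ->
  continuous V -> measurable_fun setT W ->
  (forall x, `|V x| <= C) -> (forall x, `|W x| <= C) ->
  (forall x, ~ row_box M x -> V x = 0 /\ W x = 0) ->
  continuous eta -> (forall x, row_box M x -> `|eta x| <= H) ->
  (forall x (h : R), `|eta (h *: basis_row i + x) - eta x| <= L * `|h|) ->
  (\int[lebesgue_row n]_x (V x * 'D_(basis_row i) eta x + W x * eta x)%:E = 0)%E.
Proof.
move=> C0 L0 M0 dV cV mW VC WC VM ceta etaH elip.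
have mF : measurable_fun setT (fun x => V x * 'D_(basis_row i) eta x + W x * eta x).
  apply: measurable_funD; apply: measurable_funM => //.
  - exact: continuous_row_measurable.
  - exact: measurable_derive.
  - exact: continuous_row_measurable.
apply: (@integral_lines_eq0 _ _ i (fun x => V x * 'D_(basis_row i) eta x + W x * eta x) (C * L + C * `|H|) M) => //.
- move=> x; have [xM|xM] := pselect (row_box M x); last first.
    by have [-> ->] := VM x xM; rewrite !mul0r addr0 normr0 addr_ge0// mulr_ge0.
  rewrite (le_trans (ler_normD _ _))// !normrM lerD// ler_pM//.
    exact: derive_lipschitz_bound.
  exact: le_trans (etaH x xM) (ler_norm _).
- by move=> x xM; have [-> ->] := VM x xM; rewrite !mul0r addr0.
move=> x; pose v s := V (s *: basis_row i + x); pose w s := W (s *: basis_row i + x).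
pose e s := eta (s *: basis_row i + x).
suff E : (\int[leb]_t (v t * 'D_1 e t + w t * e t)%:E = 0)%E.
  by rewrite -[RHS]E; apply: eq_integral => t _; rewrite /v /w /e derive_line.
(* Beyond this radius the i-th coordinate t + x_i has modulus greater than M, so the line has left
   the box; the 1 also gives the radius at least 1 that [ibp_line] asks for. *)
apply: (@ibp_line R v w e C L (M + `|x ord0 i| + 1) C0 L0) => //.
- by rewrite lerDr addr_ge0.
- by move=> t; exact: is_derive_line.
- by move=> t; exact: WC.
- move=> t Mt; have [] // := VM (t *: basis_row i + x).
  move=> /(_ i); rewrite /= in_itv/= !mxE !eqxx mulr1 -ler_norml => h.
  have := ler_normD (t + x ord0 i) (- x ord0 i); rewrite addrK normrN; lra.
- move=> s t; have := elip (t *: basis_row i + x) (s - t).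
  by rewrite addrA -scalerDl subrK.
- rewrite [X in measurable_fun _ X](_ : _ =
    (fun x => V x * 'D_(basis_row i) eta x + W x * eta x) \o (fun t : mR => t *: basis_row i + x)).
    by apply: measurableT_comp => //; exact: measurable_line.
  by apply/funext => t; rewrite /v /w /e derive_line.
Qed.

End ibp_row.

(** * Smooth functions *)

Section flat.
Context {R : realType}.
Implicit Types (p : {poly R}) (t : R).

(* The functions p(1/t) exp(-1/t), extended by 0 to t <= 0; this family is closed
   under derivation. *)
Definition flat p t : R := if 0 < t then p.[t^-1] * expR (- t^-1) else 0.

(** With s = 1/t, the derivative in t of p(s) exp(-s) is s^2 (p(s) - p'(s)) exp(-s). *)
Definition dflat p : {poly R} := 'X^2 * (p - p^`()).

(** Induction on p: half of the exponent serves the induction hypothesis, and the other half absorbs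
    the new factor x because exp y >= 1 + y. *)
Lemma poly_expR_bound p e : 0 < e ->
  exists2 C, 0 <= C & forall x, 0 <= x -> `|p.[x]| <= C * expR (e * x).
Proof.
elim/poly_ind: p e => [|p c IHp] e e0.
  by exists 0 => // x _; rewrite horner0 normr0 mul0r.
have e20 : 0 < e / 2 by rewrite divr_gt0.
have [C C0 HC] := IHp _ e20.
exists (C * (e / 2)^-1 + `|c|).
  by rewrite addr_ge0// mulr_ge0// invr_ge0 ltW.
move=> x x0; rewrite hornerMXaddC (le_trans (ler_normD _ _))// mulrDl lerD//; last first.
  by rewrite -[leLHS]mulr1 ler_wpM2l// -expR0 ler_expR mulr_ge0// ltW.
rewrite normrM (ger0_norm x0) (_ : e * x = e / 2 * x + e / 2 * x); last by field.
set E := expR (e / 2 * x); rewrite expRD -/E.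
have xE : x <= (e / 2)^-1 * E.
  by rewrite ler_pdivlMl// (le_trans _ (expR_ge1Dx _))// lerDr.
rewrite (_ : C / (e / 2) * (E * E) = C * E * ((e / 2)^-1 * E)); last by ring.
by rewrite ler_pM// HC.
Qed.

Lemma flat_gt0 p t : 0 < t -> flat p t = p.[t^-1] * expR (- t^-1).
Proof. by rewrite /flat => ->. Qed.

Lemma flat_le0 p t : t <= 0 -> flat p t = 0.
Proof. by rewrite /flat leNgt => /negbTE ->. Qed.

(** Here the loss e is incurred: the polynomial in 1/t is paid for with exp(e/t). *)
Lemma flat_bound p e : 0 < e -> exists2 C, 0 <= C & forall t, 0 < t ->
  `|flat p t| <= C * expR (- t^-1) `^ (1 - e).
Proof.
move=> e0; have [C C0 HC] := poly_expR_bound p e0; exists C => // t t0.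
rewrite flat_gt0// normrM (ger0_norm (expR_ge0 _)) -expRM.
rewrite (_ : - t^-1 * (1 - e) = e * t^-1 - t^-1); last by ring.
by rewrite expRD mulrA ler_wpM2r ?expR_ge0// HC// invr_ge0 ltW.
Qed.

(** The previous exponential bound for X^2 p, with e = 1. Quadratic decay makes the difference
    quotient at the origin tend to 0, and also yields a global bound on [bump2] over s >= 0. *)
Lemma flat_linear_bound p : exists2 C, 0 <= C & forall t, `|flat p t| <= C * t ^+ 2.
Proof.
have [C C0 HC] := poly_expR_bound ('X^2 * p) (@ltr01 R).
exists C => // t; have [t0|t0] := leP t 0.
  by rewrite flat_le0// normr0 mulr_ge0// sqr_ge0.
have ti0 : 0 < t^-1 by rewrite invr_gt0.
have := HC _ (ltW ti0); rewrite mul1r hornerM hornerXn normrM => H.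
rewrite flat_gt0// normrM (ger0_norm (expR_ge0 _)) expRN.
rewrite ler_pdivrMr ?expR_gt0//.
have -> : `|p.[t^-1]| = t ^+ 2 * (`|t^-1 ^+ 2| * `|p.[t^-1]|).
  by rewrite [X in _ * (X * _)]ger0_norm ?sqr_ge0// exprVn mulVKf// expf_neq0// gt_eqF.
rewrite (_ : C * t ^+ 2 * _ = t ^+ 2 * (C * expR t^-1)); last by ring.
by rewrite ler_wpM2l ?sqr_ge0.
Qed.

Lemma is_derive_flat p t : is_derive t (1 : R) (flat p) (flat (dflat p) t).
Proof.
have [t0|t0|->] := ltgtP t 0.
- rewrite flat_le0 ?ltW//; apply: (@near_eq_is_derive _ _ _ (cst 0)).
  near=> s; rewrite flat_le0//; apply: ltW.
  by near: s; exact: lt_nbhsl.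
- have tn0 : t != 0 by rewrite gt_eqF.
  have di : is_derive t (1 : R) (fun s : R => s^-1) (- t ^- 2).
    have := @is_deriveV R id t 1 1 tn0 (is_derive_id t (1 : R)).
    by rewrite /GRing.scale/= mulr1.
  have dp : is_derive t (1 : R) (fun s : R => p.[s^-1]) (p^`().[t^-1] * - t ^- 2).
    exact: (@is_derive1_comp R (horner p) (fun s : R => s^-1)).
  have de : is_derive t (1 : R) (fun s : R => expR (- s^-1)) (expR (- t^-1) * t ^- 2).
    have dN : is_derive t (1 : R) (fun s : R => - s^-1) (t ^- 2).
      by rewrite -[t ^- 2]opprK; exact: is_deriveN.
    exact: (@is_derive1_comp R expR (fun s : R => - s^-1)).
  have dpe : is_derive t (1 : R) (fun s : R => p.[s^-1] * expR (- s^-1)) (flat (dflat p) t).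
    apply: (is_derive_eq (is_deriveM dp de)).
    rewrite flat_gt0// /dflat hornerM hornerXn hornerD hornerN.
    by rewrite /GRing.scale/= exprVn; ring.
  apply: (near_eq_is_derive _ dpe).
  by near=> s; rewrite flat_gt0//; near: s; exact: lt_nbhsr.
rewrite [flat _ 0]flat_le0//; apply/is_derive1_caratheodory.
have [C C0 HC] := flat_linear_bound p.
(* At z = 0 this slope function has the value 0, because the inverse of 0 is 0; that is the
   derivative wanted. *)
exists (fun z => flat p z / z); split.
- move=> z; rewrite [flat p 0]flat_le0// !subr0; have [->|z0] := eqVneq z 0.
    by rewrite flat_le0// mulr0.
  by rewrite divfK.
- apply/cvgrPdist_le => e e0.
  near=> z; rewrite /= invr0 mulr0 sub0r normrN normrM normfV.
  have [->|z0] := eqVneq z 0; first by rewrite flat_le0// normr0 mul0r ltW.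
  rewrite ler_pdivrMr ?normr_gt0// (le_trans (HC z))// -real_normK ?num_real//.
  rewrite expr2 mulrA ler_wpM2r//.
  have : `|0 - z| <= e / (C + 1).
    by near: z; apply: cvgr_dist_le => //; rewrite divr_gt0// ltr_wpDl.
  rewrite sub0r normrN ler_pdivlMr ?ltr_wpDl// => h.
  by rewrite mulrC (le_trans _ h)// ler_wpM2l// lerDl.
by rewrite invr0 mulr0.
Unshelve. all: by end_near. Qed.

End flat.

Section smooth_algebra.
Context {R : realType} {m : nat}.
Implicit Types (f g : 'rV[R]_m -> R) (x v : 'rV[R]_m) (i j : 'I_m).

(** Restricting f to the line through x in direction v reduces this to the one-variable chain rule;
    f need not be differentiable in the full sense. *)
Lemma is_derive_comp_line (g : R -> R) f x v (a b : R) :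
  is_derive (f x) (1 : R) g a -> is_derive x v f b ->
  is_derive x v (fun y => g (f y)) (a * b).
Proof.
move=> dg df; have x0 : 0 *: v + x = x by rewrite scale0r add0r.
have := @is_derive1_comp R g (fun s : R => f (s *: v + x)) 0 a b.
rewrite x0 => /(_ dg) H.
have df0 : is_derive (0 *: v + x) v f b by rewrite x0.
have [h1 h2] := H (is_derive_line df0).
split; first by have := (derivable_line (fun y => g (f y)) v x 0).1 h1; rewrite x0.
by have := derive_line (fun y => g (f y)) v x 0; rewrite x0 => <-.
Qed.

(* A class of functions closed under partial derivatives, rich enough for the
   construction; each member is therefore smooth. *)
Inductive elem : ('rV[R]_m -> R) -> Prop :=
| elem_cst c : elem (fun=> c)
| elem_coord i : elem (fun x => x ord0 i)
| elem_add f g : elem f -> elem g -> elem (fun x => f x + g x)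
| elem_mul f g : elem f -> elem g -> elem (fun x => f x * g x)
| elem_flat p f : elem f -> elem (fun x => flat p (f x)).

Lemma elem_opp f : elem f -> elem (fun x => - f x).
Proof.
move=> ef; rewrite [X in elem X](_ : _ = fun x => -1 * f x).
  by apply: elem_mul => //; exact: elem_cst.
by apply/funext => x; rewrite mulN1r.
Qed.

Lemma elem_differentiable f : elem f -> forall x, differentiable f x.
Proof.
elim=> [c|i|{}f g _ IHf _ IHg|{}f g _ IHf _ IHg|p {}f _ IHf] x.
- exact: differentiable_cst.
- exact: differentiable_coord.
- exact: differentiableD.
- exact: differentiableM.
- apply: (@differentiable_comp _ _ _ _ f (flat p)) => //.
  by apply/derivable1_diffP; case: (is_derive_flat p (f x)).
Qed.

Lemma elem_continuous f : elem f -> continuous f.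
Proof. by move=> ef x; exact/differentiable_continuous/elem_differentiable. Qed.

Lemma elem_is_derive f x i : elem f -> is_derive x (basis_row i) f (partial i f x).
Proof. by move=> /elem_differentiable df; apply: derivableP; exact: diff_derivable. Qed.

Lemma is_derive_coord x v i : is_derive x v (fun y : 'rV[R]_m => y ord0 i) (v ord0 i).
Proof.
have H : (fun h : R => h^-1 *: (((fun y : 'rV[R]_m => y ord0 i) \o shift x) (h *: v) - x ord0 i)) @ 0^' --> v ord0 i.
  apply: cvg_near_cst; near=> h; have h0 : h != 0 by near: h; exact: nbhs_dnbhs_neq.
  by rewrite /= !mxE addrK /GRing.scale/= mulKf.
by split; [apply/cvg_ex; exists (v ord0 i)|exact: cvg_lim H].
Unshelve. all: by end_near. Qed.

Lemma partial_cst i (c : R) : partial i (fun=> c) = fun=> 0.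
Proof. by apply/funext => x; rewrite /partial; exact: derive_val. Qed.

Lemma partial_coord i j : partial i (fun x : 'rV[R]_m => x ord0 j) = fun=> (i == j)%:R.
Proof.
apply/funext => x; rewrite /partial.
by have [_ ->] := is_derive_coord x (basis_row i) j; rewrite /basis_row mxE eqxx eq_sym.
Qed.

Lemma partialD i f g : elem f -> elem g ->
  partial i (fun x => f x + g x) = fun x => partial i f x + partial i g x.
Proof.
move=> ef eg; apply/funext => x.
by have [_] := is_deriveD (elem_is_derive x i ef) (elem_is_derive x i eg).
Qed.

Lemma partialN i f : elem f -> partial i (fun x => - f x) = fun x => - partial i f x.
Proof.
by move=> ef; apply/funext => x; have [_] := is_deriveN (elem_is_derive x i ef).
Qed.

Lemma partialM i f g : elem f -> elem g ->
  partial i (fun x => f x * g x) = fun x => f x * partial i g x + g x * partial i f x.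
Proof.
move=> ef eg; apply/funext => x.
by have [_] := is_deriveM (elem_is_derive x i ef) (elem_is_derive x i eg).
Qed.

Lemma partial_comp i f (g g' : R -> R) : elem f ->
  (forall t : R, is_derive t (1 : R) g (g' t)) ->
  partial i (fun x => g (f x)) = fun x => g' (f x) * partial i f x.
Proof.
move=> ef dg; apply/funext => x.
by have [_] := is_derive_comp_line (dg (f x)) (elem_is_derive x i ef).
Qed.

Lemma elem_partial i f : elem f -> elem (partial i f).
Proof.
elim=> [c|j|{}f g ef IHf eg IHg|{}f g ef IHf eg IHg|p {}f ef IHf].
- rewrite partial_cst; exact: elem_cst.
- rewrite partial_coord; exact: elem_cst.
- rewrite partialD//; exact: elem_add.
- by rewrite partialM//; apply: elem_add; apply: elem_mul.
- rewrite (partial_comp _ ef (is_derive_flat p)); apply: elem_mul => //.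
  exact: elem_flat.
Qed.

Lemma elem_smooth f : elem f -> smooth f.
Proof.
move=> ef s; have es : elem (foldr partial f s).
  by elim: s => //= i s; exact: elem_partial.
split; first exact: elem_continuous.
by move=> i x; exact/diff_derivable/elem_differentiable.
Qed.

Lemma elem_derive f x v : elem f -> 'D_v f x = dotp (grad f x) v.
Proof.
move=> ef; have df := elem_differentiable ef x.
rewrite deriveE// {1}(row_sum_delta v) linear_sum/=.
apply: eq_bigr => i _; rewrite linearZ/= mxE mulrC; congr (_ * _).
by rewrite /partial deriveE.
Qed.

Lemma elem_sum (I : Type) (s : seq I) (P : pred I) (F : I -> 'rV[R]_m -> R) :
  (forall k, elem (F k)) -> elem (fun x => \sum_(k <- s | P k) F k x).
Proof.
move=> eF; elim: s => [|k s IHs].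
  rewrite [X in elem X](_ : _ = fun=> 0); first exact: elem_cst.
  by apply/funext => x; rewrite big_nil.
rewrite [X in elem X](_ : _ = fun x => (if P k then F k x else 0) + \sum_(j <- s | P j) F j x); last first.
  by apply/funext => x; rewrite big_cons; case: ifP => // _; rewrite add0r.
by apply: elem_add => //; case: (P k) => //; exact: elem_cst.
Qed.

End smooth_algebra.

(** * Bounds from compact support, and Glaeser's inequality *)

Section bounded_derivatives.
Context {R : realType} {m : nat}.
Implicit Types (f g : 'rV[R]_m -> R) (x v : 'rV[R]_m) (i j : 'I_m).

Lemma row_box_compact M : compact (@row_box R m M).
Proof.
by apply: (@rV_compact R _ (fun=> `[- M, M]%classic)) => _; exact: segment_compact.
Qed.

Lemma row_box_bounded f M : continuous f -> exists2 C, 0 <= C & forall x, row_box M x -> `|f x| <= C.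
Proof.
move=> cf; have := compact_bounded (continuous_compact (continuous_subspaceT cf) (@row_box_compact M)).
move=> [C [_ HC]]; exists (`|C| + 1); first by rewrite addr_ge0.
by move=> x Bx; apply: (HC (`|C| + 1)); [rewrite ltr_pwDr ?ler_norm|exists x].
Qed.

Lemma bounded_of_box f M : continuous f -> (forall x, ~ row_box M x -> f x = 0) ->
  exists2 C, 0 <= C & forall x, `|f x| <= C.
Proof.
move=> cf fM; have [C C0 HC] := row_box_bounded M cf; exists C => // x.
by have [/HC//|/fM ->] := pselect (row_box M x); rewrite normr0.
Qed.

Lemma row_box_closed M : closed (@row_box R m M).
Proof. exact: compact_closed (@norm_hausdorff _ _) (@row_box_compact M). Qed.

Lemma partial_supp i f (A : set 'rV[R]_m) : closed A ->
  (forall x, ~ A x -> f x = 0) -> forall x, ~ A x -> partial i f x = 0.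
Proof.
move=> cA fA x xA; rewrite /partial (@near_eq_derive _ _ _ f (cst 0)) ?derive_cst//.
have /closed_openC oC := cA.
have : nbhs x (~` A) by exact: open_nbhs_nbhs.
by apply: filterS => y /fA.
Qed.

(** The mean value theorem gives 0 <= g(t + h) <= g(t) + h g'(t) + M h^2 for every h, and a
    quadratic polynomial without sign change has nonpositive discriminant. *)
Lemma glaeser (g g1 g2 : R -> R) M : 0 <= M ->
  (forall t : R, is_derive t (1 : R) g (g1 t)) ->
  (forall t : R, is_derive t (1 : R) g1 (g2 t)) ->
  (forall t, 0 <= g t) -> (forall t, `|g2 t| <= M) ->
  forall t, g1 t ^+ 2 <= 4 * M * g t.
Proof.
move=> M0 dg dg1 g0 gM t.
have cg z : {for z, continuous g}.
  by apply/differentiable_continuous/derivable1_diffP; case: (dg z).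
have lip := lipschitz_of_derive dg1 gM.
have H h : 0 <= g t + h * g1 t + M * h ^+ 2.
  have [h0|/ltW h0] := leP 0 h.
    have th : t <= t + h by lra.
    have [c] := @MVT_segment R g g1 _ _ th (fun z _ => dg z) (continuous_subspaceT cg).
    rewrite in_itv/= => /andP[c1 c2] E.
    have := lip c t; rewrite (ger0_norm (_ : 0 <= c - t)) ?subr_ge0// => l1.
    have l2 : M * (c - t) <= M * h by rewrite ler_wpM2l//; lra.
    have l3 : g1 c <= g1 t + M * h by have := ler_norm (g1 c - g1 t); lra.
    have := g0 (t + h); have := ler_wpM2l h0 l3; lra.
  have th : t + h <= t by lra.
  have [c] := @MVT_segment R g g1 _ _ th (fun z _ => dg z) (continuous_subspaceT cg).
  rewrite in_itv/= => /andP[c1 c2] E.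
  have := lip t c; rewrite (ger0_norm (_ : 0 <= t - c)) ?subr_ge0// => l1.
  have l2 : M * (t - c) <= M * - h by rewrite ler_wpM2l//; lra.
  have l3 : g1 t + M * h <= g1 c by have := ler_norm (g1 t - g1 c); lra.
  have := g0 (t + h); have := ler_wnM2l h0 l3; lra.
have [M0'|M0'] := eqVneq M 0.
  have H0 h : 0 <= g t + h * g1 t by have := H h; rewrite M0' mul0r addr0.
  have [-> |g1n] := eqVneq (g1 t) 0; first by rewrite expr0n/= !mulr_ge0.
  have := H0 (- (g t + 1) / g1 t); rewrite divfK//; lra.
have Mp : 0 < M by rewrite lt_def M0'.
(* The minimiser in h of the quadratic polynomial. *)
have := H (- g1 t / (2 * M)).
rewrite (_ : _ + _ = (4 * M * g t - g1 t ^+ 2) / (4 * M)); last by field.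
by rewrite pmulr_lge0 ?subr_ge0// invr_gt0 mulr_gt0.
Qed.

Lemma glaeser_partial f M i : 0 <= M -> elem f -> (forall x, 0 <= f x) ->
  (forall x, `|partial i (partial i f) x| <= M) ->
  forall x, partial i f x ^+ 2 <= 4 * M * f x.
Proof.
move=> M0 ef f0 fM x.
pose L (h : 'rV[R]_m -> R) (s : R) := h (s *: basis_row i + x).
have x0 : 0 *: basis_row i + x = x by rewrite scale0r add0r.
have := @glaeser (L f) (L (partial i f)) (L (partial i (partial i f))) M M0.
move=> /(_ _ _ _ _ 0); rewrite /L x0; apply.
- by move=> t; apply: is_derive_line; exact: elem_is_derive.
- by move=> t; apply: is_derive_line; apply: elem_is_derive; exact: elem_partial.
- by move=> t; exact: f0.
- by move=> t; exact: fM.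
Qed.

End bounded_derivatives.

(** * Functions with controlled defect 1 - |Du|^2 *)

Section euclidean_norms.
Context {R : realType}.

Lemma sqrt_sum_sqr_le (I : Type) (s : seq I) (f : I -> R) :
  Num.sqrt (\sum_(i <- s) f i ^+ 2) <= \sum_(i <- s) `|f i|.
Proof.
have S0 : 0 <= \sum_(i <- s) `|f i| by exact: sumr_ge0.
rewrite -(ger0_norm S0) -sqrtr_sqr ler_wsqrtr//.
elim: s {S0} => [|i s IHs]; first by rewrite !big_nil expr0n.
have S0 : 0 <= \sum_(j <- s) `|f j| by exact: sumr_ge0.
rewrite !big_cons sqrrD real_normK ?num_real// -addrA lerD2l.
by apply: le_trans IHs _; rewrite lerDr mulrn_wge0// mulr_ge0.
Qed.

Lemma enorm_le_sum n (x : 'rV[R]_n) : enorm x <= \sum_i `|x ord0 i|.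
Proof.
rewrite /enorm /dotp (eq_bigr (fun i => x ord0 i ^+ 2)) => [|i _]; last by rewrite expr2.
exact: sqrt_sum_sqr_le.
Qed.

Lemma hsnorm_le_sum n (A : 'M[R]_n) : hsnorm A <= \sum_i \sum_j `|A i j|.
Proof.
rewrite /hsnorm pair_big/= (pair_big xpredT xpredT (fun i j => `|A i j|))/=.
exact: (sqrt_sum_sqr_le (index_enum _) (fun p : 'I_n * 'I_n => A p.1 p.2)).
Qed.

End euclidean_norms.

Section boxes.
Context {R : realType} {n : nat}.

Lemma coord_le_norm (x : 'rV[R]_n) i : `|x ord0 i| <= `|x|.
Proof.
rewrite [leRHS]/Num.norm/= mx_normrE.
exact: (le_bigmax _ (fun ij => `|x ij.1 ij.2|) (ord0, i)).
Qed.

Lemma bounded_row_box (C : set 'rV[R]_n) : bounded_set C ->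
  exists2 M, 1 <= M & C `<=` row_box M.
Proof.
move=> [M [_ CM]]; exists (`|M| + 1); first by rewrite lerDr.
move=> x Cx i; rewrite /= in_itv/= -ler_norml.
apply: le_trans (coord_le_norm x i) _; apply: (CM (`|M| + 1)) => //.
by rewrite ltr_pwDr// ler_norm.
Qed.

End boxes.

Section Lp_membership.
Context {R : realType} {m : nat}.
Local Notation mu := (@lebesgue_row R m).

Lemma in_Lp_of_integral (q : R) D f : measurable D -> measurable_fun D f ->
  (\int[mu]_x (`|(f \_ D) x| `^ q) < +oo)%E -> in_Lp q%:E D f.
Proof.
by move=> mD mf fq; split=> //; rewrite unlock; exact: poweR_lty.
Qed.

End Lp_membership.

Section test_functions.
Context {R : realType} {m : nat}.
Local Notation mu := (@lebesgue_row R m).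
Implicit Types (eta phi : 'rV[R]_m -> R) (Omega : set 'rV[R]_m).

Lemma lipschitz_bound eta : [lipschitz eta x | x in setT] ->
  exists2 L, 0 <= L & forall x y, `|eta x - eta y| <= L * `|x - y|.
Proof.
move=> [K [_ hK]]; exists (`|K| + 1); first by rewrite addr_ge0.
move=> x y; apply: (hK (`|K| + 1) _ (x, y)) => //.
by rewrite ltr_pwDr// ler_norm.
Qed.

Lemma continuous_of_lipschitz eta L : 0 <= L ->
  (forall x y, `|eta x - eta y| <= L * `|x - y|) -> continuous eta.
Proof.
move=> L0 hL x; apply/(@cvgrPdist_le _ _ _ _ (nbhs_filter x)) => e e0.
have L1 : 0 < L + 1 by rewrite ltr_wpDl.
apply/(@nbhs_normP R 'rV[R]_m); exists (e / (L + 1)); first by rewrite /= divr_gt0.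
move=> y /= xy; apply: le_trans (hL x y) _.
apply: (@le_trans _ _ ((L + 1) * `|x - y|)); first by rewrite ler_wpM2r// lerDl.
by rewrite -ler_pdivlMl// mulrC ltW.
Qed.

Lemma off_supp eta x : ~ supp eta x -> eta x = 0.
Proof.
move=> xs; apply/eqP/negPn/negP => ex; apply: xs.
exact: (@subset_closure _ [set x | eta x != 0]).
Qed.

Lemma partial_off_supp eta i x : ~ supp eta x -> partial i eta x = 0.
Proof.
by move=> xs; apply: partial_supp xs; [exact: closed_closure|exact: off_supp].
Qed.

Lemma integral_restrict_eq0 Omega (f : 'rV[R]_m -> \bar R) :
  (forall x, ~ Omega x -> f x = 0%E) -> (\int[mu]_(x in Omega) f x = \int[mu]_x f x)%E.
Proof.
move=> f0; rewrite integral_mkcond; apply: eq_integral => x _.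
by rewrite patchE; case: ifPn => // /negP xO; rewrite f0// => /mem_set.
Qed.

Lemma in_Lp_pinfty Omega (f : 'rV[R]_m -> R) (C : R) : measurable_fun setT f -> (forall x, `|f x| <= C) ->
  in_Lp +oo%E Omega (EFin \o f).
Proof.
move=> mf fC; split; first by apply: measurable_funTS; exact/measurable_EFinP.
rewrite unlock; case: ifP => // _; apply: (@le_lt_trans _ _ C%:E); last exact: ltry.
apply/ess_sup_inf.ess_supP; apply: nearW => x /=; rewrite patchE; case: ifP => _ /=.
  by rewrite lee_fin.
by rewrite lee_fin normr0 (le_trans _ (fC 0)).
Qed.

Lemma smooth_line_lipschitz phi N : smooth phi -> supp phi `<=` row_box N ->
  exists2 L, 0 <= L & forall i x (h : R), `|phi (h *: basis_row i + x) - phi x| <= L * `|h|.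
Proof.
move=> sphi sN.
have off i x : ~ row_box N x -> partial i phi x = 0.
  by move=> xN; apply: partial_off_supp => /sN.
have /choice[C hC] : forall i, exists C, 0 <= C /\ forall x, `|partial i phi x| <= C.
  move=> i; have [] := @bounded_of_box _ _ (partial i phi) N.
  - by have [] := sphi [:: i].
  - exact: off.
  - by move=> C C0 CP; exists C.
exists (\sum_i C i) => [|i x h]; first by apply: sumr_ge0 => i _; case: (hC i).
have dl (t : R) : is_derive t (1 : R) (fun s : R => phi (s *: basis_row i + x))
    (partial i phi (t *: basis_row i + x)).
  apply: is_derive_line; have [_ /(_ i (t *: basis_row i + x)) d] := sphi [::].
  exact: DeriveDef.
have := @lipschitz_of_derive _ _ _ (C i) dl => /(_ (fun t => (hC i).2 _)) /(_ h 0).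
rewrite scale0r add0r subr0 => /le_trans; apply; rewrite ler_wpM2r//.
rewrite (bigD1 i)//= lerDl; apply: sumr_ge0 => j _; by case: (hC j).
Qed.

End test_functions.

(** * Integrability and the weak equation for a function with degenerate defect *)

Section singular_solution.
Context {R : realType} {m : nat}.
Variables (l : nat) (u : 'rV[R]_m -> R) (M : R).
Hypothesis lm : (l < m)%N.
Hypothesis M1 : 1 <= M.
Hypothesis eu : elem u.
Hypothesis uM : forall x, ~ row_box M x -> u x = 0.
Local Notation mu := (@lebesgue_row R m).
Local Notation k := ((m - l)%:R : R).

Definition lorentz (v : 'rV[R]_m -> R) x : R := 1 - dotp (grad v x) (grad v x).
Local Notation F := (lorentz u).
Definition third x : R := dotp (grad u x *m hessian u x) (grad u x).

Hypothesis F0 : forall x, 0 <= F x.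
Hypothesis Fl : forall (x : 'rV[R]_m) (i : 'I_m), (l <= i)%N ->
  Num.min (x ord0 i ^+ 2) 1 / 4 <= F x.
Hypothesis hess_gradF : exists2 K, 0 <= K & forall x j,
  `|(grad u x *m hessian u x) ord0 j| <= K * Num.sqrt (F x).
Hypothesis thirdF : forall e : R, 0 < e < 1 -> exists2 K, 0 <= K &
  forall x, `|third x| <= K * F x `^ (1 - e).

Lemma elem_lorentz : elem F.
Proof.
apply: elem_add; first exact: elem_cst.
apply: elem_opp; rewrite /dotp; apply: elem_sum => i.
rewrite (_ : (fun x => _) = fun x => partial i u x * partial i u x).
  by apply: elem_mul; exact: elem_partial.
by apply/funext => x; rewrite !mxE.
Qed.

Lemma elem_hess_grad j : elem (fun x => (grad u x *m hessian u x) ord0 j).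
Proof.
rewrite (_ : (fun x => _) = fun x => \sum_i partial i u x * partial i (partial j u) x).
  by apply: elem_sum => i; apply: elem_mul; do ?apply: elem_partial.
by apply/funext => x; rewrite mxE; apply: eq_bigr => i _; rewrite !mxE.
Qed.

Lemma elem_third : elem third.
Proof.
apply: elem_sum => j; apply: elem_mul; first exact: elem_hess_grad.
rewrite (_ : (fun x => _) = partial j u); first exact: elem_partial.
by apply/funext => x; rewrite mxE.
Qed.

Let elem_measurable (f : 'rV[R]_m -> R) : elem f -> measurable_fun setT f.
Proof. by move=> ef; apply: continuous_row_measurable; exact: elem_continuous. Qed.

Lemma lorentz_le1 x : F x <= 1.
Proof. by rewrite /lorentz gerBl; apply: sumr_ge0 => i _; rewrite -expr2 sqr_ge0. Qed.

Lemma lorentzE (v : 'rV[R]_m -> R) x : 1 - enorm (grad v x) ^+ 2 = lorentz v x.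
Proof.
rewrite /lorentz /enorm sqr_sqrtr//.
by apply: sumr_ge0 => i _; rewrite -expr2 sqr_ge0.
Qed.

Lemma partial_box i x : ~ row_box M x -> partial i u x = 0.
Proof. by apply: partial_supp => //; exact: row_box_closed. Qed.

Lemma partial2_box i j x : ~ row_box M x -> partial i (partial j u) x = 0.
Proof. by move=> xM; apply: partial_supp xM; [exact: row_box_closed|exact: partial_box]. Qed.

Lemma grad_box x : ~ row_box M x -> grad u x = 0.
Proof. by move=> xM; apply/rowP => i; rewrite !mxE partial_box. Qed.

Lemma hessian_box x : ~ row_box M x -> hessian u x = 0.
Proof. by move=> xM; apply/matrixP => i j; rewrite !mxE partial2_box. Qed.

Lemma dotp0l n (x : 'rV[R]_n) : dotp 0 x = 0.
Proof. by rewrite /dotp big1// => i _; rewrite mxE mul0r. Qed.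

Lemma lorentz_box x : ~ row_box M x -> F x = 1.
Proof. by move=> xM; rewrite /lorentz grad_box// dotp0l subr0. Qed.

Lemma third_box x : ~ row_box M x -> third x = 0.
Proof. by move=> xM; rewrite /third grad_box// mul0mx dotp0l. Qed.

Lemma weight_lorentz x : 0 < F x -> weight (grad u) x = (F x `^ (- 2^-1))%:E.
Proof.
move=> Fx; rewrite /weight lorentzE inver sqrtr_eq0 leNgt Fx/=.
by rewrite powRN powR12_sqrt// ltW.
Qed.

Lemma measurable_weight : measurable_fun setT (weight (grad u)).
Proof.
rewrite (_ : weight _ = fun x => if F x <= 0 then +oo%E else (F x `^ (- 2^-1))%:E).
  apply: measurable_fun_ifT; [|exact: measurable_cst|].
    apply: measurable_fun_ler; last exact: measurable_cst.
    by apply: elem_measurable; exact: elem_lorentz.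
  apply/measurable_EFinP; apply: (measurableT_comp (measurable_powR _)).
  by apply: elem_measurable; exact: elem_lorentz.
apply/funext => x; case: ifPn => [Fx|]; last by rewrite -ltNge => /weight_lorentz.
by rewrite /weight lorentzE inver sqrtr_eq0 Fx.
Qed.

Lemma weightX_singular n K s (g : 'rV[R]_m -> R) x : 0 < F x ->
  `|g x| <= K * F x `^ s ->
  (`|weight (grad u) x ^+ n * (g x)%:E| <= (K * F x `^ (- (n%:R / 2 - s)))%:E)%E.
Proof.
move=> Fx gx; rewrite weight_lorentz// -EFin_expe -EFinM abse_EFin lee_fin.
rewrite -powR_mulrn ?powR_ge0// -powRrM normrM ger0_norm ?powR_ge0//.
rewrite opprB addrC powRD ?(gt_eqF Fx) ?implybT//.
rewrite mulrCA (_ : - 2^-1 * n%:R = - (n%:R / 2)); last by rewrite mulrC mulrN.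
by rewrite ler_wpM2l ?powR_ge0.
Qed.

Lemma measurable_weightX n (g : 'rV[R]_m -> R) : measurable_fun setT g ->
  measurable_fun setT (fun x => weight (grad u) x ^+ n * (g x)%:E)%E.
Proof.
move=> mg; apply: emeasurable_funM; last exact/measurable_EFinP.
elim: n => [|n IHn]; first exact: measurable_cst.
rewrite (_ : (fun x => _) = fun x => (weight (grad u) x * weight (grad u) x ^+ n)%E).
  by apply: emeasurable_funM => //; exact: measurable_weight.
by apply/funext => x; rewrite expeS.
Qed.

(** The three global memberships are the cases (n, s) = (1, 0), (2, 1/2) and (3, 1 - e); the
    singular exponent n/2 - s is then 1/2, 1/2 and 1/2 + e. *)
Lemma in_Lp_weightX n K s q (g : 'rV[R]_m -> R) : 0 <= K -> 1 <= q -> s <= n%:R / 2 ->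
  2 * ((n%:R / 2 - s) * q) < k -> measurable_fun setT g ->
  (forall x, ~ row_box M x -> g x = 0) -> (forall x, `|g x| <= K * F x `^ s) ->
  in_Lp q%:E setT (fun x => weight (grad u) x ^+ n * (g x)%:E)%E.
Proof.
move=> K0 q1 sn nk mg gM gK; apply: in_Lp_of_integral => //.
  exact: measurable_weightX.
rewrite patch_setT.
apply: (@singular_integral_lty _ _ l F M M1 Fl lm K (n%:R / 2 - s)) => //.
- by rewrite subr_ge0.
- exact: measurable_weightX.
- by move=> x xM; rewrite gM// mule0.
- by move=> x Fx; exact: weightX_singular.
Qed.


(** Only local, since w = 1 off the support of u; the box is now adapted to the compact set instead
    of to u. *)
Lemma in_Lp_loc_weight q : 1 <= q < k -> in_Lp_loc q%:E setT (weight (grad u)).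
Proof.
move=> /andP[q1 qk] C cC _; have mC : measurable C.
  by apply: closed_row_measurable; exact: compact_closed (@norm_hausdorff _ _) cC.
have [N N1 CN] := bounded_row_box (compact_bounded cC).
have mw := measurable_weight.
apply: in_Lp_of_integral => //; first exact: measurable_funTS.
apply: (@singular_integral_lty _ _ l F N N1 Fl lm 1 (1 / 2)) => //.
- by lra.
- by apply/(measurable_restrictT _ mC); exact: measurable_funTS.
- by move=> x xN; rewrite patchE memNset// => /CN.
- move=> x Fx; have := @weightX_singular 1 1 0 (fun=> 1) x Fx.
  rewrite normr1 mul1r powRr0 subr0 mule1 => /(_ (lexx _)); apply: le_trans.
  by rewrite patchE; case: ifP => // _; rewrite abse0.
Qed.

Lemma in_Lp_weight_hessian q : 1 <= q < k ->
  in_Lp q%:E setT (fun x => weight (grad u) x * (hsnorm (hessian u x))%:E)%E.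
Proof.
move=> /andP[q1 qk].
have eh i j : elem (partial i (partial j u)) by apply: elem_partial; exact: elem_partial.
have /choice[C hC] : forall ij : 'I_m * 'I_m, exists C, 0 <= C /\
    forall x, `|partial ij.1 (partial ij.2 u) x| <= C.
  move=> [i j]; have [] := @bounded_of_box _ _ (partial i (partial j u)) M.
  - exact: elem_continuous.
  - exact: partial2_box.
  - by move=> C C0 CP; exists C.
apply: (@in_Lp_weightX 1 (\sum_i \sum_j C (i, j)) 0) => //.
- by apply: sumr_ge0 => i _; apply: sumr_ge0 => j _; case: (hC (i, j)).
- by lra.
- apply: continuous_row_measurable => x.
  apply: (@continuous_comp _ _ _ (fun x => \sum_i \sum_j hessian u x i j ^+ 2) (@Num.sqrt R));
    last exact: sqrt_continuous.
  apply: elem_continuous.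
  apply: elem_sum => i; apply: elem_sum => j.
  rewrite (_ : (fun x => _) = fun x => partial i (partial j u) x * partial i (partial j u) x).
    exact: elem_mul.
  by apply/funext => y; rewrite !mxE.
- move=> x xM; rewrite hessian_box// /hsnorm big1 ?sqrtr0// => i _.
  by rewrite big1// => j _; rewrite mxE expr0n.
- move=> x; rewrite powRr0 mulr1 ger0_norm ?sqrtr_ge0//.
  apply: le_trans (hsnorm_le_sum _) _; apply: ler_sum => i _; apply: ler_sum => j _.
  by rewrite mxE; have [_] := hC (i, j); exact.
Qed.

Lemma in_Lp_weight2_hess_grad q : 1 <= q < k ->
  in_Lp q%:E setT
    (fun x => weight (grad u) x ^+ 2 * (enorm (grad u x *m hessian u x))%:E)%E.
Proof.
move=> /andP[q1 qk]; have [K K0 hK] := hess_gradF.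
apply: (@in_Lp_weightX 2 (m%:R * K) 2^-1) => //.
- by rewrite mulr_ge0.
- by lra.
- by lra.
- apply: continuous_row_measurable => x.
  apply: (@continuous_comp _ _ _ (fun x => dotp (grad u x *m hessian u x)
    (grad u x *m hessian u x)) (@Num.sqrt R)); last exact: sqrt_continuous.
  apply: elem_continuous.
  by apply: elem_sum => j; apply: elem_mul; exact: elem_hess_grad.
- by move=> x xM; rewrite grad_box// mul0mx /enorm dotp0l sqrtr0.
- move=> x; rewrite powR12_sqrt// ger0_norm ?sqrtr_ge0//.
  apply: le_trans (enorm_le_sum _) _.
  rewrite -mulrA mulr_natl -[X in _ *+ X]card_ord -sumr_const.
  by apply: ler_sum => j _; exact: hK.
Qed.

Lemma in_Lp_weight3_third q : 1 <= q < k ->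
  in_Lp q%:E setT (fun x => weight (grad u) x ^+ 3 * (third x)%:E)%E.
Proof.
(* Integrability needs 2 (1/2 + e) q < k, that is 2eq < k - q; as q < k, this choice makes 2eq < (k
   - q)/2. *)
move=> /andP[q1 qk]; pose e := (k - q) / (4 * k).
have k0 : 0 < k by rewrite (lt_trans _ qk)// (lt_le_trans _ q1).
have ek : e * (4 * k) = k - q by rewrite divfK// gt_eqF// mulr_gt0.
have e0 : 0 < e by rewrite divr_gt0 ?mulr_gt0 ?subr_gt0.
have e4 : e * k <= e * k by [].
have e1 : e < 1 by rewrite ltr_pdivrMr ?mulr_gt0//; lra.
have eqk : e * q < e * k by rewrite ltr_pM2l.
have [|K K0 hK] := @thirdF e; first by rewrite e0.
apply: (@in_Lp_weightX 3 K (1 - e)) => //.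
- by lra.
- by lra.
- by apply: elem_measurable; exact: elem_third.
- exact: third_box.
Qed.

Lemma partial_sum i (I : Type) (s : seq I) (f : I -> 'rV[R]_m -> R) : (forall j, elem (f j)) ->
  partial i (fun x => \sum_(j <- s) f j x) = fun x => \sum_(j <- s) partial i (f j) x.
Proof.
move=> ef; elim: s => [|j s IHs].
  transitivity (partial i (fun _ : 'rV[R]_m => 0 : R)).
    by congr partial; apply/funext => x; rewrite big_nil.
  by rewrite partial_cst; apply/funext => x; rewrite big_nil.
transitivity (partial i (fun x => f j x + \sum_(j <- s) f j x)).
  by congr partial; apply/funext => x; rewrite big_cons.
rewrite partialD//; last exact: elem_sum.
by apply/funext => x; rewrite big_cons IHs.
Qed.

Lemma partial_lorentz i : partial i F =
  fun x => - 2 * \sum_j partial j u x * partial i (partial j u) x.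
Proof.
have ep j : elem (partial j u) by exact: elem_partial.
have ep2 j : elem (fun x => partial j u x * partial j u x) by exact: elem_mul.
transitivity (partial i (fun x => 1 + - \sum_j partial j u x * partial j u x)).
  congr partial; apply/funext => x; congr (_ - _).
  by apply: eq_bigr => j _; rewrite !mxE.
have es : elem (fun x => \sum_j partial j u x * partial j u x) by exact: elem_sum.
rewrite partialD; [|exact: elem_cst|exact: elem_opp].
rewrite partial_cst partialN// partial_sum//.
apply/funext => x; rewrite add0r mulNr mulr_sumr; congr (- _).
by apply: eq_bigr => j _; rewrite partialM// mulrDl !mul1r.
Qed.

Lemma sum_partial_lorentz x : \sum_i partial i F x * partial i u x = - 2 * third x.
Proof.
rewrite /third /dotp mulr_sumr.
under eq_bigr do rewrite partial_lorentz.
under [RHS]eq_bigr do rewrite !mxE mulr_suml mulr_sumr.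
rewrite [RHS]exchange_big/=; apply: eq_bigr => i _.
rewrite mulr_sumr mulr_suml; apply: eq_bigr => j _.
by rewrite !mxE; ring.
Qed.

Definition laplacian x : R := \sum_i partial i (partial i u) x.

(* The divergence of [Du / sqrt (F + c)]. *)
Definition flux_div c x : R :=
  (F x + c) `^ (- 2^-1) * laplacian x + (F x + c) `^ (- (3 / 2)) * third x.

Lemma elem_laplacian : elem laplacian.
Proof. by apply: elem_sum => i; apply: elem_partial; exact: elem_partial. Qed.

Lemma laplacian_box x : ~ row_box M x -> laplacian x = 0.
Proof. by move=> xM; rewrite /laplacian big1// => i _; rewrite partial2_box. Qed.

Lemma flux_div_box c x : ~ row_box M x -> flux_div c x = 0.
Proof. by move=> xM; rewrite /flux_div laplacian_box// third_box// !mulr0 addr0. Qed.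

Lemma measurable_powR_lorentz c s : measurable_fun setT (fun x => (F x + c) `^ s).
Proof.
apply: (measurableT_comp (measurable_powR s)); apply: measurable_funD => //.
by apply: elem_measurable; exact: elem_lorentz.
Qed.

Lemma measurable_flux_div c : measurable_fun setT (flux_div c).
Proof.
apply: measurable_funD; apply: measurable_funM; do ?exact: measurable_powR_lorentz.
  by apply: elem_measurable; exact: elem_laplacian.
by apply: elem_measurable; exact: elem_third.
Qed.

Let shift_powR c s x : 0 <= c -> 0 <= s -> 0 < F x -> (F x + c) `^ (- s) <= F x `^ (- s).
Proof.
move=> c0 s0 Fx; have Fc : 0 < F x + c by rewrite ltr_wpDr.
rewrite !powRN lef_pV2 ?posrE ?powR_gt0//.
by apply: ge0_ler_powR; rewrite ?nnegrE ?(ltW Fx) ?(ltW Fc)// lerDl.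
Qed.

(** Uniform in c, since adding c >= 0 to F only lowers its negative powers. The Laplacian term is of
    order F^(-1/2), the other of order F^(-3/2) F^(1-e), and F <= 1 lets the second exponent serve
    for both. *)
Lemma flux_div_le e : 0 < e < 1 -> exists2 C, 0 <= C &
  forall c x, 0 <= c -> 0 < F x -> `|flux_div c x| <= C * F x `^ (- (1 / 2 + e)).
Proof.
move=> e01; have [K K0 hK] := thirdF e01; have /andP[e0 e1] := e01.
have [] := @bounded_of_box _ _ laplacian M.
- by apply: elem_continuous; exact: elem_laplacian.
- exact: laplacian_box.
move=> L L0 hL; exists (L + K) => [|c x c0 Fx]; first exact: addr_ge0.
rewrite mulrDl; apply: le_trans (ler_normD _ _) _; apply: lerD; rewrite normrM ger0_norm ?powR_ge0//.
  rewrite mulrC ler_pM ?powR_ge0//.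
  apply: (@le_trans _ _ (F x `^ (- 2^-1))); first by apply: shift_powR.
  by rewrite ger_powR ?Fx ?lorentz_le1// lerN2; lra.
apply: (@le_trans _ _ (F x `^ (- (3 / 2)) * (K * F x `^ (1 - e)))).
  by rewrite ler_pM ?powR_ge0//; apply: shift_powR => //; lra.
rewrite mulrCA -powRD ?(gt_eqF Fx) ?implybT// ler_wpM2l//.
by rewrite (_ : - (3 / 2) + (1 - e) = - (1 / 2 + e)) //; lra.
Qed.

(** On the null set where F vanishes this is 0, by the convention for powers of 0. *)
Definition density x : R := - flux_div 0 x.

(** The singular exponent is 1/2 + e, as for the third-order weight, and e is chosen in the same
    way. *)
Lemma in_Lp_density q : 1 <= q < k -> in_Lp q%:E setT (EFin \o density).
Proof.
move=> /andP[q1 qk]; pose e := (k - q) / (4 * k).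
have k0 : 0 < k by rewrite (lt_trans _ qk)// (lt_le_trans _ q1).
have ek : e * (4 * k) = k - q by rewrite divfK// gt_eqF// mulr_gt0.
have e0 : 0 < e by rewrite divr_gt0 ?mulr_gt0 ?subr_gt0.
have e1 : e < 1 by rewrite ltr_pdivrMr ?mulr_gt0//; lra.
have eqk : e * q < e * k by rewrite ltr_pM2l.
have [|C C0 hC] := @flux_div_le e; first by rewrite e0.
have md : measurable_fun setT (EFin \o density).
  by apply/measurable_EFinP; apply: measurable_funN; exact: measurable_flux_div.
apply: in_Lp_of_integral => //; rewrite patch_setT.
apply: (@singular_integral_lty _ _ l F M M1 Fl lm C (1 / 2 + e)) => //.
- by lra.
- by lra.
- by move=> x xM /=; rewrite /density flux_div_box// oppr0.
- by move=> x Fx; rewrite lee_fin normrN; exact: hC.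
Qed.

Section test_function.
Variables (eta : 'rV[R]_m -> R) (H L : R).
Hypothesis ceta : continuous eta.
Hypothesis etaH : forall x, row_box M x -> `|eta x| <= H.
Hypothesis L0 : 0 <= L.
Hypothesis etaL : forall i x (h : R), `|eta (h *: basis_row i + x) - eta x| <= L * `|h|.

Definition flux c x : R := (F x + c) `^ (- 2^-1) * dotp (grad u x) (grad eta x).

Let continuous_powR_lorentz c s : 0 < c -> continuous (fun x => (F x + c) `^ s).
Proof.
move=> c0 x.
apply: (@continuous_comp _ _ _ (fun x : 'rV[R]_m => F x + c : R) (fun y : R => y `^ s : R)).
  by apply: elem_continuous; apply: elem_add; [exact: elem_lorentz|exact: elem_cst].
have Fc : 0 < F x + c by rewrite ltr_wpDl.
apply: differentiable_continuous; apply/derivable1_diffP.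
by have [] := is_derive1_powR s Fc.
Qed.

Let partial_eta_le i x : `|partial i eta x| <= L.
Proof. by apply: derive_lipschitz_bound => // h; exact: etaL. Qed.

(** Since c > 0, each component V_i = (F + c)^(-1/2) D_i u is continuous with continuous derivative
    W_i in direction i; one integration by parts for each i, and the W_i sum to [flux_div c]. *)
Lemma regularized_equation c : 0 < c ->
  (\int[mu]_x (flux c x + flux_div c x * eta x)%:E = 0)%E.
Proof.
move=> c0.
pose V i x := (F x + c) `^ (- 2^-1) * partial i u x.
pose W i x := (F x + c) `^ (- 2^-1) * partial i (partial i u) x +
  partial i u x * (- 2^-1 * (F x + c) `^ (- 2^-1 - 1) * partial i F x).
have M0 : 0 <= M by rewrite (le_trans _ M1).
have eF := elem_lorentz.
have cp i : continuous (partial i u) by apply: elem_continuous; exact: elem_partial.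
have cpp i : continuous (partial i (partial i u)).
  by apply: elem_continuous; apply: elem_partial; exact: elem_partial.
have cpF i : continuous (partial i F) by apply: elem_continuous; exact: elem_partial.
have cpow t : continuous (fun x => (F x + c) `^ t) by exact: continuous_powR_lorentz.
have cV i : continuous (V i).
  by move=> x; exact: (cvgM (cpow (- 2^-1) x) (cp i x)).
have cW i : continuous (W i).
  move=> x; apply: (cvgD (cvgM (cpow (- 2^-1) x) (cpp i x))).
  apply: (cvgM (cp i x)).
  apply: (cvgM _ (cpF i x)); apply: (cvgM _ (cpow _ x)); exact: cvg_cst.
have VM i x : ~ row_box M x -> V i x = 0 by move=> xM; rewrite /V partial_box// mulr0.
have WM i x : ~ row_box M x -> W i x = 0.
  by move=> xM; rewrite /W partial2_box// partial_box// mulr0 mul0r addr0.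
have dV i x : is_derive x (basis_row i) (V i) (W i x).
  have Fc : 0 < F x + c by rewrite ltr_wpDl.
  have eFc : elem (fun x => F x + c) by apply: elem_add => //; exact: elem_cst.
  have d1 := is_derive_comp_line (is_derive1_powR (- 2^-1) Fc) (elem_is_derive x i eFc).
  have d2 : is_derive x (basis_row i) (partial i u) (partial i (partial i u) x).
    by apply: elem_is_derive; exact: elem_partial.
  apply: is_derive_eq (is_deriveM d1 d2) _; congr (_ + _ *: (_ * _)).
  by rewrite partialD//; [rewrite partial_cst addr0|exact: elem_cst].
have VWI i : mu.-integrable setT (EFin \o (fun x => V i x * partial i eta x + W i x * eta x)).
  have [C1 C10 hC1] := bounded_of_box (cV i) (VM i).
  have [C2 C20 hC2] := bounded_of_box (cW i) (WM i).
  apply: (@integrable_row_box _ _ _ (C1 * L + C2 * H) M).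
  - apply: measurable_funD; apply: measurable_funM.
    + exact: continuous_row_measurable.
    + exact: measurable_derive.
    + exact: continuous_row_measurable.
    + exact: continuous_row_measurable.
  - move=> x; have [xM|xM] := pselect (row_box M x).
      apply: le_trans (ler_normD _ _) _; rewrite (normrM (V i x)) (normrM (W i x)).
      by apply: lerD; apply: ler_pM => //; exact: etaH.
    rewrite VM// WM// !mul0r addr0 normr0 addr_ge0 ?mulr_ge0//.
    by apply: le_trans (etaH (x := 0) _) => // i0; rewrite /= mxE in_itv/= oppr_le0 M0.
  - by move=> x xM; rewrite VM// WM// !mul0r addr0.
transitivity (\int[mu]_x \sum_i (V i x * partial i eta x + W i x * eta x)%:E)%E.
  apply: eq_integral => x _; rewrite sumEFin; congr EFin.
  rewrite big_split/=; congr (_ + _).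
    by rewrite /flux /dotp mulr_sumr; apply: eq_bigr => i _; rewrite !mxE mulrA.
  rewrite -mulr_suml; congr (_ * _); rewrite big_split/= -mulr_sumr; congr (_ + _).
  (* The derivative of (F + c)^(-1/2) contributes DF.Du = -2 D^2u(Du, Du), and the factor -2 cancels
     -1/2. *)
  transitivity (- 2^-1 * (F x + c) `^ (- 2^-1 - 1) * \sum_i partial i F x * partial i u x).
    rewrite sum_partial_lorentz (_ : - 2^-1 - 1 = - (3 / 2)); last by lra.
    by move: (_ `^ _) (third x) => *; field.
  by rewrite mulr_sumr; apply: eq_bigr => i _; rewrite mulrA mulrC.
rewrite integral_sum// big1// => i _.
have [C1 C10 hC1] := bounded_of_box (cV i) (VM i).
have [C2 C20 hC2] := bounded_of_box (cW i) (WM i).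
apply: (@ibp_row _ _ i (V i) (W i) eta (C1 + C2) H L M) => //.
- exact: addr_ge0.
- exact: continuous_row_measurable.
- by move=> x; rewrite (le_trans (hC1 x))// lerDl.
- by move=> x; rewrite (le_trans (hC2 x))// lerDr.
- by move=> x xM; rewrite VM// WM.
Qed.

Hypothesis lm1 : (l.+1 < m)%N.

(** An integrable function is finite almost everywhere, while [row_npow] is infinite wherever F
    vanishes, since coordinate l is then 0. Any exponent in [0, 1) would do in place of 1/2. *)
Lemma lorentz_gt0_ae : {ae mu, forall x, 0 < F x}.
Proof.
have iN : mu.-integrable setT (row_npow l M (1 / 2)).
  apply/integrableP; split; first exact: measurable_row_npow.
  under eq_integral do rewrite gee0_abs ?row_npow_ge0//.
  by apply: row_npow_lty => //; lra.
have := integrable_ae measurableT iN; apply: filterS => x /(_ I) xN.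
have [xM|xM] := pselect (row_box M x); last by rewrite lorentz_box.
rewrite lt_neqAle F0 andbT; apply/eqP => Fx.
have := @Fl x (Ordinal lm) (leqnn _); rewrite -Fx => h.
have xl : x ord0 (Ordinal lm) = 0.
  apply/eqP; rewrite -sqrf_eq0 eq_le sqr_ge0 andbT.
  by move: h; rewrite minEle; case: ifP => _; lra.
by move: xN; rewrite (row_npow_eqy l (1 / 2) xM xl).
Qed.

Let partial_le1 i x : `|partial i u x| <= 1.
Proof.
rewrite -(@ler_pXn2r _ 2)// ?nnegrE// expr1n real_normK ?num_real//.
have : dotp (grad u x) (grad u x) <= 1 by have := F0 x; rewrite subr_ge0.
apply: le_trans; rewrite /dotp (bigD1 i)//= !mxE -expr2 lerDl.
by apply: sumr_ge0 => j _; rewrite -expr2 sqr_ge0.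
Qed.

Let H0 : 0 <= H.
Proof.
apply: le_trans (normr_ge0 (eta 0)) _; apply: etaH => i.
by rewrite /= mxE in_itv/= oppr_le0 (le_trans _ M1).
Qed.

(** The exponent 3/4 is 1/2 + e for e = 1/4; it is integrable because 2 (3/4) < 2 <= m - l. *)
Let dominating B x : \bar R := ((fun x => (B * F x `^ (- (3 / 4)))%:E) \_ (row_box M)) x.

Let dominatingE B x : 0 <= B -> `|dominating B x|%E = dominating B x.
Proof.
move=> B0; rewrite /dominating patchE; case: ifP => _; rewrite ?abse0//.
by rewrite abse_EFin ger0_norm// mulr_ge0 ?powR_ge0.
Qed.

Let integrable_dominating B : 0 <= B -> mu.-integrable setT (dominating B).
Proof.
move=> B0; have mB : measurable_fun setT (dominating B).
  apply/(measurable_restrictT _ (measurable_row_sym_box M)); apply: measurable_funTS.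
  apply/measurable_EFinP; apply: measurable_funM => //.
  rewrite (_ : (fun x => _) = fun x => (F x + 0) `^ (- (3 / 4))); last first.
    by apply/funext => x; rewrite addr0.
  exact: measurable_powR_lorentz.
have kge2 : 2 <= k by rewrite ler_nat leq_subRL ?(ltnW lm)// addn2.
apply/integrableP; split => //.
rewrite (eq_integral (fun x => `|dominating B x| `^ 1)%E) => [|x _]; last by rewrite poweRe1.
apply: (@singular_integral_lty _ _ l F M M1 Fl lm B (3 / 4)) => //.
- by apply: lt_le_trans kge2; lra.
- by move=> x xM; rewrite /dominating patchE memNset.
- move=> x Fx; rewrite dominatingE// /dominating patchE; case: ifP => // _.
  by rewrite lee_fin mulr_ge0// powR_ge0.
Qed.

Let flux_le c x : 0 <= c -> 0 < F x -> row_box M x ->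
  `|flux c x| <= m%:R * L * F x `^ (- (3 / 4)).
Proof.
move=> c0 Fx xM; rewrite /flux mulrC normrM (ger0_norm (powR_ge0 _ _)) ler_pM ?powR_ge0//.
  apply: le_trans (ler_norm_sum _ _ _) _.
  rewrite mulr_natl -[X in _ *+ X]card_ord -sumr_const; apply: ler_sum => i _.
  rewrite !mxE normrM -[L]mul1r ler_pM//; exact: partial_eta_le.
apply: (@le_trans _ _ (F x `^ (- 2^-1))); first by apply: shift_powR.
by rewrite ger_powR ?Fx ?lorentz_le1// lerN2; lra.
Qed.

Let flux_box c x : ~ row_box M x -> flux c x = 0.
Proof. by move=> xM; rewrite /flux grad_box// dotp0l mulr0. Qed.

Lemma measurable_flux c : measurable_fun setT (flux c).
Proof.
apply: measurable_funM; first exact: measurable_powR_lorentz.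
apply: measurable_sum => i.
rewrite (_ : (fun x => _) = fun x => partial i u x * partial i eta x).
  apply: measurable_funM; last exact: measurable_derive.
  by apply: elem_measurable; exact: elem_partial.
by apply/funext => x; rewrite !mxE.
Qed.

(** The alternative reflects the conventions for powers: where F = 0 the dominating function is 0,
    which is matched by the terms with c = 0 but not in general by those with c > 0. *)
Let dominated : exists2 B, 0 <= B & forall c x, 0 <= c -> (0 < F x \/ c = 0) ->
  (`|(flux c x)%:E| <= dominating B x)%E /\
  (`|(flux_div c x * eta x)%:E| <= dominating B x)%E.
Proof.
have [|C C0 hC] := @flux_div_le (1 / 4); first by lra.
have B0 : 0 <= m%:R * L + C * H by rewrite addr_ge0 ?mulr_ge0.
exists (m%:R * L + C * H) => // c x c0 Fc; rewrite /dominating patchE.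
have [xM|xM] := pselect (row_box M x); last first.
  by rewrite memNset// flux_box// flux_div_box// mul0r abse0.
rewrite mem_set// !abse_EFin !lee_fin mulrDl.
have [Fx|Fx] := ltP 0 (F x).
  have p0 := powR_ge0 (F x) (- (3 / 4)); split.
    by apply: le_trans (flux_le c0 Fx xM) _; rewrite lerDl !mulr_ge0.
  apply: (@le_trans _ _ (C * F x `^ (- (3 / 4)) * H)).
    rewrite normrM ler_pM//; last exact: etaH.
    by have := hC c x c0 Fx; rewrite (_ : 1 / 2 + 1 / 4 = 3 / 4)//; lra.
  by rewrite mulrAC lerDr !mulr_ge0.
have {}Fx : F x = 0 by apply/eqP; rewrite eq_le Fx F0.
case: Fc => [|->]; first by rewrite Fx ltxx.
have z s : s != 0 -> (F x + 0) `^ s = 0 by move=> s0; rewrite Fx addr0 powR0.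
rewrite /flux /flux_div !z ?mul0r ?addr0 ?mul0r ?normr0; try lra.
by rewrite -mulrDl mulr_ge0 ?powR_ge0.
Qed.

Let cvg_shift x s : 0 < F x -> (F x + n.+1%:R^-1) `^ s @[n --> \oo] --> (F x + 0) `^ s.
Proof.
move=> Fx; have Fx0 : 0 < F x + 0 by rewrite addr0.
have ct : {for (F x + 0), continuous (fun y : R => y `^ s : R)}.
  apply: differentiable_continuous; apply/derivable1_diffP.
  by have [] := is_derive1_powR s Fx0.
apply: (continuous_cvg _ ct); apply: cvgD; first exact: cvg_cst.
exact: cvg_harmonic.
Qed.

(** Dominated convergence along c = 1/(n+1) is applied to the sum, whose integral is 0 for each n.
    Both limit terms are integrable, so the sum may be split afterwards. *)
Lemma limit_equation :
  (\int[mu]_x (flux 0 x)%:E = \int[mu]_x (density x * eta x)%:E)%E.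
Proof.
have [B B0 hB] := dominated.
have mfd c : measurable_fun setT (fun x => flux_div c x * eta x).
  by apply: measurable_funM; [exact: measurable_flux_div|exact: continuous_row_measurable].
have mG c : measurable_fun setT (EFin \o (fun x => flux c x + flux_div c x * eta x)).
  by apply/measurable_EFinP; apply: measurable_funD => //; exact: measurable_flux.
have [] := @dominated_convergence _ _ _ mu setT measurableT
  (fun n => EFin \o (fun x => flux n.+1%:R^-1 x + flux_div n.+1%:R^-1 x * eta x))
  (EFin \o (fun x => flux 0 x + flux_div 0 x * eta x)) (dominating (B + B))
  (fun n => mG _) (mG 0).
- apply: filterS lorentz_gt0_ae => x Fx _; apply/cvg_EFin; first exact: nearW.
  apply: cvgD; first by apply: cvgMl; exact: cvg_shift.
  by apply: cvgMl; apply: cvgD; apply: cvgMl; exact: cvg_shift.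
- exact: integrable_dominating (addr_ge0 B0 B0).
- apply: filterS lorentz_gt0_ae => x Fx n _.
  have [|d1 d2] := hB n.+1%:R^-1 x _ (or_introl Fx); first by rewrite invr_ge0.
  apply: (@le_trans _ _ (dominating B x + dominating B x)%E).
    exact: (le_trans (lee_abs_add (flux _ x)%:E (flux_div _ x * eta x)%:E) (leeD d1 d2)).
  rewrite /dominating !patchE; case: ifP => _; rewrite ?adde0//.
  by rewrite [leRHS]EFinM EFinD ge0_muleDl ?lee_fin// -!EFinM.
move=> _ _ c0.
have {}c0 : (fun _ : nat => 0%E : \bar R) @ \oo -->
    (\int[mu]_x (flux 0 x + flux_div 0 x * eta x)%:E)%E.
  apply: cvg_trans c0; apply: near_eq_cvg; apply: nearW => n.
  by rewrite -(@regularized_equation n.+1%:R^-1) ?invr_gt0.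
have I0 : (\int[mu]_x (flux 0 x + flux_div 0 x * eta x)%:E = 0)%E.
  by apply: (cvg_unique _ c0); [exact: ereal_hausdorff|exact: cvg_cst].
have if1 : mu.-integrable setT (EFin \o flux 0).
  apply: (le_integrable measurableT _ _ (integrable_dominating B0)).
    by apply/measurable_EFinP; exact: measurable_flux.
  move=> x _; rewrite dominatingE//; by have [] := hB 0 x (lexx _) (or_intror erefl).
have if2 : mu.-integrable setT (EFin \o (fun x => density x * eta x)).
  apply: (le_integrable measurableT _ _ (integrable_dominating B0)).
    apply/measurable_EFinP; rewrite (_ : (fun x => _) = fun x => - (flux_div 0 x * eta x)).
      exact: measurable_funN.
    by apply/funext => x; rewrite mulNr.
  move=> x _; rewrite dominatingE// /= mulNr normrN.
  by have [] := hB 0 x (lexx _) (or_intror erefl).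
have := integralB_EFin measurableT if1 if2.
rewrite (eq_integral (fun x => (flux 0 x + flux_div 0 x * eta x)%:E)) => [|x _]; last first.
  by rewrite -EFinB mulNr opprK.
rewrite I0 => /esym.
rewrite -(fineK (integrable_fin_num measurableT if1)).
rewrite -(fineK (integrable_fin_num measurableT if2)).
by move=> [] /subr0_eq ->.
Qed.

(** [weight] and the power used in [flux 0] differ only where F = 0, a null set. *)
Lemma weight_equation :
  (\int[mu]_x (weight (grad u) x * (dotp (grad u x) (grad eta x))%:E) =
   \int[mu]_x (density x * eta x)%:E)%E.
Proof.
rewrite -limit_equation; apply: ae_eq_integral => //.
- apply: emeasurable_funM; first exact: measurable_weight.
  apply/measurable_EFinP; apply: measurable_sum => i.
  rewrite (_ : (fun x => _) = fun x => partial i u x * partial i eta x).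
    apply: measurable_funM; last exact: measurable_derive.
    by apply: elem_measurable; exact: elem_partial.
  by apply/funext => x; rewrite !mxE.
- by apply/measurable_EFinP; exact: measurable_flux.
apply: filterS lorentz_gt0_ae => x Fx _.
by rewrite weight_lorentz// /flux addr0 EFinM.
Qed.

End test_function.

Hypothesis lm1 : (l.+1 < m)%N.

Lemma grad_off_supp x : ~ supp u x -> grad u x = 0.
Proof. by move=> xs; apply/rowP => i; rewrite !mxE partial_off_supp. Qed.

Lemma weak_equation_density Omega : supp u `<=` Omega ->
  weak_equation Omega (grad u) density.
Proof.
move=> sO eta [/lipschitz_bound[L L0 hL] [ceta etaO]].
have ce := continuous_of_lipschitz L0 hL.
have [H H0 etaH] := row_box_bounded M ce.
pose B := \sum_i `|basis_row i : 'rV[R]_m|.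
have B0 : 0 <= B by exact: sumr_ge0.
have etaL i x (h : R) : `|eta (h *: basis_row i + x) - eta x| <= L * B * `|h|.
  apply: le_trans (hL _ _) _; rewrite addrK normrZ -mulrA ler_wpM2l// mulrC.
  by rewrite ler_wpM2r// /B (bigD1 i)//= lerDl sumr_ge0.
rewrite (@integral_restrict_eq0 _ _ Omega) => [|x xO]; last first.
  by rewrite grad_off_supp ?dotp0l ?mule0// => /sO.
rewrite (@integral_restrict_eq0 _ _ Omega) => [|x xO]; last first.
  by rewrite (@off_supp _ _ eta) ?mulr0// => /etaO.
exact: (@weight_equation eta H (L * B) ce etaH (mulr_ge0 L0 B0) etaL lm1).
Qed.

Lemma enorm_grad_le1 x : enorm (grad u x) <= 1.
Proof.
by rewrite /enorm -[1](@sqrtr1 R) ler_wsqrtr//; have := F0 x; rewrite subr_ge0.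
Qed.

(** The classical gradient is the weak one by the same integration by parts, with u in the role of
    [V] and the smooth test function in that of [eta]. *)
Lemma W1infty_light Omega : W1infty Omega u (grad u).
Proof.
have M0 : 0 <= M by rewrite (le_trans _ M1).
have cu : continuous u by exact: elem_continuous.
have cp i : continuous (partial i u) by apply: elem_continuous; exact: elem_partial.
have [C C0 hC] := bounded_of_box cu uM.
have bp i := bounded_of_box (cp i) (partial_box i).
split.
- by apply: in_Lp_pinfty hC; exact: elem_measurable.
- move=> i; have [D D0 hD] := bp i.
  rewrite (_ : (fun x => _) = EFin \o partial i u); last first.
    by apply/funext => x; rewrite mxE.
  by apply: in_Lp_pinfty hD; exact: continuous_row_measurable.
move=> phi sphi [cphi phiO] i; have [D D0 hD] := bp i.
have [N N1 sN] := bounded_row_box (compact_bounded cphi).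
have [L L0 etaL] := smooth_line_lipschitz sphi sN.
have cph : continuous phi by have [] := sphi [::].
have [H H0 phiH] : exists2 H, 0 <= H & forall x, `|phi x| <= H.
  by apply: (@bounded_of_box _ _ phi N) => // x xN; apply: off_supp => /sN.
have dphi x : `|partial i phi x| <= L by apply: derive_lipschitz_bound => // h; exact: etaL.
rewrite [in RHS](eq_integral (fun x => (partial i u x * phi x)%:E)) => [|x _]; last by rewrite mxE.
rewrite (@integral_restrict_eq0 _ _ Omega) => [|x xO]; last first.
  by rewrite partial_off_supp ?mulr0// => /phiO.
rewrite (@integral_restrict_eq0 _ _ Omega) => [|x xO]; last first.
  by rewrite (@off_supp _ _ phi) ?mulr0// => /phiO.
have i1 : mu.-integrable setT (EFin \o (fun x => u x * partial i phi x)).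
  apply: (@integrable_row_box _ _ _ (C * L) M).
  - by apply: measurable_funM; [exact: continuous_row_measurable|exact: measurable_derive].
  - by move=> x; rewrite normrM ler_pM.
  - by move=> x xM; rewrite uM// mul0r.
have i2 : mu.-integrable setT (EFin \o (fun x => partial i u x * phi x)).
  apply: (@integrable_row_box _ _ _ (D * H) M).
  - by apply: measurable_funM; exact: continuous_row_measurable.
  - by move=> x; rewrite normrM ler_pM.
  - by move=> x xM; rewrite partial_box// mul0r.
have I0 : (\int[mu]_x ((u x * partial i phi x)%:E + (partial i u x * phi x)%:E) = 0)%E.
  transitivity (\int[mu]_x (u x * partial i phi x + partial i u x * phi x)%:E)%E.
    by apply: eq_integral => x _; rewrite EFinD.
  apply: (@ibp_row _ _ i u (partial i u) phi (C + D) H L M) => //.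
  - exact: addr_ge0.
  - by move=> x; exact: elem_is_derive.
  - exact: continuous_row_measurable.
  - by move=> x; rewrite (le_trans (hC x))// lerDl.
  - by move=> x; rewrite (le_trans (hD x))// lerDr.
  - by move=> x xM; rewrite uM// partial_box.
have := etrans (esym I0) (integralD_EFin measurableT i1 i2).
rewrite -(fineK (integrable_fin_num measurableT i1)).
rewrite -(fineK (integrable_fin_num measurableT i2)).
by move=> /= [] /esym/eqP; rewrite addr_eq0 => /eqP ->.
Qed.

Lemma weak_solution_density Omega : bounded_domain Omega -> supp u `<=` Omega ->
  weak_solution Omega density u.
Proof.
move=> _ sO.
have k1 : 1 <= (1 : R) < k by rewrite lexx/= ltr1n ltn_subRL addn1.
have cu : continuous u by exact: elem_continuous.
split.
  move=> C cC _; have mC : measurable C.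
    by apply: closed_row_measurable; exact: compact_closed (@norm_hausdorff _ _) cC.
  have [md] := in_Lp_density k1; rewrite patch_setT Lnorm1 => dfin.
  split; first exact: measurable_funTS.
  rewrite Lnorm1; apply: le_lt_trans dfin; apply: ge0_le_integral => //.
  - apply: measurableT_comp => //; apply/(measurable_restrictT _ mC).
    exact: measurable_funTS.
  - exact: measurableT_comp.
  - by move=> x _; rewrite patchE; case: ifP => // _; rewrite abse0.
exists (grad u); split.
- exact: W1infty_light.
- by apply: nearW => x _; exact: enorm_grad_le1.
- exists u; split.
  + by move=> x _; exact: cu.
  + exact: nearW.
  + move=> y [_ yO]; have <- : u y = 0 by apply: off_supp => /sO.
    by apply: cvg_trans (cu y); apply: cvg_app; exact: cvg_within.
- by move=> C cC _; exact: in_Lp_loc_weight.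
- exact: weak_equation_density.
Qed.

End singular_solution.

(** * Light segments *)

Section light_segments.
Context {R : realType} {m : nat}.
Variable u : 'rV[R]_m -> R.
Hypothesis eu : elem u.
Hypothesis F0 : forall x, 0 <= lorentz u x.

(** The expression is |v - c g|^2. With c = |v| this is Cauchy-Schwarz in the form needed: |g| <= 1
    gives g.v <= |v|, and g.v = |v| > 0 gives |g| >= 1. *)
Lemma dotp_sqr_line (g v : 'rV[R]_m) (c : R) :
  0 <= dotp v v - 2 * c * dotp g v + c ^+ 2 * dotp g g.
Proof.
have -> : dotp v v - 2 * c * dotp g v + c ^+ 2 * dotp g g =
    \sum_i (v ord0 i - c * g ord0 i) ^+ 2.
  rewrite /dotp !mulr_sumr -sumrB -big_split/=; apply: eq_bigr => i _; ring.
by apply: sumr_ge0 => i _; exact: sqr_ge0.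
Qed.

Lemma is_derive_constant_itv (h : R -> R) (s e : R) : is_derive s (1 : R) h e ->
  0 <= s <= 1 -> (forall t, 0 <= t <= 1 -> h t = 0) -> e = 0.
Proof.
move=> dh /andP[s0 s1] h0; apply/eqP/negPn/negP => en0.
have [dq e_def] := dh.
have /cvgrPdist_lt /(_ `|e|) : (fun k : R => k^-1 *: ((h \o shift s) (k *: 1) - h s)) @ 0^' --> e.
  by rewrite -e_def; exact: dq.
rewrite normr_gt0 => /(_ en0); rewrite near_withinE => /nbhs_normP[r /= r0 hr].
pose b := Num.min (r / 2) (1 / 2).
have b0 : 0 < b by rewrite lt_min !divr_gt0.
have br : b <= r / 2 by rewrite ge_min lexx.
have b2 : b <= 1 / 2 by rewrite ge_min lexx orbT.
(* The increment points towards the farther end of [0, 1], so s + k stays inside even when s is an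
   endpoint. *)
pose k := if s <= 1 / 2 then b else - b.
have k0 : k != 0 by rewrite /k; case: ifP => _; rewrite ?oppr_eq0 gt_eqF.
have ks : 0 <= k + s <= 1.
  by apply/andP; rewrite /k; case: (leP s (1 / 2)) => s2; split; lra.
have hk : h (k *: 1 + s) = 0 by rewrite [k *: 1]mulr1 h0.
have hs : h s = 0 by rewrite h0// s0.
have kr : `|k| < r by rewrite /k; case: ifP => _; rewrite ?normrN gtr0_norm//; lra.
by have := hr k; rewrite /= sub0r normrN hk hs subrr scaler0 subr0 ltxx => /(_ kr k0).
Qed.

(** After exchanging the ends so that u increases, the deficit h(t) = N t - (u(x + tv) - u(x)) is
    nondecreasing and vanishes at 0 and 1, hence on [0, 1]. Its derivative there is 0, so Du.v = |v|
    and |Du| >= 1. *)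
Lemma light_segment_lorentz x y z : light_segment u x y -> segment x y z -> lorentz u z = 0.
Proof.
move=> [xy uxy] [s s01 <-].
wlog u_ge0 : x y s xy uxy s01 / 0 <= u y - u x.
  move=> WL; have [|yx] := leP 0 (u y - u x); first exact: WL.
  have -> : (1 - s) *: x + s *: y = (1 - (1 - s)) *: y + (1 - s) *: x.
    by rewrite subKr addrC.
  apply: WL; first by rewrite eq_sym.
  - by rewrite distrC uxy /enorm -(opprB x y) /dotp; congr Num.sqrt; apply: eq_bigr => i _;
      rewrite !mxE mulrNN.
  - by move: s01; rewrite /= !in_itv/=; lra.
  - by rewrite -opprB oppr_ge0 ltW.
pose v := y - x; set N := enorm (x - y) in uxy.
have vv : dotp v v = N ^+ 2.
  rewrite /N /enorm sqr_sqrtr; last by apply: sumr_ge0 => i _; rewrite -expr2 sqr_ge0.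
  by rewrite /dotp; apply: eq_bigr => i _; rewrite !mxE -mulrNN !opprB.
have N0 : 0 < N.
  rewrite lt_def sqrtr_ge0 andbT; apply/eqP => N0.
  move: vv; rewrite N0 expr0n/= /dotp => /eqP; rewrite psumr_eq0 => [/allP v0|i _]; last first.
    by rewrite -expr2 sqr_ge0.
  move/eqP: xy; apply; apply/rowP => i; have := v0 i (mem_index_enum i).
  by rewrite /= mulf_eq0 orbb !mxE subr_eq0 => /eqP.
pose L (f : 'rV[R]_m -> R) (t : R) := f (t *: v + x).
have dL (t : R) : is_derive t (1 : R) (L u) (dotp (grad u (t *: v + x)) v).
  apply: is_derive_line; rewrite -elem_derive//.
  by apply: DeriveDef => //; apply: diff_derivable; exact: elem_differentiable.
pose h (t : R) := N * t - (L u t - u x).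
have dh (t : R) : is_derive t (1 : R) h (N - dotp (grad u (t *: v + x)) v).
  have dN : is_derive t (1 : R) (fun r : R => N * r) N.
    apply: is_derive_eq (is_deriveZ N (is_derive_id t (1 : R))) _; exact: mulr1.
  have := is_deriveB dN (is_deriveB (dL t) (is_derive_cst (u x) t (1 : R))).
  by rewrite subr0.
have dg t : dotp (grad u t) (grad u t) <= 1 by have := F0 t; rewrite subr_ge0.
have h'0 (t : R) : 0 <= N - dotp (grad u (t *: v + x)) v.
  have := dotp_sqr_line (grad u (t *: v + x)) v N; rewrite vv => H.
  have H1 : N ^+ 2 * dotp (grad u (t *: v + x)) (grad u (t *: v + x)) <= N ^+ 2.
    by rewrite ler_piMr ?sqr_ge0.
  rewrite -(pmulr_rge0 _ N0) mulrBr -expr2; nra.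
have h_nd t1 t2 : t1 <= t2 -> h t1 <= h t2.
  move=> t12; have [] := @MVT_segment R h _ t1 t2 t12 (fun t _ => dh t).
    apply: continuous_subspaceT => t; apply: differentiable_continuous.
    by apply/derivable1_diffP; have [] := dh t.
  by move=> c _ hc; rewrite -subr_ge0 hc mulr_ge0// subr_ge0.
have h0 : h 0 = 0 by rewrite /h /L scale0r (add0r x) subrr mulr0 subr0.
have h1 : h 1 = 0.
  have uyx : u y - u x = N by rewrite -uxy distrC ger0_norm.
  by rewrite /h /L mulr1 scale1r /v subrK uyx subrr.
have hz t : 0 <= t <= 1 -> h t = 0.
  by move=> /andP[t0 t1]; apply/eqP; rewrite eq_le -{1}h1 -h0 !h_nd.
have -> : (1 - s) *: x + s *: y = s *: v + x.
  by rewrite /v scalerBl scalerBr scale1r [LHS]addrC addrA [RHS]addrAC.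
have /(is_derive_constant_itv (dh s)) : 0 <= s <= 1 by move: s01; rewrite /= in_itv.
move=> /(_ hz)/eqP; rewrite subr_eq0 => /eqP Ns.
apply/eqP; rewrite eq_le F0 andbT /lorentz subr_le0.
have := dotp_sqr_line (grad u (s *: v + x)) v N; rewrite vv -Ns => H.
have N2 : 0 < N ^+ 2 by rewrite exprn_gt0.
rewrite -(ler_pM2l N2) mulr1; rewrite -mulrA -expr2 in H; lra.
Qed.

(** The zero set of F is closed, which takes care of the closure in [light_set]. *)
Lemma light_set_subset : light_set u `<=` [set x | lorentz u x = 0].
Proof.
have cF : closed [set x | lorentz u x = 0].
  apply: (@preimage_closed _ _ (lorentz u) [set 0]) => [x _|].
    by apply: elem_continuous; exact: elem_lorentz.
  exact: closed_eq.
rewrite /light_set closureE => x; apply; split=> // z [[p q] /= pq zpq].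
exact: light_segment_lorentz pq zpq.
Qed.

End light_segments.

(** * The profiles *)

Section profile.
Context {R : realType}.
Implicit Types (p : {poly R}) (s t x : R).

Local Notation E := (@flat R 1).
Local Notation E1 := (@flat R (dflat 1)).
Local Notation E2 := (@flat R (dflat (dflat 1))).

Lemma E_gt0 t : 0 < t -> E t = expR (- t^-1).
Proof. by move=> t0; rewrite flat_gt0// hornerC mul1r. Qed.

Lemma dflat1 : dflat (1 : {poly R}) = 'X^2.
Proof. by rewrite /dflat derivC subr0 mulr1. Qed.

Lemma E1_gt0 t : 0 < t -> E1 t = (t^-1) ^+ 2 * expR (- t^-1).
Proof. by move=> t0; rewrite flat_gt0// dflat1 hornerXn. Qed.

Lemma E_ge0 t : 0 <= E t.
Proof. by have [/flat_le0 ->//|/E_gt0 ->] := leP t 0; exact: expR_ge0. Qed.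

Lemma E1_ge0 t : 0 <= E1 t.
Proof.
have [/flat_le0 ->//|t0] := leP t 0; rewrite E1_gt0//.
by rewrite mulr_ge0 ?sqr_ge0 ?expR_ge0.
Qed.

Lemma E_ge t : 5 <= t -> 4 / 5 <= E t.
Proof.
move=> t5; have t0 : 0 < t by lra.
rewrite E_gt0//; have := expR_ge1Dx (- t^-1); apply: le_trans.
have : t^-1 <= 5^-1 by rewrite lef_pV2// posrE.
lra.
Qed.

Let u : R := expR (- 1).

Let u0 : 0 < u. Proof. exact: expR_gt0. Qed.

(** From e >= (1 + 1/4)^4 = 625/256, whose inverse is 0.4096. *)
Lemma expRN1_small : u <= 41 / 100.
Proof.
have h : 1 + 4^-1 <= expR 4^-1 :> R by exact: expR_ge1Dx.
have e4 : expR 1 = expR 4^-1 ^+ 4 :> R.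
  by rewrite -expRM_natl; congr expR; lra.
have : (1 + 4^-1 : R) ^+ 4 <= expR 4^-1 ^+ 4.
  by rewrite lerXn2r// nnegrE ?expR_ge0//; lra.
rewrite -e4 => h4; rewrite /u expRN -[leLHS]mul1r ler_pdivrMr ?expR_gt0//; lra.
Qed.

Lemma xexpN x : x * expR (- x) <= u.
Proof.
have := expR_ge1Dx (x - 1); rewrite addrC subrK expRD mulrC => h.
by rewrite expRN ler_pdivrMr ?expR_gt0.
Qed.

(** The maximum, at x = 2, obtained by squaring the bound of [xexpN] at x/2. *)
Lemma x2expN x : 0 <= x -> x ^+ 2 * expR (- x) <= 4 * u ^+ 2.
Proof.
move=> x0; have h := xexpN (x / 2).
have h0 : 0 <= x / 2 * expR (- (x / 2)) by rewrite mulr_ge0 ?expR_ge0// divr_ge0.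
have -> : expR (- x) = expR (- (x / 2)) ^+ 2.
  by rewrite -expRM_natl; congr expR; field.
have : (x / 2 * expR (- (x / 2))) ^+ 2 <= u ^+ 2 by rewrite lerXn2r// nnegrE ltW.
rewrite exprMn => h2; have -> : x ^+ 2 = 4 * (x / 2) ^+ 2 by field.
by rewrite -mulrA ler_wpM2l.
Qed.

Lemma E1_le t : E1 t <= 4 * u ^+ 2.
Proof.
have [/flat_le0 ->|t0] := leP t 0; first by rewrite mulr_ge0// sqr_ge0.
by rewrite E1_gt0// x2expN// invr_ge0 ltW.
Qed.

Lemma tE1_le t : t * E1 t <= u.
Proof.
have [/flat_le0 ->|t0] := leP t 0; first by rewrite mulr0 ltW.
by rewrite E1_gt0// mulrA expr2 mulVKf ?gt_eqF// xexpN.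
Qed.

(** This is exp(-s/(1-s)) for s < 1 and 0 afterwards; the factor e normalises it to 1 at s = 0. *)
Definition bump s : R := expR 1 * E (1 - s).
Definition bump1 s : R := - (expR 1 * E1 (1 - s)).
Definition bump2 s : R := expR 1 * E2 (1 - s).

Let is_derive_onem p s : is_derive s (1 : R) (fun s => flat p (1 - s)) (- flat (dflat p) (1 - s)).
Proof.
have H : is_derive s (1 : R) (fun s : R => 1 - s) (- 1).
  have := is_deriveB (is_derive_cst (1 : R) s (1 : R)) (is_derive_id s (1 : R)).
  by rewrite sub0r.
have := @is_derive1_comp R (flat p) (fun s => 1 - s) s _ _ (is_derive_flat p _) H.
by rewrite mulrN1.
Qed.

Lemma is_derive_bump s : is_derive s (1 : R) bump (bump1 s).
Proof.
have := is_deriveZ (expR 1) (is_derive_onem 1 s).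
by rewrite /bump1 -mulrN.
Qed.

Lemma is_derive_bump1 s : is_derive s (1 : R) bump1 (bump2 s).
Proof.
have := is_deriveN (is_deriveZ (expR 1) (is_derive_onem (dflat 1) s)).
by rewrite /bump2 /GRing.scale/= mulrN opprK.
Qed.

Lemma bump0 : bump 0 = 1.
Proof. by rewrite /bump subr0 E_gt0// invr1 -expRD subrr expR0. Qed.

Lemma bump_ge0 s : 0 <= bump s.
Proof. by rewrite mulr_ge0 ?expR_ge0 ?E_ge0. Qed.

Lemma bump_ge1 s : 1 <= s -> [/\ bump s = 0, bump1 s = 0 & bump2 s = 0].
Proof. by move=> s1; rewrite /bump /bump1 /bump2 !flat_le0 ?subr_le0// !mulr0 oppr0. Qed.

(** For s < 1, exp(s/(1-s)) >= 1 + s/(1-s) >= 1 + s, and 1/(1+s) <= 1 - s/2 on [0, 1]. *)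
Lemma onem_bump s : 0 <= s -> Num.min s 1 / 2 <= 1 - bump s.
Proof.
move=> s0; have [s1|s1] := leP 1 s.
  by have [-> _ _] := bump_ge1 s1; lra.
have s1' : 0 < 1 - s by lra.
have -> : bump s = (expR (s / (1 - s)))^-1.
  rewrite /bump E_gt0// -expRD -expRN; congr expR; field; lra.
have h : 1 + s <= expR (s / (1 - s)).
  apply: le_trans (expR_ge1Dx _); rewrite lerD2l ler_pdivlMr//; nra.
have : (expR (s / (1 - s)))^-1 <= (1 + s)^-1.
  by rewrite lef_pV2// posrE ?expR_gt0//; lra.
have : (1 + s)^-1 <= 1 - s / 2.
  by rewrite -[leLHS]mul1r ler_pdivrMr; [nra|lra].
lra.
Qed.

Lemma bump_le1 s : 0 <= s -> bump s <= 1.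
Proof. by move=> s0; have := onem_bump s0; rewrite minEle; case: ifP; lra. Qed.

Lemma bump1_bound s : - (4 * u) <= bump1 s <= 0.
Proof.
rewrite /bump1 lerN2 oppr_le0 mulr_ge0 ?expR_ge0 ?E1_ge0// andbT.
have := E1_le (1 - s); rewrite /u expRN => h.
by rewrite mulrC -ler_pdivlMr ?expR_gt0// (le_trans h)// expr2 mulrA.
Qed.

Lemma bump2_bound : exists2 C, 0 <= C & forall s, 0 <= s -> `|bump2 s| <= C.
Proof.
have [C C0 HC] := @flat_linear_bound R (dflat (dflat 1)).
exists (expR 1 * C); first by rewrite mulr_ge0 ?expR_ge0.
move=> s s0; have [s1|s1] := leP 1 s.
  by have [_ _ ->] := bump_ge1 s1; rewrite normr0 mulr_ge0 ?expR_ge0.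
rewrite /bump2 normrM ger0_norm ?expR_ge0// ler_wpM2l ?expR_ge0// (le_trans (HC _))//.
rewrite -[leRHS]mulr1 ler_wpM2l// exprn_ile1//; lra.
Qed.

End profile.

(** * The axial profile *)

Section axial_profile.
Context {R : realType}.
Implicit Types (p : {poly R}) (s t x : R).

Local Notation E := (@flat R 1).
Local Notation E1 := (@flat R (dflat 1)).
Local Notation E2 := (@flat R (dflat (dflat 1))).

(* [ax t = t * bump (cut t)] has slope 1 for |t| <= tau; the constants are chosen
   so that the slope stays above -9/10. *)
Definition tau : R := 100^-1.
(** Vanishes exactly for |t| <= tau. At distance 5 the flat function is at least 4/5, so the factor
    5/4 lifts [cut] to 1 once |t| >= 6, where the bump is 0. *)
Definition cut t := 5 / 4 * (E (t - tau) + E (- t - tau)).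
Definition cut1 t := 5 / 4 * (E1 (t - tau) - E1 (- t - tau)).
Definition cut2 t := 5 / 4 * (E2 (t - tau) + E2 (- t - tau)).
Definition ax t := t * bump (cut t).
Definition axb1 t := bump1 (cut t) * cut1 t.
Definition axb2 t := bump2 (cut t) * cut1 t ^+ 2 + bump1 (cut t) * cut2 t.
Definition ax1 t := bump (cut t) + t * axb1 t.
Definition ax2 t := 2 * axb1 t + t * axb2 t.

Let is_derive_shift p t : is_derive t (1 : R) (fun t => flat p (t - tau)) (flat (dflat p) (t - tau)).
Proof.
have H : is_derive t (1 : R) (fun s : R => s - tau) 1.
  have := is_deriveB (is_derive_id t (1 : R)) (is_derive_cst tau t (1 : R)).
  by rewrite subr0.
have := @is_derive1_comp R (flat p) (fun s => s - tau) t _ _ (is_derive_flat p _) H.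
by rewrite mulr1.
Qed.

Let is_derive_shiftN p t : is_derive t (1 : R) (fun t => flat p (- t - tau)) (- flat (dflat p) (- t - tau)).
Proof.
have H : is_derive t (1 : R) (fun s : R => - s - tau) (- 1).
  have := is_deriveB (is_deriveN (is_derive_id t (1 : R))) (is_derive_cst tau t (1 : R)).
  by rewrite subr0.
have := @is_derive1_comp R (flat p) (fun s => - s - tau) t _ _ (is_derive_flat p _) H.
by rewrite mulrN1.
Qed.

Let is_derive_cut t : is_derive t (1 : R) cut (cut1 t).
Proof. exact: is_deriveZ (is_deriveD (is_derive_shift 1 t) (is_derive_shiftN 1 t)). Qed.

Let is_derive_cut1 t : is_derive t (1 : R) cut1 (cut2 t).
Proof.
have := is_deriveZ (5 / 4) (is_deriveB (is_derive_shift (dflat 1) t) (is_derive_shiftN (dflat 1) t)).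
by rewrite opprK.
Qed.

Let is_derive_axb t : is_derive t (1 : R) (fun t => bump (cut t)) (axb1 t).
Proof. exact: (@is_derive1_comp R bump cut t _ _ (is_derive_bump _) (is_derive_cut t)). Qed.

Let is_derive_axb1 t : is_derive t (1 : R) axb1 (axb2 t).
Proof.
have H := @is_derive1_comp R bump1 cut t _ _ (is_derive_bump1 _) (is_derive_cut t).
apply: (is_derive_eq (is_deriveM H (is_derive_cut1 t))).
by rewrite /axb2 /GRing.scale/=; ring.
Qed.

Lemma is_derive_ax t : is_derive t (1 : R) ax (ax1 t).
Proof.
apply: (is_derive_eq (is_deriveM (is_derive_id t (1 : R)) (is_derive_axb t))).
by rewrite /ax1 /GRing.scale/=; ring.
Qed.

Lemma is_derive_ax1 t : is_derive t (1 : R) ax1 (ax2 t).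
Proof.
apply: (is_derive_eq (is_deriveD (is_derive_axb t) (is_deriveM (is_derive_id t (1 : R)) (is_derive_axb1 t)))).
by rewrite /ax2 /GRing.scale/=; ring.
Qed.

Lemma cut_ge0 t : 0 <= cut t.
Proof. by rewrite mulr_ge0 ?addr_ge0 ?E_ge0. Qed.

Let tau0 : 0 < tau. Proof. by rewrite invr_gt0. Qed.

Lemma cut_far t : 6 <= `|t| -> 1 <= cut t.
Proof.
move=> t6; have ? : tau <= 1 by rewrite /tau; lra.
have h1 := E_ge0 (t - tau); have h2 := E_ge0 (- t - tau); rewrite /cut.
move: t6; rewrite ler_normr => /orP[t6|t6].
  have h : 5 <= t - tau by lra.
  by have := E_ge h; lra.
have h : 5 <= - t - tau by lra.
by have := E_ge h; lra.
Qed.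

Lemma ax_far t : 6 <= `|t| -> [/\ ax t = 0, ax1 t = 0 & ax2 t = 0].
Proof.
move=> /cut_far/bump_ge1[b0 b1 b2].
by rewrite /ax /ax1 /ax2 /axb1 /axb2 b0 b1 b2 !(mul0r, mulr0, addr0).
Qed.

Lemma ax_near t : `|t| <= tau -> ax t = t /\ ax1 t = 1.
Proof.
rewrite ler_norml => /andP[h1 h2].
have c0 p : flat p (t - tau) = 0 by rewrite flat_le0// subr_le0.
have c1 p : flat p (- t - tau) = 0 by rewrite flat_le0//; lra.
have cut0 : cut t = 0 by rewrite /cut c0 c1 addr0 mulr0.
rewrite /ax /ax1 /axb1 cut0 bump0 mulr1; split => //.
by rewrite /cut1 c0 c1 subr0 !mulr0 addr0.
Qed.

Lemma cut_gt0 t : tau < `|t| -> 0 < cut t.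
Proof.
move=> tt; have h1 := E_ge0 (t - tau); have h2 := E_ge0 (- t - tau).
have h x : 0 < x -> 0 < E x by move=> x0; rewrite E_gt0// expR_gt0.
rewrite mulr_gt0//; move: tt; rewrite ltr_normr => /orP[tt|tt].
  by rewrite ltr_wpDr// h// subr_gt0.
by rewrite ltr_wpDl// h// subr_gt0.
Qed.

(** The sign holds because the bump decreases while [cut] grows with |t|. With u = 1/e, |bump1| <=
    4u, and writing t = (t - tau) + tau gives t E1(t - tau) <= u + 4 tau u^2; for u <= 0.41 and tau
    = 1/100 the product 5u (u + 4 tau u^2) is about 0.855. *)
Lemma ax_slope t : - (9 / 10) <= t * axb1 t <= 0.
Proof.
pose k t := t * E1 (t - tau).
have u0 : 0 < expR (- 1) :> R by exact: expR_gt0.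
have ku t' : 0 <= k t' <= expR (- 1) + tau * (4 * expR (- 1) ^+ 2).
  rewrite /k; have [h|h] := leP t' tau.
    rewrite flat_le0 ?subr_le0// mulr0 lexx/=; apply: addr_ge0; first exact: ltW.
    by apply: mulr_ge0; [exact: ltW|apply: mulr_ge0 => //; exact: sqr_ge0].
  have t'0 : 0 <= t' by rewrite ltW// (lt_trans tau0).
  rewrite mulr_ge0 ?E1_ge0//=.
  have := tE1_le (t' - tau).
  have : tau * E1 (t' - tau) <= tau * (4 * expR (- 1) ^+ 2) by rewrite ler_pM2l ?E1_le.
  lra.
have kk : 0 <= k t + k (- t) <= expR (- 1) + tau * (4 * expR (- 1) ^+ 2).
  have [/andP[a1 a2] /andP[b1 b2]] := (ku t, ku (- t)).
  have [h|h] := leP t tau.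
    have -> : k t = 0 by rewrite /k flat_le0 ?subr_le0// mulr0.
    by rewrite add0r b1 b2.
  have -> : k (- t) = 0 by have ? := tau0; rewrite /k flat_le0 ?mulr0//; lra.
  by rewrite addr0 a1 a2.
have -> : t * axb1 t = 5 / 4 * (bump1 (cut t) * (k t + k (- t))).
  by rewrite /axb1 /cut1 /k; ring.
have /andP[b1 b2] := bump1_bound (cut t); have /andP[k0 k1] := kk.
have us := @expRN1_small R; have ? := tau0.
set B := bump1 (cut t) in b1 b2 *; set K := k t + k (- t) in k0 k1 *.
set u := expR (- 1) in u0 k1 b1 us *.
have h1 : 0 <= - B * K by rewrite mulr_ge0// oppr_ge0.
have h2 : - B * K <= 4 * u * (u + tau * (4 * u ^+ 2)).
  by rewrite ler_pM// ?oppr_ge0// lerNl.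
have h3 : 4 * u * (u + tau * (4 * u ^+ 2)) <= 4 * (41 / 100) * (41 / 100 + tau * (4 * (41 / 100) ^+ 2)).
  apply: ler_pM.
  - by rewrite mulr_ge0// ltW.
  - by rewrite addr_ge0// ?mulr_ge0// ?sqr_ge0// ltW.
  - by rewrite ler_pM2l.
  - by rewrite lerD// !ler_pM2l// lerXn2r// nnegrE; [exact: ltW|lra].
by move: h2 h3; rewrite /tau => h2 h3; apply/andP; split; lra.
Qed.

Lemma ax1_bound t : - (9 / 10) <= ax1 t <= 1 - Num.min (cut t) 1 / 2.
Proof.
have /andP[h1 h2] := ax_slope t; have h3 := bump_ge0 (cut t).
have h4 := onem_bump (cut_ge0 t); rewrite /ax1; lra.
Qed.

(** The slope bound -9/10 keeps 1 + a' at least 1/10, so 1 - a'^2 is comparable to 1 - a'. *)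
Lemma onem_ax1_sq t : Num.min (cut t) 1 / 20 <= 1 - ax1 t ^+ 2.
Proof.
have /andP[h1 h2] := ax1_bound t.
have : 0 <= Num.min (cut t) 1 by rewrite minEle; case: ifP => // _; exact: cut_ge0.
set M := Num.min _ _ in h2 *; move=> M0.
have -> : 1 - ax1 t ^+ 2 = (1 - ax1 t) * (1 + ax1 t) by ring.
have : M / 2 * (1 / 10) <= (1 - ax1 t) * (1 + ax1 t) by apply: ler_pM; lra.
lra.
Qed.

End axial_profile.

Section axial_profile_bounds.
Context {R : realType}.
Implicit Types (p : {poly R}) (s t x : R).

Lemma flat_le_powR p e : 0 < e ->
  exists2 C, 0 <= C & forall t, `|flat p t| <= C * flat 1 t `^ (1 - e).
Proof.
move=> e0; have [C C0 HC] := flat_bound p e0; exists C => // t.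
have [t0|t0] := leP t 0; first by rewrite flat_le0// normr0 mulr_ge0// powR_ge0.
by rewrite E_gt0// HC.
Qed.

Lemma cut_le_powR p q e : 0 < e < 1 -> exists2 C, 0 <= C &
  forall t, `|flat p (t - tau)| + `|flat q (- t - tau)| <= C * cut t `^ (1 - e).
Proof.
move=> /andP[e0 e1]; have [C C0 HC] := flat_le_powR p e0.
have [D D0 HD] := flat_le_powR q e0; exists (C + D); first by rewrite addr_ge0.
move=> t; rewrite mulrDl; have h1 := E_ge0 (t - tau); have h2 := E_ge0 (- t - tau).
have e10 : 0 <= 1 - e by rewrite subr_ge0 ltW.
have c0 := cut_ge0 t.
apply: lerD.
  rewrite (le_trans (HC _))// ler_wpM2l// ge0_ler_powR// ?nnegrE//.
  by rewrite /cut; lra.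
rewrite (le_trans (HD _))// ler_wpM2l// ge0_ler_powR// ?nnegrE//.
by rewrite /cut; lra.
Qed.

(** Every term of a'' contains [cut1] or [cut2], each of order cut^(1-e); the remaining factors are
    bounded, and cut t < 1 gives |t| <= 6. *)
Lemma ax2_le_cut e : 0 < e < 1 -> exists2 C, 0 <= C &
  forall t, cut t < 1 -> `|ax2 t| <= C * cut t `^ (1 - e).
Proof.
move=> e01; have [C1 C10 H1] := cut_le_powR (dflat 1) (dflat 1) e01.
have [C2 C20 H2] := cut_le_powR (dflat (dflat 1)) (dflat (dflat 1)) e01.
have [D D0 HD] := @bump2_bound R.
have [D1 D10 HD1] : exists2 D1, 0 <= D1 & forall t, `|cut1 t| <= D1.
  exists (5 / 4 * (2 * (4 * expR (- 1) ^+ 2))).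
    by rewrite !mulr_ge0// sqr_ge0.
  move=> t; rewrite /cut1 normrM ger0_norm// ler_wpM2l//.
  rewrite (le_trans (ler_normB _ _))// !ger0_norm ?E1_ge0//.
  by have := E1_le (t - tau); have := E1_le (- t - tau); lra.
have B1 s : `|bump1 s| <= 2.
  have /andP[b1 b2] := bump1_bound s; have := @expRN1_small R.
  by rewrite ler_norml => h; apply/andP; split; lra.
exists (2 * (2 * (5 / 4 * C1)) + 6 * (D * (D1 * (5 / 4 * C1)) + 2 * (5 / 4 * C2))).
  by rewrite addr_ge0// !mulr_ge0// addr_ge0// !mulr_ge0.
move=> t ct; set P := cut t `^ (1 - e).
have P0 : 0 <= P by exact: powR_ge0.
have c1 : `|cut1 t| <= 5 / 4 * C1 * P.
  rewrite /cut1 normrM ger0_norm// -mulrA ler_wpM2l//.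
  exact: le_trans (ler_normB _ _) (H1 t).
have c2 : `|cut2 t| <= 5 / 4 * C2 * P.
  rewrite /cut2 normrM ger0_norm// -mulrA ler_wpM2l//.
  exact: le_trans (ler_normD _ _) (H2 t).
have t6 : `|t| <= 6.
  by have [//|/ltW/cut_far] := leP `|t| 6; rewrite leNgt ct.
have b1 : `|axb1 t| <= 2 * (5 / 4 * C1 * P) by rewrite /axb1 (normrM (bump1 _)); exact: ler_pM.
have b2 : `|axb2 t| <= D * (D1 * (5 / 4 * C1 * P)) + 2 * (5 / 4 * C2 * P).
  rewrite /axb2 expr2 (le_trans (ler_normD _ _))//.
  rewrite (normrM (bump2 _)) (normrM (bump1 _)) (normrM (cut1 t)).
  apply: lerD; apply: ler_pM => //; first by rewrite HD ?cut_ge0.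
  exact: ler_pM.
have : `|ax2 t| <= 2 * (2 * (5 / 4 * C1 * P)) +
    6 * (D * (D1 * (5 / 4 * C1 * P)) + 2 * (5 / 4 * C2 * P)).
  rewrite /ax2 (le_trans (ler_normD _ _))// (normrM 2) (normrM t) (ger0_norm (_ : 0 <= 2))//.
  by apply: lerD; [rewrite ler_wpM2l|exact: ler_pM].
by move=> h; rewrite (le_trans h)// le_eqVlt; apply/orP; left; apply/eqP; ring.
Qed.

(** If cut >= 1 then a'' = 0; otherwise cut <= 20 (1 - a'^2), which explains the factor 20^(1-e). *)
Lemma ax2_bound e : 0 < e < 1 -> exists2 C, 0 <= C &
  forall t, `|ax2 t| <= C * (1 - ax1 t ^+ 2) `^ (1 - e).
Proof.
move=> e01; have [C C0 HC] := ax2_le_cut e01.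
exists (C * 20 `^ (1 - e)); first by rewrite mulr_ge0// powR_ge0.
move=> t; have [ct|ct] := leP 1 (cut t).
  have [_ b1 b2] := bump_ge1 ct.
  by rewrite /ax2 /axb1 /axb2 b1 b2 !(mul0r, mulr0, addr0) normr0 !mulr_ge0// powR_ge0.
have := onem_ax1_sq t; rewrite (min_idPl (ltW ct)) => h.
have c0 := cut_ge0 t.
have h0 : 0 <= 1 - ax1 t ^+ 2 by apply: le_trans h; rewrite divr_ge0.
rewrite (le_trans (HC t ct))// -mulrA ler_wpM2l// -powRM//.
rewrite ge0_ler_powR ?nnegrE//; [lra|exact: mulr_ge0|lra].
Qed.

Lemma ax1_sq_lt1 t : tau < `|t| -> ax1 t ^+ 2 < 1.
Proof.
move=> /cut_gt0 c0; have := onem_ax1_sq t.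
have : 0 < Num.min (cut t) 1 by rewrite lt_min c0 ltr01.
lra.
Qed.

(** The rescaling c ax(t/c) with c = d/6: slopes are unchanged, the amplitude is at most 6c = d, and
    the factor 1/c in the second derivative goes into the constant C. *)
Lemma axial_profile (d : R) : 0 < d -> exists (a a1 a2 : R -> R) (T S : R),
  [/\ 0 < T, forall t : R, is_derive t (1 : R) a (a1 t) & forall t : R, is_derive t (1 : R) a1 (a2 t)] /\
  [/\ forall (m : nat) (i : 'I_m), elem (fun x : 'rV[R]_m => a (x ord0 i)),
      forall t, `|a t| <= d,
      forall t, S <= `|t| -> [/\ a t = 0, a1 t = 0 & a2 t = 0],
      forall t, `|t| <= T -> a t = t /\ a1 t = 1 &
      forall t, T < `|t| -> a1 t ^+ 2 < 1] /\
  (forall e, 0 < e < 1 -> exists2 C, 0 <= C &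
     forall t, `|a2 t| <= C * (1 - a1 t ^+ 2) `^ (1 - e)).
Proof.
move=> d0; pose c := d / 6; have c0 : 0 < c by rewrite divr_gt0.
have cn : c != 0 by rewrite gt_eqF.
have nE t : `|t / c| = `|t| / c by rewrite normrM normfV (gtr0_norm c0).
exists (fun t => c * ax (t / c)), (fun t => ax1 (t / c)), (fun t => c^-1 * ax2 (t / c)), (c * tau), (c * 6).
have tau0 : 0 < tau :> R by rewrite invr_gt0.
have dsc (t : R) : is_derive t (1 : R) (fun t : R => t / c) c^-1.
  have := is_deriveZ c^-1 (is_derive_id t (1 : R)).
  rewrite /GRing.scale/= mulr1; congr (is_derive _ _ _ _).
  by apply/funext => s; rewrite /= mulrC.
have dcomp (f f' : R -> R) : (forall t : R, is_derive t (1 : R) f (f' t)) ->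
    forall t : R, is_derive t (1 : R) (fun t => f (t / c)) (f' (t / c) * c^-1).
  by move=> df t; exact: (@is_derive1_comp R f (fun t => t / c) t _ _ (df _) (dsc t)).
split; [|split].
- split; first by rewrite mulr_gt0.
    move=> t; apply: (is_derive_eq (is_deriveZ c (dcomp _ _ (@is_derive_ax R) t))).
    by rewrite /GRing.scale/= mulrC mulfVK.
  by move=> t; rewrite mulrC; exact: dcomp (@is_derive_ax1 R) t.
- split.
  + move=> m i; apply: elem_mul; first exact: elem_cst.
    have ec : elem (fun x : 'rV[R]_m => x ord0 i / c).
      by apply: elem_mul; [exact: elem_coord|exact: elem_cst].
    apply: elem_mul => //; apply: elem_mul; first exact: elem_cst.
    apply: elem_flat; apply: elem_add; first exact: elem_cst.
    apply: elem_opp; apply: elem_mul; first exact: elem_cst.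
    apply: elem_add; apply: elem_flat; apply: elem_add; try exact: elem_cst.
      exact: ec.
    exact: elem_opp.
  + move=> t; rewrite (normrM c) (gtr0_norm c0); have -> : d = c * 6 by rewrite divfK.
    rewrite ler_pM2l//.
    have [/ax_far[-> _ _]|t6] := leP 6 `|t / c|; first by rewrite normr0.
    rewrite /ax normrM -[leRHS]mulr1 ler_pM ?(ltW t6)//.
    by rewrite ger0_norm ?bump_ge0 ?bump_le1 ?cut_ge0.
  + move=> t St; have : 6 <= `|t / c| by rewrite nE ler_pdivlMr// mulrC.
    by move=> /ax_far[-> -> ->]; rewrite !mulr0.
  + move=> t tT; have : `|t / c| <= tau by rewrite nE ler_pdivrMr// mulrC.
    by move=> /ax_near[-> ->]; rewrite mulrC mulfVK.
  + by move=> t Tt; apply: ax1_sq_lt1; rewrite nE ltr_pdivlMr// mulrC.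
move=> e /ax2_bound[C C0 HC]; exists (c^-1 * C); first by rewrite mulr_ge0// invr_ge0 ltW.
move=> t; rewrite normrM ger0_norm ?invr_ge0 ?(ltW c0)// -mulrA ler_wpM2l ?HC//.
by rewrite invr_ge0 ltW.
Qed.

End axial_profile_bounds.

(** * The transverse bump *)

Section transverse_profile.
Context {R : realType} {m : nat}.
Variables (l : nat) (it : 'I_m).
Hypothesis itl : (it : nat) = l.-1.
Hypothesis l1 : (0 < l)%N.
Implicit Types (f g : 'rV[R]_m -> R) (x : 'rV[R]_m) (i j : 'I_m).

Definition ysq x : R := \sum_(i < m | (i < l.-1)%N) x ord0 i ^+ 2.
Definition zsq x : R := \sum_(i < m | (l <= i)%N) x ord0 i ^+ 2.
(** A smooth nonnegative substitute for the squared distance to {|y| <= 1, z = 0}. The factor 2 is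
    more than enough to bring it above 1, where the bump vanishes, as soon as |y|^2 >= 6. *)
Definition transv x : R := zsq x + 2 * flat 1 (ysq x - 1).
Definition tbump x : R := bump (transv x).

Let elem_sq i : elem (fun x : 'rV[R]_m => x ord0 i ^+ 2).
Proof. by apply: elem_mul; exact: elem_coord. Qed.

Lemma elem_tbump : elem tbump.
Proof.
apply: elem_mul; first exact: elem_cst.
apply: elem_flat; apply: elem_add; first exact: elem_cst.
apply: elem_opp; apply: elem_add; first exact: elem_sum.
apply: elem_mul; first exact: elem_cst.
apply: elem_flat; apply: elem_add; last exact: elem_cst.
exact: elem_sum.
Qed.

Lemma zsq_ge0 x : 0 <= zsq x.
Proof. by apply: sumr_ge0 => i _; exact: sqr_ge0. Qed.

Lemma transv_ge0 x : 0 <= transv x.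
Proof. by rewrite addr_ge0 ?zsq_ge0// mulr_ge0// E_ge0. Qed.

Lemma tbump_ge0 x : 0 <= tbump x. Proof. exact: bump_ge0. Qed.

Lemma tbump_le1 x : tbump x <= 1. Proof. exact: bump_le1 (transv_ge0 x). Qed.

Lemma zsq_ge i x : (l <= i)%N -> x ord0 i ^+ 2 <= zsq x.
Proof.
move=> li; rewrite /zsq (bigD1 i)//= lerDl.
by apply: sumr_ge0 => j _; exact: sqr_ge0.
Qed.

Lemma ysq_ge i x : (i < l.-1)%N -> x ord0 i ^+ 2 <= ysq x.
Proof.
move=> li; rewrite /ysq (bigD1 i)//= lerDl.
by apply: sumr_ge0 => j _; exact: sqr_ge0.
Qed.

Lemma onem_tbump i x : (l <= i)%N -> Num.min (x ord0 i ^+ 2) 1 / 2 <= 1 - tbump x.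
Proof.
move=> li; apply: le_trans (onem_bump (transv_ge0 x)); rewrite ler_pM2r//.
rewrite le_min !ge_min lexx orbT andbT (le_trans (zsq_ge x li))//.
by rewrite lerDl mulr_ge0// E_ge0.
Qed.

Lemma tbump1 x : zsq x = 0 -> ysq x <= 1 -> tbump x = 1.
Proof.
move=> z0 y1; rewrite /tbump /transv z0 flat_le0 ?subr_le0//.
by rewrite mulr0 addr0 bump0.
Qed.

Lemma tbump_lt1 x : ~ (zsq x = 0 /\ ysq x <= 1) -> tbump x < 1.
Proof.
move=> H; have t0 : 0 < transv x.
  rewrite lt_def transv_ge0 andbT; apply/negP => /eqP t0; apply: H.
  have := zsq_ge0 x; have := E_ge0 (ysq x - 1); move: t0; rewrite /transv => t0 h1 h2.
  split; first by lra.
  have E0 : flat 1 (ysq x - 1) = 0 by lra.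
  rewrite leNgt; apply/negP; rewrite -subr_gt0 => h3; move: E0.
  by rewrite E_gt0// => /eqP; rewrite gt_eqF ?expR_gt0.
have := onem_bump (transv_ge0 x).
have : 0 < Num.min (transv x) 1 by rewrite lt_min t0 ltr01.
rewrite /tbump; lra.
Qed.

(** b does not depend on t, so its support is not compact; it is bounded in all directions but that
    of the axis. *)
Definition slab : set 'rV[R]_m := [set x | forall i, i != it -> `[-3, 3]%classic (x ord0 i)].

Lemma slab_closed : closed slab.
Proof.
rewrite (_ : slab = \bigcap_(i in [set i | i != it]) ((fun x : 'rV[R]_m => x ord0 i) @^-1` `[-3, 3]%classic)).
  apply: closed_bigI => i _; apply: (@preimage_closed _ _ (fun x : 'rV[R]_m => x ord0 i) `[-3, 3]%classic); last exact: interval_closed.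
  by move=> x _; exact: coord_continuous.
by apply/seteqP; split => x H i; exact: H.
Qed.

Lemma tbump_slab x : ~ slab x -> tbump x = 0.
Proof.
move=> xs; have [i [it0 xi]] : exists i, i != it /\ 3 < `|x ord0 i|.
  apply: contrapT => H; apply: xs => i it0; rewrite /= in_itv/= -ler_norml leNgt.
  by apply/negP => xi; apply: H; exists i.
have x9 : 9 <= x ord0 i ^+ 2.
  rewrite -[x ord0 i ^+ 2]real_normK ?num_real// (_ : 9 = 3 ^+ 2); last by lra.
  by rewrite lerXn2r// ?nnegrE// ltW.
have := E_ge0 (ysq x - 1); have := zsq_ge0 x => z0 E0.
suff : 1 <= transv x by move=> /bump_ge1[].
have [li|li] := leqP l i.
  by have := zsq_ge x li; rewrite /transv; lra.
have il : (i < l.-1)%N.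
  rewrite ltn_neqAle -ltnS prednK// li andbT -itl.
  by apply: contra it0 => /eqP/val_inj ->.
have := ysq_ge x il => y9.
have y5 : 5 <= ysq x - 1 by lra.
by have := E_ge y5; rewrite /transv; lra.
Qed.

Lemma tbump_line x (h : R) : tbump (h *: basis_row it + x) = tbump x.
Proof.
have E i : i != it -> (h *: basis_row it + x) ord0 i = x ord0 i.
  by move=> iit; rewrite !mxE eqxx (negbTE iit) mulr0 add0r.
rewrite /tbump /transv /zsq /ysq; congr (bump (_ + 2 * flat 1 (_ - 1))).
  apply: eq_bigr => i li; rewrite E//; apply/eqP => iit; move: li.
  by rewrite iit itl leqNgt prednK// leqnn.
apply: eq_bigr => i li; rewrite E//; apply/eqP => iit; move: li.
by rewrite iit itl ltnn.
Qed.

Lemma partial_line i g : (forall x (h : R), g (h *: basis_row it + x) = g x) ->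
  forall x (h : R), partial i g (h *: basis_row it + x) = partial i g x.
Proof.
move=> gl x h; rewrite /partial /derive.
rewrite (_ : (fun k : R => k^-1 *: ((g \o shift (h *: basis_row it + x)) (k *: basis_row i)
    - g (h *: basis_row it + x))) =
  fun k : R => k^-1 *: ((g \o shift x) (k *: basis_row i) - g x))//.
by apply/funext => k /=; rewrite gl addrCA gl.
Qed.

Lemma partial_line0 g : (forall x (h : R), g (h *: basis_row it + x) = g x) ->
  forall x, partial it g x = 0.
Proof.
move=> gl x; rewrite /partial /derive; apply: cvg_lim => //.
by apply: cvg_near_cst; near=> h; rewrite /= gl subrr scaler0.
Unshelve. all: by end_near. Qed.

(** Invariance along the axis moves any point of the slab to t = 0, into a compact box. *)
Lemma slab_bounded g : continuous g -> (forall x (h : R), g (h *: basis_row it + x) = g x) ->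
  (forall x, ~ slab x -> g x = 0) -> exists2 C, 0 <= C & forall x, `|g x| <= C.
Proof.
move=> cg gl gs; have [C C0 HC] := row_box_bounded 3 cg; exists C => // x.
have [xs|/gs ->] := pselect (slab x); last by rewrite normr0.
rewrite -(gl x (- x ord0 it)); apply: HC => i; rewrite !mxE eqxx /=.
have [->|iit] := eqVneq i it; first by rewrite mulr1 addNr in_itv/=; lra.
by rewrite mulr0 add0r; exact: xs.
Qed.

(** The first two bounds follow from compactness modulo the axis; the third is Glaeser's inequality
    for 1 - b >= 0. *)
Lemma tbump_derivatives : exists2 D, 0 <= D & forall i j x,
  [/\ `|partial i tbump x| <= D, `|partial i (partial j tbump) x| <= D &
      partial i tbump x ^+ 2 <= D * (1 - tbump x)].
Proof.
have et := elem_tbump.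
have H1 i : exists2 C, 0 <= C & forall x, `|partial i tbump x| <= C.
  apply: slab_bounded; first by apply: elem_continuous; exact: elem_partial.
  - by apply: partial_line; exact: tbump_line.
  - by apply: partial_supp; [exact: slab_closed|exact: tbump_slab].
have H2 i j : exists2 C, 0 <= C & forall x, `|partial i (partial j tbump) x| <= C.
  apply: slab_bounded.
  - by apply: elem_continuous; do 2!apply: elem_partial.
  - by do 2!apply: partial_line; exact: tbump_line.
  - by do 2!(apply: partial_supp; first exact: slab_closed); exact: tbump_slab.
have /boolp.choice[C1 HC1] i : exists C, 0 <= C /\ forall x, `|partial i tbump x| <= C.
  by have [C C0 HC] := H1 i; exists C.
have /boolp.choice[C2 HC2] (ij : 'I_m * 'I_m) :
    exists C, 0 <= C /\ forall x, `|partial ij.1 (partial ij.2 tbump) x| <= C.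
  by have [C C0 HC] := H2 ij.1 ij.2; exists C.
pose S1 := \sum_i C1 i; pose S2 := \sum_ij C2 ij.
have S10 : 0 <= S1 by apply: sumr_ge0 => i _; exact: (HC1 i).1.
have S20 : 0 <= S2 by apply: sumr_ge0 => i _; exact: (HC2 i).1.
have S1i i x : `|partial i tbump x| <= S1.
  rewrite /S1 (bigD1 i)//= (le_trans ((HC1 i).2 x))// lerDl.
  by apply: sumr_ge0 => j _; exact: (HC1 j).1.
have S2i i j x : `|partial i (partial j tbump) x| <= S2.
  rewrite /S2 (bigD1 (i, j))//= (le_trans ((HC2 (i, j)).2 x))// lerDl.
  by apply: sumr_ge0 => k _; exact: (HC2 k).1.
exists (S1 + 4 * S2); first by rewrite addr_ge0// mulr_ge0.
move=> i j x; split.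
- by rewrite (le_trans (S1i i x))// lerDl mulr_ge0.
- by rewrite (le_trans (S2i i j x))//; lra.
pose g x := 1 + - tbump x : R.
have eg : elem g by apply: elem_add; [exact: elem_cst|exact: elem_opp].
have pg k : partial k g = fun x => - partial k tbump x.
  rewrite /g partialD ?partial_cst ?partialN//; [|exact: elem_cst|exact: elem_opp].
  by apply/funext => y; rewrite add0r.
have := @glaeser_partial R m g S2 i S20 eg _ _ x.
rewrite pg partialN; last exact: elem_partial.
rewrite sqrrN => H; apply: (le_trans (H _ _)).
- by move=> y; rewrite subr_ge0 tbump_le1.
- by move=> y; rewrite normrN S2i.
- by rewrite ler_wpM2r ?subr_ge0 ?tbump_le1// lerDr.
Qed.

End transverse_profile.

(** * The product a(t) b(y, z): its defect and the estimates by the defect *)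

Section construction.
Context {R : realType} {m : nat}.
Variables (l : nat) (it : 'I_m).
Hypothesis itl : (it : nat) = l.-1.
Hypothesis l1 : (0 < l)%N.
Variables (a a1 a2 : R -> R) (D d : R).
Hypothesis da : forall t : R, is_derive t (1 : R) a (a1 t).
Hypothesis da1 : forall t : R, is_derive t (1 : R) a1 (a2 t).
Hypothesis ea : elem (fun x : 'rV[R]_m => a (x ord0 it)).
Hypothesis D0 : 0 <= D.
Hypothesis tbD : forall i j (x : 'rV[R]_m),
  [/\ `|partial i (tbump l) x| <= D, `|partial i (partial j (tbump l)) x| <= D &
      partial i (tbump l) x ^+ 2 <= D * (1 - tbump l x)].
Hypothesis ad : forall t, `|a t| <= d.
Hypothesis d1 : d <= 1.
Hypothesis dD : d ^+ 2 * (m%:R * D) <= 1 / 2.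
Hypothesis a1le : forall t, a1 t ^+ 2 <= 1.
Implicit Types (x : 'rV[R]_m) (i j : 'I_m).

Local Notation b := (@tbump R m l).
Local Notation bi i := (partial i b).
Local Notation bij i j := (partial i (partial j b)).
Local Notation delta i := ((i == it)%:R : R).

Definition light_fun x : R := a (x ord0 it) * b x.
Local Notation u := light_fun.

Let eb : elem b. Proof. exact: elem_tbump. Qed.
Let ebi i : elem (bi i). Proof. exact: elem_partial. Qed.

Lemma elem_light_fun : elem u.
Proof. exact: elem_mul. Qed.

Let partial_axial (g g' : R -> R) : (forall t : R, is_derive t (1 : R) g (g' t)) ->
  forall i, partial i (fun x => g (x ord0 it)) = fun x => g' (x ord0 it) * delta i.
Proof. by move=> dg i; rewrite (partial_comp i (elem_coord it) dg) partial_coord. Qed.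

Let ea1 : elem (fun x : 'rV[R]_m => a1 (x ord0 it)).
Proof.
have := elem_partial it ea; rewrite (partial_axial da); congr elem.
by apply/funext => x; rewrite eqxx mulr1.
Qed.

Lemma bit x : bi it x = 0.
Proof. exact: (@partial_line0 R m it b (@tbump_line R m l it itl l1) x). Qed.

Lemma biit i x : bij i it x = 0.
Proof.
rewrite (_ : partial it b = fun=> 0) ?partial_cst//.
by apply/funext => y; exact: bit.
Qed.

Lemma bitj j x : bij it j x = 0.
Proof.
have bl := @tbump_line R m l it itl l1.
exact: (@partial_line0 R m it (partial j b) (@partial_line R m it j b bl) x).
Qed.

Lemma partial_light i : partial i u =
  fun x => a (x ord0 it) * bi i x + b x * (a1 (x ord0 it) * delta i).
Proof. by rewrite partialM// (partial_axial da). Qed.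

Lemma partial2_light i j : partial i (partial j u) = fun x =>
  a (x ord0 it) * bij i j x + bi j x * (a1 (x ord0 it) * delta i) +
  (b x * (a2 (x ord0 it) * delta i * delta j) + a1 (x ord0 it) * delta j * bi i x).
Proof.
have ed : elem (fun _ : 'rV[R]_m => delta j) by exact: elem_cst.
have e1 : elem (fun x => a1 (x ord0 it) * delta j) by exact: elem_mul.
rewrite partial_light partialD; [|exact: elem_mul|exact: elem_mul].
rewrite partialM// (partial_axial da) partialM// partialM// (partial_axial da1) partial_cst.
apply/funext => x; move: (a _) (a1 _) (a2 _) (b x) (bi i x) (bi j x) (bij i j x) => *.
by ring.
Qed.

Definition normb2 x : R := \sum_i bi i x ^+ 2.
Definition hessb x j : R := \sum_i bi i x * bij i j x.
Definition hessbb x : R := \sum_j hessb x j * bi j x.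

Let sum_delta : \sum_i delta i = 1.
Proof. by rewrite (bigD1 it)//= eqxx big1 ?addr0// => i /negbTE ->. Qed.

(** b has no derivative along the axis and a only that one, so the two parts of Du are
    orthogonal. *)
Lemma dotp_grad_light x : dotp (grad u x) (grad u x) =
  a1 (x ord0 it) ^+ 2 * b x ^+ 2 + a (x ord0 it) ^+ 2 * normb2 x.
Proof.
rewrite /dotp (eq_bigr (fun i => a1 (x ord0 it) ^+ 2 * b x ^+ 2 * delta i +
    a (x ord0 it) ^+ 2 * bi i x ^+ 2)) => [|i _]; last first.
  rewrite !mxE partial_light; have [->|_] := eqVneq i it; rewrite ?bit;
    move: (a _) (a1 _) (b x) (bi i x) => * /=; ring.
rewrite big_split/= -!mulr_sumr; congr (_ + _).
by rewrite sum_delta mulr1.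
Qed.

Lemma grad_hess_light x j : (grad u x *m hessian u x) ord0 j =
  delta j * (a1 (x ord0 it) * a2 (x ord0 it) * b x ^+ 2 + a (x ord0 it) * a1 (x ord0 it) * normb2 x)
  + (a1 (x ord0 it) ^+ 2 * b x * bi j x + a (x ord0 it) ^+ 2 * hessb x j).
Proof.
set A := a (x ord0 it); set A1 := a1 (x ord0 it); set A2 := a2 (x ord0 it).
rewrite mxE (eq_bigr (fun i => A ^+ 2 * (bi i x * bij i j x) + A * A1 * delta j * bi i x ^+ 2 +
    (A1 ^+ 2 * b x * bi j x + A1 * A2 * b x ^+ 2 * delta j) * delta i)) => [|i _]; last first.
  rewrite !mxE partial2_light partial_light -/A -/A1 -/A2.
  have [->|_] := eqVneq i it; rewrite ?bit ?bitj;
    move: A A1 A2 (b x) (bi i x) (bi j x) (bij i j x) => * /=; ring.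
rewrite !big_split/= -!mulr_sumr.
rewrite sum_delta -/(normb2 x) -/(hessb x j).
by move: A A1 A2 (b x) (bi j x) (normb2 x) (hessb x j) => * /=; ring.
Qed.

Lemma hess_grad2_light x : dotp (grad u x *m hessian u x) (grad u x) =
  a1 (x ord0 it) ^+ 2 * a2 (x ord0 it) * b x ^+ 3 +
  2 * a (x ord0 it) * a1 (x ord0 it) ^+ 2 * b x * normb2 x + a (x ord0 it) ^+ 3 * hessbb x.
Proof.
set A := a (x ord0 it); set A1 := a1 (x ord0 it); set A2 := a2 (x ord0 it).
have hit : hessb x it = 0 by rewrite /hessb big1// => i _; rewrite biit mulr0.
rewrite /dotp (eq_bigr (fun j => A1 ^+ 2 * b x * A * bi j x ^+ 2 + A ^+ 3 * (hessb x j * bi j x) +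
    (A1 * A2 * b x ^+ 2 + A * A1 * normb2 x) * (A1 * b x) * delta j)) => [|j _]; last first.
  rewrite grad_hess_light mxE partial_light -/A -/A1 -/A2.
  have [->|_] := eqVneq j it; rewrite ?bit ?hit;
    move: A A1 A2 (b x) (bi j x) (normb2 x) (hessb x j) => * /=; ring.
rewrite !big_split/= -!mulr_sumr.
rewrite sum_delta -/(normb2 x) -/(hessbb x).
by move: A A1 A2 (b x) (normb2 x) (hessbb x) => * /=; ring.
Qed.

Lemma normb2_ge0 x : 0 <= normb2 x.
Proof. by apply: sumr_ge0 => i _; exact: sqr_ge0. Qed.

Lemma normb2_le x : normb2 x <= m%:R * D * (1 - b x).
Proof.
rewrite -mulrA mulr_natl -[X in _ *+ X]card_ord -sumr_const.
by apply: ler_sum => i _; have [_ _] := tbD i i x.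
Qed.

Local Notation defect := (lorentz u).

(** 1 - a'^2 b^2 = b^2 (1 - a'^2) + (1 - b^2) with 1 - b^2 >= 1 - b, and the choice of d makes a^2
    |Db|^2 at most half of 1 - b. *)
Lemma defect_ge x : b x ^+ 2 * (1 - a1 (x ord0 it) ^+ 2) + (1 - b x) / 2 <= defect x.
Proof.
rewrite /lorentz dotp_grad_light.
have b0 := tbump_ge0 l x; have b1 := tbump_le1 l x.
have n0 := normb2_ge0 x; have n1 := normb2_le x.
have A2 : a (x ord0 it) ^+ 2 <= d ^+ 2.
  by rewrite -[leLHS]real_normK ?num_real// lerXn2r// nnegrE (le_trans _ (ad 0)).
have h1 : a (x ord0 it) ^+ 2 * normb2 x <= d ^+ 2 * (m%:R * D * (1 - b x)).
  by rewrite ler_pM// sqr_ge0.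
have h2 : d ^+ 2 * (m%:R * D) * (1 - b x) <= 1 / 2 * (1 - b x).
  by rewrite ler_wpM2r ?subr_ge0.
have h3 : 0 <= b x * (1 - b x) by rewrite mulr_ge0 ?subr_ge0.
lra.
Qed.

Let axial_ge0 x : 0 <= b x ^+ 2 * (1 - a1 (x ord0 it) ^+ 2).
Proof. by rewrite mulr_ge0 ?sqr_ge0// subr_ge0. Qed.

Lemma defect_ge_onem x : (1 - b x) / 2 <= defect x.
Proof. by apply: le_trans (defect_ge x); rewrite lerDr. Qed.

Lemma defect_ge0 x : 0 <= defect x.
Proof.
by apply: le_trans (defect_ge_onem x); rewrite divr_ge0// subr_ge0 tbump_le1.
Qed.

Lemma defect_ge_axial x : b x ^+ 2 * (1 - a1 (x ord0 it) ^+ 2) <= defect x.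
Proof.
by apply: le_trans (defect_ge x); rewrite lerDl divr_ge0// subr_ge0 tbump_le1.
Qed.

Lemma defect_ge_coord i x : (l <= i)%N -> Num.min (x ord0 i ^+ 2) 1 / 4 <= defect x.
Proof.
move=> li; apply: le_trans (defect_ge_onem x).
by have := onem_tbump x li; lra.
Qed.

Section estimates.
Variables (S : R).
Hypothesis a2le : forall e : R, 0 < e < 1 ->
  exists2 C, 0 <= C & forall t, `|a2 t| <= C * (1 - a1 t ^+ 2) `^ (1 - e).
Local Notation F := defect.

Let aux x : [/\ 0 <= b x, b x <= 1, `|a (x ord0 it)| <= 1, `|a1 (x ord0 it)| <= 1 & 0 <= F x <= 1].
Proof.
split; [exact: tbump_ge0|exact: tbump_le1|exact: le_trans (ad _) d1| |].
  by rewrite -(@ler_pXn2r _ 2)// ?nnegrE// expr1n real_normK ?num_real.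
by rewrite defect_ge0 lorentz_le1.
Qed.

(** As b^2 <= 1, b^2 <= (b^2)^(1-e); the factor b^2 can thus be drawn into the power, where b^2 (1 -
    a'^2) <= F. *)
Lemma second_axial_le e : 0 < e < 1 ->
  exists2 C, 0 <= C & forall x, b x ^+ 2 * `|a2 (x ord0 it)| <= C * F x `^ (1 - e).
Proof.
move=> e01; have [C C0 aC] := a2le e01; exists C => // x.
have [b0 b1 _ _ /andP[F0 F1]] := aux x; have /andP[e0 e1] := e01.
have e1' : 0 <= 1 - e by lra.
have b2 : b x ^+ 2 <= (b x ^+ 2) `^ (1 - e).
  have [->|bn0] := eqVneq (b x) 0; first by rewrite expr0n/= powR_ge0.
  rewrite -[leLHS]powRr1 ?sqr_ge0// ger_powR//; last by lra.
  by rewrite exprn_gt0 ?lt_def ?bn0// exprn_ile1.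
apply: (@le_trans _ _ (b x ^+ 2 * (C * (1 - a1 (x ord0 it) ^+ 2) `^ (1 - e)))).
  by rewrite ler_wpM2l ?sqr_ge0.
rewrite mulrCA ler_wpM2l//.
apply: (@le_trans _ _ ((b x ^+ 2) `^ (1 - e) * (1 - a1 (x ord0 it) ^+ 2) `^ (1 - e))).
  by rewrite ler_wpM2r ?powR_ge0.
rewrite -powRM ?sqr_ge0 ?subr_ge0//.
apply: ge0_ler_powR; rewrite ?nnegrE ?defect_ge0//; exact: defect_ge_axial.
Qed.

Let bi_le i x : `|bi i x| <= Num.sqrt (2 * D) * Num.sqrt (F x).
Proof.
have [_ _ _ _ /andP[F0 _]] := aux x.
rewrite -sqrtrM ?mulr_ge0// -sqrtr_sqr ler_sqrt ?mulr_ge0//.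
have [_ _] := tbD i i x; move=> /le_trans; apply.
have := defect_ge_onem x => h.
have -> : 2 * D * F x = D * (2 * F x) by ring.
by rewrite ler_wpM2l//; lra.
Qed.

Let normb2_le_defect x : `|normb2 x| <= 2 * (m%:R * D) * F x.
Proof.
rewrite ger0_norm ?normb2_ge0//; apply: le_trans (normb2_le x) _.
have -> : 2 * (m%:R * D) * F x = m%:R * D * (2 * F x) by ring.
have := defect_ge_onem x => h.
by rewrite ler_wpM2l ?mulr_ge0//; lra.
Qed.

Let hessb_le x j : `|hessb x j| <= m%:R * (Num.sqrt (2 * D) * Num.sqrt (F x) * D).
Proof.
apply: le_trans (ler_norm_sum _ _ _) _.
rewrite mulr_natl -[X in _ *+ X]card_ord -sumr_const.
apply: ler_sum => i _; have h1 := bi_le i x; have [_ h2 _] := tbD i j x.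
by move: (bi i x) (bij i j x) h1 h2 => y z h1 h2; rewrite normrM ler_pM.
Qed.

Let hessbb_le x : `|hessbb x| <= m%:R * (m%:R * (2 * D ^+ 2)) * F x.
Proof.
have [_ _ _ _ /andP[F0 _]] := aux x.
have s1 := sqr_sqrtr F0; have s2 : Num.sqrt (2 * D) ^+ 2 = 2 * D by rewrite sqr_sqrtr ?mulr_ge0.
have -> : m%:R * (m%:R * (2 * D ^+ 2)) * F x = m%:R * (m%:R * (Num.sqrt (2 * D) * Num.sqrt (F x) * D)
    * (Num.sqrt (2 * D) * Num.sqrt (F x))).
  transitivity (m%:R * m%:R * (Num.sqrt (2 * D) ^+ 2 * D) * (Num.sqrt (F x)) ^+ 2).
    by rewrite s1 s2; move: (F x) => *; ring.
  by move: (Num.sqrt _) (Num.sqrt (F x)) => *; ring.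
apply: le_trans (ler_norm_sum _ _ _) _.
rewrite mulr_natl -[X in _ *+ X]card_ord -sumr_const.
apply: ler_sum => j _; have h1 := bi_le j x; have h2 := hessb_le x j.
by move: (bi j x) (hessb x j) h1 h2 => y z h1 h2; rewrite normrM ler_pM.
Qed.

(** Each term contains b^2 a'', |Db|^2, D_j b or D^2b(Db, .), of respective order F^(1/2) (taking e
    = 1/2), F, F^(1/2) and F^(1/2); the other factors are at most 1 in modulus, and F <= 1. *)
Lemma hess_grad_light_le : exists2 K, 0 <= K & forall x j,
  `|(grad u x *m hessian u x) ord0 j| <= K * Num.sqrt (F x).
Proof.
have [|C C0 aC] := @second_axial_le (1 / 2); first lra.
pose s0 := Num.sqrt (2 * D).
exists (C + 2 * (m%:R * D) + (s0 + m%:R * (s0 * D))) => [|x j].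
  by rewrite !addr_ge0 ?mulr_ge0 ?sqrtr_ge0.
have [b0 b1 a_1 a1_1 /andP[F0 F1]] := aux x.
set s := Num.sqrt (F x).
have s_ge0 : 0 <= s by exact: sqrtr_ge0.
have s_le1 : s <= 1 by rewrite -[1](@sqrtr1 R) ler_wsqrtr.
have Fs : F x <= s by rewrite -(sqr_sqrtr F0) -/s expr2 ler_piMl.
have A2 : b x ^+ 2 * `|a2 (x ord0 it)| <= C * s.
  by have := aC x; rewrite (_ : 1 - 1 / 2 = 2^-1) ?powR12_sqrt//; lra.
rewrite grad_hess_light.
have M1 (y z w : R) : `|y| <= 1 -> `|z| <= w -> `|y * z| <= w.
  by move=> y1 zw; rewrite normrM (le_trans _ zw)// ler_piMl.
have dl : `|delta j| <= 1 by case: (j == it); rewrite ?normr1 ?normr0.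
have b1' : `|b x| <= 1 by rewrite ger0_norm.
apply: le_trans (ler_normD _ _) _; rewrite 2!mulrDl; apply: lerD.
  apply: (M1) => //; apply: le_trans (ler_normD _ _) _; apply: lerD.
    rewrite -mulrA; apply: (M1) => //.
    by rewrite normrM mulrC (ger0_norm (sqr_ge0 _)).
  rewrite -mulrA; apply: (M1) => //; apply: (M1) => //.
  by apply: le_trans (normb2_le_defect x) _; rewrite ler_wpM2l ?mulr_ge0.
apply: le_trans (ler_normD _ _) _; rewrite mulrDl; apply: lerD.
  rewrite expr2 -!(mulrA (a1 _)); exact: (M1 _ _ _ a1_1 (M1 _ _ _ a1_1 (M1 _ _ _ b1' (bi_le j x)))).
rewrite expr2 -!mulrA; apply: (M1) => //; apply: (M1) => //.
apply: le_trans (hessb_le x j) _.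
by rewrite -/s -/s0 [X in _ <= X](_ : _ = m%:R * (s0 * s * D)) //; ring.
Qed.

(** Only the term with a'' suffers the loss e: |Db|^2 and D^2b(Db, Db) are of order F, which is at
    most F^(1-e). *)
Lemma hess_grad2_light_le e : 0 < e < 1 -> exists2 K, 0 <= K & forall x,
  `|dotp (grad u x *m hessian u x) (grad u x)| <= K * F x `^ (1 - e).
Proof.
move=> e01; have [C C0 aC] := second_axial_le e01.
exists (C + 2 * (2 * (m%:R * D)) + m%:R * (m%:R * (2 * D ^+ 2))) => [|x].
  by rewrite !addr_ge0 ?mulr_ge0 ?sqr_ge0.
have [b0 b1 a_1 a1_1 /andP[F0 F1]] := aux x.
have Fe : F x <= F x `^ (1 - e).
  have [->|Fn0] := eqVneq (F x) 0; first by rewrite powR_ge0.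
  rewrite -[leLHS]powRr1// ger_powR//; last by lra.
  by rewrite lt_def Fn0 F0 F1.
have M1 (y z w : R) : `|y| <= 1 -> `|z| <= w -> `|y * z| <= w.
  by move=> y1 zw; rewrite normrM (le_trans _ zw)// ler_piMl.
have b1' : `|b x| <= 1 by rewrite ger0_norm.
rewrite hess_grad2_light 2!(mulrDl _ _ (F x `^ (1 - e))).
apply: le_trans (ler_normD _ _) _; apply: lerD.
  apply: le_trans (ler_normD _ _) _; apply: lerD.
    rewrite (_ : _ * b x ^+ 3 = a1 (x ord0 it) * (a1 (x ord0 it) * (b x * (a2 (x ord0 it) * b x ^+ 2)))).
      refine (M1 _ _ _ a1_1 (M1 _ _ _ a1_1 (M1 _ _ _ b1' _))); apply: le_trans (aC x).
      by rewrite normrM mulrC (ger0_norm (sqr_ge0 _)).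
    by move: (a1 _) (b x) (a2 _) => *; ring.
  rewrite (_ : _ * normb2 x = 2 * (a (x ord0 it) * (a1 (x ord0 it) *
      (a1 (x ord0 it) * (b x * normb2 x))))); last first.
    by move: (a _) (a1 _) (b x) (normb2 x) => *; ring.
  have pos : 0 <= 2 * (m%:R * D) by rewrite !mulr_ge0.
  rewrite normrM gtr0_norm// -mulrA ler_pM2l//.
  exact: (M1 _ _ _ a_1 (M1 _ _ _ a1_1 (M1 _ _ _ a1_1 (M1 _ _ _ b1' (le_trans
    (normb2_le_defect x) (ler_wpM2l pos Fe)))))).
rewrite (_ : _ * hessbb x = a (x ord0 it) * (a (x ord0 it) * (a (x ord0 it) * hessbb x))); last first.
  by move: (a _) (hessbb x) => *; ring.
refine (M1 _ _ _ a_1 (M1 _ _ _ a_1 (M1 _ _ _ a_1 (le_trans (hessbb_le x) (ler_wpM2l _ Fe))))).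
by rewrite !mulr_ge0 ?sqr_ge0.
Qed.

End estimates.

End construction.

(** * The cylinder and the light segments that fill it *)

Section coordinates.
Context {R : realType} {m : nat}.
Variables (l : nat) (it : 'I_m).
Hypothesis itl : (it : nat) = l.-1.
Hypothesis l1 : (0 < l)%N.

Definition light_cylinder (T : R) : set 'rV[R]_m :=
  [set x | [/\ zsq l x = 0, ysq l x <= 1 & `|x ord0 it| <= T]].

Lemma light_cylinder_closed_cylinder T : 0 < T -> closed_cylinder l (light_cylinder T).
Proof.
move=> T0.
have ln : (l.-1 + 1 <= m)%N by rewrite addn1 -itl ltn_ord.
have lm : (l.-1 <= m)%N by rewrite (leq_trans _ ln)// leq_addr.
have winj : injective (widen_ord ln) by move=> i j /(congr1 val) ij; exact/val_inj.
(* The inclusion of the first l coordinates, in the order (y, t); l >= 1 identifies l.-1 + 1 with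
   l. *)
pose A : 'M[R]_(l.-1 + 1, m) := \matrix_(i, j) (widen_ord ln i == j)%:R.
have AE (w : 'rV[R]_(l.-1 + 1)) i : (w *m A) ord0 (widen_ord ln i) = w ord0 i.
  rewrite mxE (bigD1 i)//= mxE eqxx mulr1 big1 ?addr0// => k ki.
  by rewrite mxE (inj_eq winj) (negbTE ki) mulr0.
have A0 (w : 'rV[R]_(l.-1 + 1)) (j : 'I_m) : (l <= j)%N -> (w *m A) ord0 j = 0.
  move=> lj; rewrite mxE big1// => k _; rewrite mxE; case: eqP => [kj|]; last by rewrite mulr0.
  by move: lj; rewrite -kj /= leqNgt (leq_trans (ltn_ord k))// addn1 prednK.
pose iy (i : 'I_l.-1) : 'I_m := widen_ord lm i.
have iyE i : iy i = widen_ord ln (lshift 1 i) by exact/val_inj.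
have itE : it = widen_ord ln (rshift l.-1 ord0).
  by apply/val_inj; rewrite /= itl addn0.
have ysqE x : ysq l x = \sum_i x ord0 (iy i) ^+ 2.
  by rewrite /ysq (big_ord_narrow lm).
exists 0, A, 0, 1, (- T), T; split => //.
- apply/matrixP => i j; rewrite !mxE (bigD1 (widen_ord ln i))//= !mxE eqxx mul1r.
  rewrite big1 => [|k ki]; last by rewrite !mxE eq_sym (negbTE ki) mul0r.
  by rewrite addr0 (inj_eq winj) eq_sym.
- by rewrite gtrN.
- apply/seteqP; split=> [x [z0 y1 tT]|_ [[y t] /= [y1 tT] <-]].
    exists (\row_i x ord0 (iy i), x ord0 it) => /=.
      split; last by rewrite in_itv/= -ler_norml.
      rewrite subr0 /enorm -[1](@sqrtr1 R) ler_wsqrtr// (le_trans _ y1)// ysqE.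
      by apply: ler_sum => i _; rewrite !mxE expr2.
    rewrite add0r; apply/rowP => j; have [jl|lj] := ltnP j l; last first.
      rewrite A0//; apply/esym/eqP; rewrite -sqrf_eq0 eq_le sqr_ge0 andbT -z0.
      exact: zsq_ge.
    have jn : (j < l.-1 + 1)%N by rewrite addn1 prednK.
    have -> : j = widen_ord ln (Ordinal jn) by exact/val_inj.
    rewrite AE; case: (split_ordP (Ordinal jn)) => k ->.
      by rewrite row_mxEl mxE iyE.
    by rewrite row_mxEr (ord1 k) mxE eqxx mulr1n {1}itE.
  rewrite add0r; split.
  - rewrite /zsq big1// => j lj; by rewrite A0// expr0n.
  - rewrite ysqE; apply: (@le_trans _ _ (dotp y y)).
      by apply: ler_sum => i _; rewrite iyE AE row_mxEl expr2.
    have d0 : 0 <= dotp y y by apply: sumr_ge0 => i _; rewrite -expr2 sqr_ge0.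
    by move: y1; rewrite subr0 /enorm -{1}[1](@sqrtr1 R) ler_sqrt.
  - by rewrite itE AE row_mxEr mxE eqxx mulr1n ler_norml; move: tT; rewrite in_itv.
Qed.

End coordinates.

Section light_function_segments.
Context {R : realType} {m : nat}.
Variables (l : nat) (it : 'I_m).
Hypothesis itl : (it : nat) = l.-1.
Hypothesis l1 : (0 < l)%N.
Variables (u : 'rV[R]_m -> R) (T : R).
Hypothesis T0 : 0 < T.
Hypothesis eu : elem u.
Hypothesis F0 : forall x, 0 <= lorentz u x.
Hypothesis FT : forall x, lorentz u x = 0 -> light_cylinder l it T x.
Hypothesis uT : forall x, light_cylinder l it T x -> u x = x ord0 it.

Let shift_axis t (x : 'rV[R]_m) := (t - x ord0 it) *: basis_row it + x.

Let shift_axis_it t x : shift_axis t x ord0 it = t.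
Proof. by rewrite !mxE !eqxx mulr1 subrK. Qed.

Let shift_axis_cylinder t x : `|t| <= T -> light_cylinder l it T x ->
  light_cylinder l it T (shift_axis t x).
Proof.
move=> tT [z0 y1 xT]; have E i : i != it -> shift_axis t x ord0 i = x ord0 i.
  by move=> iit; rewrite !mxE eqxx (negbTE iit) mulr0 add0r.
split; last by rewrite shift_axis_it.
- rewrite -z0; apply: eq_bigr => i li; rewrite E//; apply/eqP => iit; move: li.
  by rewrite iit itl leqNgt prednK// leqnn.
- rewrite (le_trans _ y1)//; apply: ler_sum => i li; rewrite E//; apply/eqP => iit.
  by move: li; rewrite iit itl ltnn.
Qed.

(** On the cylinder u is the coordinate t, so along the full axial segment through x, of length 2T,
    u changes by exactly 2T. *)
Lemma light_segment_axis x : light_cylinder l it T x ->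
  light_segment u (shift_axis (- T) x) (shift_axis T x) /\
  segment (shift_axis (- T) x) (shift_axis T x) x.
Proof.
move=> xC; have [_ _ xT] := xC.
have TT : `|T| <= T by rewrite gtr0_norm.
have TN : `|- T| <= T by rewrite normrN.
split.
  split.
    apply/eqP => /(congr1 (fun y : 'rV[R]_m => y ord0 it)).
    by rewrite !shift_axis_it; have := T0; lra.
  rewrite !uT; do ?exact: shift_axis_cylinder.
  rewrite !shift_axis_it /enorm /shift_axis.
  rewrite opprD addrACA subrr addr0 -scalerBl /dotp (bigD1 it)//= big1 => [|i iit]; last first.
    by rewrite !mxE eqxx (negbTE iit) !mulr0.
  rewrite !mxE !eqxx mulr1 addr0 -expr2 sqrtr_sqr; congr (`|_|); ring.
exists ((x ord0 it + T) / (2 * T)).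
  rewrite /= in_itv/=; move: xT; rewrite ler_norml => /andP[h1 h2].
  have T2 : 0 < 2 * T by rewrite mulr_gt0.
  by apply/andP; split; [apply: divr_ge0; lra|rewrite ler_pdivrMr//; lra].
rewrite /shift_axis !scalerDr !scalerA addrACA -scalerDl -[X in _ + X]scalerDl subrK scale1r.
rewrite [X in X *: _](_ : _ = 0) ?scale0r ?add0r//.
by field; rewrite gt_eqF.
Qed.

Lemma light_set_cylinder : light_set u = light_cylinder l it T.
Proof.
apply/seteqP; split=> [x /(light_set_subset eu F0)/FT//|x xC].
have [h1 h2] := light_segment_axis xC.
by apply: subset_closure; exists (shift_axis (- T) x, shift_axis T x).
Qed.

(** For l = 1 there are no coordinates y and z vanishes, so the axial segments through all points of
    the cylinder coincide with the one through 0. *)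
Lemma light_cylinder_segment : l = 1%N -> exists x y,
  light_segment u x y /\ light_cylinder l it T = segment x y.
Proof.
move=> l1'.
have C0 : light_cylinder l it T 0.
  split; last by rewrite mxE normr0 ltW.
  - by rewrite /zsq big1// => i _; rewrite mxE expr0n.
  - by rewrite /ysq big1 ?ler01// => i _; rewrite mxE expr0n.
exists (shift_axis (- T) 0), (shift_axis T 0).
have [h1 _] := light_segment_axis C0; split=> //; apply/seteqP; split=> x xC.
  have E t : shift_axis t 0 = shift_axis t x.
    apply/rowP => i; rewrite !mxE eqxx/=; have [->|iit] := eqVneq i it.
      by rewrite !mulr1 subr0 addr0 subrK.
    have li : (l <= i)%N.
      rewrite l1' lt0n; apply/eqP => i0; move/eqP: iit; apply; apply/val_inj.
      by rewrite /= i0 itl l1'.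
    have [z0 _ _] := xC; have := zsq_ge x li; rewrite z0 => h.
    have /eqP : x ord0 i ^+ 2 = 0 by apply/eqP; rewrite eq_le h sqr_ge0.
    by rewrite sqrf_eq0 => /eqP ->; rewrite !mulr0.
  by rewrite !E; case: (light_segment_axis xC).
apply: FT; exact: light_segment_lorentz h1 xC.
Qed.

End light_function_segments.

Theorem theorem1p7 (R : realType) (m l : nat) (hm : (3 <= m)%N)
    (hl1 : (1 <= l)%N) (hl2 : (l <= m - 2)%N) :
  exists u : 'rV[R]_m -> R,
    [/\ smooth u, compact_supp_in setT u & forall x, enorm (grad u x) <= 1] /\
    [/\ (* (i) *)
        [/\ closed_cylinder l (light_set u),
            (l = 1%N -> exists x y, light_segment u x y /\
                                    light_set u = segment x y) &
            forall x, ~ light_set u x -> enorm (grad u x) < 1],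
        (* (ii) *)
        exists rho : 'rV[R]_m -> R,
          [/\ forall q : R, 1 <= q < (m - l)%:R ->
                in_Lp q%:E setT (EFin \o rho),
              weak_equation setT (grad u) rho &
              forall Omega, bounded_domain Omega -> supp u `<=` Omega ->
                weak_solution Omega rho u] &
        (* (iii) *)
        forall q : R, 1 <= q < (m - l)%:R ->
          [/\ in_Lp_loc q%:E setT (weight (grad u)),
              in_Lp q%:E setT
                (fun x => weight (grad u) x * (hsnorm (hessian u x))%:E)%E,
              in_Lp q%:E setT
                (fun x => weight (grad u) x ^+ 2 *
                          (enorm (grad u x *m hessian u x))%:E)%E &
              in_Lp q%:E setT
                (fun x => weight (grad u) x ^+ 3 *
                  (dotp (grad u x *m hessian u x) (grad u x))%:E)%E]].
Proof.
have lm2 : (l.+2 <= m)%N by move: hl2; rewrite leq_subRL ?(ltnW hm)// add2n.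
have lm := ltnW lm2; have ltm : (l.-1 < m)%N := leq_ltn_trans (leq_pred l) lm.
pose it := Ordinal ltm; have itl : (it : nat) = l.-1 by [].
have [D D0 tbD] := @tbump_derivatives R m l it itl hl1.
(* Chosen so that d <= 1 and d m D <= 1/2; then d^2 m D <= 1/2 as well. *)
pose d : R := (1 + 2 * (m%:R * D))^-1.
have mD0 : 0 <= m%:R * D by rewrite mulr_ge0.
have d0 : 0 < d by rewrite invr_gt0; lra.
have d1 : d <= 1 by rewrite invf_le1; lra.
have dD : d ^+ 2 * (m%:R * D) <= 1 / 2.
  have dd : d * (1 + 2 * (m%:R * D)) = 1 by rewrite mulVf// gt_eqF//; lra.
  have h : d * (m%:R * D) <= 1 / 2 by lra.
  by apply: le_trans h; rewrite expr2 -mulrA ler_piMl// mulr_ge0// ltW.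
have [a [a1 [a2 [T [S [[T0 da da1] [[ea ad aS aT a1T] a2le]]]]]]] := axial_profile d0.
have a1le t : a1 t ^+ 2 <= 1.
  by case: (leP `|t| T) => [/aT[_ ->]|/a1T/ltW//]; rewrite expr1n.
pose u := light_fun l it a.
have eu : elem u by apply: elem_light_fun; exact: ea.
have F0 := defect_ge0 itl hl1 da (ea m it) tbD ad dD a1le.
have Fl x i := @defect_ge_coord _ _ _ _ itl hl1 _ _ _ _ da (ea m it) tbD ad dD a1le i x.
have gradF := hess_grad_light_le itl hl1 da da1 (ea m it) D0 tbD ad d1 dD a1le a2le.
have thirdF e := @hess_grad2_light_le _ _ _ _ itl hl1 _ _ _ _ _ da da1 (ea m it) D0 tbD ad d1 dD a1le a2le e.
rewrite -/u in F0 Fl gradF thirdF.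
(* S bounds the support of a along the axis, and 3 that of b in the other coordinates. *)
pose M := `|S| + 3; have M1 : 1 <= M by rewrite /M; have := normr_ge0 S; lra.
have uM x : ~ row_box M x -> u x = 0.
  move=> xM; rewrite /u /light_fun; have [/aS[-> _ _]|tS] := leP S `|x ord0 it|.
    by rewrite mul0r.
  rewrite [X in _ * X](tbump_slab itl hl1) ?mulr0// => xs; apply: xM => i.
  rewrite /= in_itv/= -ler_norml; have [->|/xs] := eqVneq i it.
    by rewrite (le_trans (ltW tS))// (le_trans (ler_norm S))// lerDl.
  by rewrite /= in_itv/= -ler_norml => /le_trans; apply; rewrite lerDr.
(* If F = 0, both nonnegative terms of its lower bound vanish: the second gives b = 1, hence z = 0
   and |y| <= 1, and then the first gives a'^2 = 1, hence |t| <= T. *)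
have FT x : lorentz u x = 0 -> light_cylinder l it T x.
  move=> Fx; have := defect_ge itl hl1 da (ea m it) tbD ad dD x; rewrite -/u Fx.
  set B := tbump l x => H.
  have B1 : B <= 1 by exact: tbump_le1.
  have A1 := a1le (x ord0 it).
  have BA : 0 <= B ^+ 2 * (1 - a1 (x ord0 it) ^+ 2) by rewrite mulr_ge0 ?sqr_ge0 ?subr_ge0.
  have B_1 : B = 1 by apply/eqP; rewrite eq_le B1; lra.
  have [z0 y1] : zsq l x = 0 /\ ysq l x <= 1.
    by apply: contrapT => /tbump_lt1; rewrite -/B B_1 ltxx.
  split=> //; rewrite leNgt; apply/negP => /a1T.
  by move: H; rewrite B_1 expr1n; lra.
have uT x : light_cylinder l it T x -> u x = x ord0 it.
  by move=> [z0 y1 xT]; rewrite /u /light_fun (aT _ xT).1 [X in _ * X]tbump1// mulr1.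
have LS := light_set_cylinder itl hl1 T0 eu F0 FT uT.
have su : compact (supp u).
  apply: (subclosed_compact _ (@row_box_compact R m M)); first exact: closed_closure.
  rewrite /supp closureE => x; apply; split; first exact: row_box_closed.
  by move=> y /= uy; apply: contrapT => /uM uy0; move: uy; rewrite uy0 eqxx.
exists u; split.
  split; [exact: elem_smooth|by split|exact: enorm_grad_le1].
split.
- rewrite LS; split.
  + exact: light_cylinder_closed_cylinder.
  + exact: (light_cylinder_segment itl hl1 T0 eu F0 FT uT).
  + move=> x xC; have Fx : 0 < lorentz u x.
      by rewrite lt_def F0 andbT; apply/eqP => /FT.
    by rewrite /enorm -[1](@sqrtr1 R) ltr_sqrt//; move: Fx; rewrite subr_gt0.
- exists (density u); split.
  + by move=> q; exact: (in_Lp_density lm M1 eu uM Fl thirdF).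
  + exact: (weak_equation_density lm M1 eu uM F0 Fl thirdF lm2).
  + by move=> Omega; exact: (weak_solution_density lm M1 eu uM F0 Fl thirdF lm2).
- move=> q qk; split.
  + exact: (in_Lp_loc_weight lm eu F0 Fl qk).
  + exact: (in_Lp_weight_hessian lm M1 eu uM F0 Fl qk).
  + exact: (in_Lp_weight2_hess_grad lm M1 eu uM F0 Fl gradF qk).
  + exact: (in_Lp_weight3_third lm M1 eu uM F0 Fl thirdF qk).
Qed.
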